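(* Let $q_1,q_2\in L_{1,1}$ and let $I_1(k),I_2(k)$ be the corresponding $I$-functions. If $I_1(k)=I_2(k)$ for all $k>0$, then $q_1=q_2$.
   Context: $\mathbb{R}_+=[0,\infty)$. $L_{1,1}$ is the set of real-valued functions $q$ on $\mathbb{R}_+$ with $\int_0^\infty(1+x)|q(x)|\,dx<\infty$ and $q\in L^2(0,a)$ for every $a<\infty$. For $q\in L_{1,1}$ and $\operatorname{Im}k\ge0$, the Jost solution $f(x,k)$ is the unique solution of $-f''+q(x)f=k^2f$, $x>0$, with $f(x,k)=e^{ikx}+o(1)$ as $x\to+\infty$. The Jost function is $f(k):=f(0,k)$, and the $I$-function is $I(k):=\dfrac{f'(0,k)}{f(k)}$, where prime denotes $d/dx$. *)

(* Defs.v *)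
(* MathComp with MathComp-Analysis and real-closed *)
From HB Require Import structures.
From mathcomp Require Import all_boot all_order all_algebra.
From mathcomp Require Import all_classical all_reals all_analysis.
From mathcomp Require Import complex.

Set Implicit Arguments.
Unset Strict Implicit.
Unset Printing Implicit Defensive.

Import Order.TTheory GRing.Theory Num.Theory.
Import numFieldNormedType.Exports.

Local Open Scope classical_set_scope.
Local Open Scope ring_scope.

Section Definitions.
Variable R : realType.
Implicit Types (q F : R -> R) (f : R -> R[i]) (k z : R[i]) (x : R).

Local Notation mu := (@lebesgue_measure R).
Local Notation RE := (@complex.Re R).
Local Notation IM := (@complex.Im R).

(* Functions on [0, +oo[ are represented by functions on R whose values at
   negative arguments are ignored. *)
Definition L11 q : Prop :=
  [/\ measurable_fun (`[0, +oo[ : set R) q,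
      (\int[mu]_(x in `[0%R, +oo[) ((1 + x) * `|q x|)%:E < +oo)%E
    & forall a : R, (\int[mu]_(x in `]0%R, a[) (q x ^+ 2)%:E < +oo)%E].

(* Derivative of a function on [0, +oo[: two-sided at x > 0, one-sided
   (from the right) at x = 0. *)
Definition diff_quot_Rp F x : set_system R :=
  (F y - F x) / (y - x) @[y --> within `[0, +oo[ x^'].

Definition derivable_Rp F x : Prop := cvg (diff_quot_Rp F x).

Definition derive_Rp F x : R := lim (diff_quot_Rp F x).

Definition absolutely_continuous_on (a b : R) F : Prop :=
  forall e : R, 0 < e -> exists2 d : R, 0 < d &
    forall (n : nat) (s t : 'I_n -> R),
      (forall i, a <= s i /\ s i <= t i /\ t i <= b) ->
      trivIset [set: 'I_n] (fun i => `]s i, t i[%classic) ->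
      \sum_(i < n) (t i - s i) < d ->
      \sum_(i < n) `|F (t i) - F (s i)| < e.

Definition cderivable f x : Prop :=
  derivable_Rp (RE \o f) x /\ derivable_Rp (IM \o f) x.

Definition cderive f x : R[i] :=
  Complex (derive_Rp (RE \o f) x) (derive_Rp (IM \o f) x).

Definition cabsolutely_continuous_on (a b : R) f : Prop :=
  absolutely_continuous_on a b (RE \o f) /\
  absolutely_continuous_on a b (IM \o f).

Definition cexp z : R[i] :=
  real_complex R (expR (RE z)) * Complex (cos (IM z)) (sin (IM z)).

Definition plane_wave k x : R[i] :=
  cexp (Complex 0 1 * k * real_complex R x).

(* Since q is only locally integrable, - f'' + q f = k^2 f is understood in the
   usual (Caratheodory) sense: f' exists on [0, +oo[ and is locally absolutely
   continuous, and the equation holds almost everywhere. *)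
Definition schrodinger_solution q k f : Prop :=
  [/\ forall x, 0 <= x -> cderivable f x,
      forall b : R, 0 < b -> cabsolutely_continuous_on 0 b (cderive f)
    & {ae mu, forall x, 0 < x ->
        cderivable (cderive f) x /\
        - cderive (cderive f) x + real_complex R (q x) * f x = k ^+ 2 * f x}].

(* f(x) = e^{ikx} + o(e^{ikx}) as x --> +oo, with |e^{ikx}| = e^{- x Im k}.
   For real k this is f(x) = e^{ikx} + o(1); for Im k > 0 the relative form is
   the one that determines f, since o(1) would admit every decaying solution. *)
Definition jost_asymptotics k f : Prop :=
  expR (IM k * x) * Normc.normc (f x - plane_wave k x) @[x --> +oo] --> (0 : R).

Definition is_jost_solution q k f : Prop :=
  schrodinger_solution q k f /\ jost_asymptotics k f.

(* For q in L11 and 0 <= Im k the Jost solution exists and is unique on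
   [0, +oo[, the only values on which jost_function and I_function depend. *)
Definition jost_solution q k : R -> R[i] :=
  xget (fun=> 0) [set f | is_jost_solution q k f].

Definition jost_function q k : R[i] := jost_solution q k 0.

Definition I_function q k : R[i] :=
  cderive (jost_solution q k) 0 / jost_function q k.

End Definitions.

(* Main.v *)
(* Write p = q1 - q2 and let f1, f2 be the Jost solutions. The Wronskian
   identity turns I1(k) = I2(k) into the orthogonality relation
   \int_0^oo p(x) f1(x, k) f2(x, k) dx = 0 for all k > 0, and it remains to see
   that the products f1 f2 are complete.

   The operator taking exp(i k y) to f_j(x, k) is of the form "identity plus
   Volterra". Its kernel is never constructed: applied to a trigonometric
   polynomial psi, it satisfies the d'Alembert equation
     U(x, r) = psi(r) + \int_x^oo q(t) \int_0^(t-x) U(t, r + s) ds dt,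
   and comparison with a supersolution gives
     |U(x, r) - psi(r)| <= C \int_0^oo sigma(x + s) |psi(r + s)| ds,
   where sigma(x) = \int_x^oo |q|. Composing the operators of q1 and q2, the
   orthogonality relation becomes |\int p psi| <= \int H |psi| for all
   trigonometric polynomials psi, where H(y) <= B \int_0^y |p|.

   This inequality survives bounded pointwise limits of psi, and indicators of
   intervals are iterated limits of this kind: apply x |-> x (3 - x^2) / 2
   repeatedly to sin(k (y - a)), which converges to its sign, and let k tend
   to 0. Hence |p(y)| <= B \int_0^y |p| almost everywhere, so p = 0. *)
Require Import Defs.
From HB Require Import structures.
From mathcomp Require Import all_boot all_order all_algebra.
From mathcomp Require Import all_classical all_reals all_analysis.
From mathcomp Require Import complex.
From mathcomp Require Import measurable_realfun.
From mathcomp Require Import ring lra.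

Set Implicit Arguments.
Unset Strict Implicit.
Unset Printing Implicit Defensive.

Import Order.TTheory GRing.Theory Num.Theory.
Import numFieldNormedType.Exports.

Local Open Scope classical_set_scope.
Local Open Scope ring_scope.

(** * Integrals *)

Section Integrals.
Variable R : realType.
Implicit Types (h g F G : R -> R) (a b x y : R).
Local Notation mu := (@lebesgue_measure R).

(** The data concern real k > 0 only, so every complex object is split into a pair of real ones: for
    real k the equation decouples, and the complex orthogonality relation becomes two real ones,
    which supply the free choice of cosine and sine coefficients. Frequencies are doubled because f1
    f2 behaves like exp(2ikx). The constant C of the comparison depends on q alone: it comes from a
    weight that turns all Volterra operators of q, whatever k, into contractions by 1/2, so no
    information about psi enters. Two operators can be composed without their kernels because, at a
    fixed x, the image of a trigonometric polynomial in r is again one, with each coefficient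
    multiplied by exp(-ikx) f(x,k). The bound on H by the mass of p on [0, y] expresses causality:
    the comparison kernels are bounded and supported on s >= 0. The inequality for psi is not
    additive in psi, so differences of sign functions have to be formed before passing to the limit.
    Potentials are extended by 0 to negative arguments, so that Tonelli and translations can be used
    on the whole line. *)

Definition L1 h : Prop := mu.-integrable setT (EFin \o h).

Definition tail h x : R := \int[mu]_(t in `[x, +oo[) h t.

Lemma L1_measurable h : L1 h -> measurable_fun setT h.
Proof. by move=> /integrableP[/measurable_EFinP]. Qed.

Lemma L1D h g : L1 h -> L1 g -> L1 (fun x => h x + g x).
Proof. by move=> ih ig; exact: (integrableD measurableT ih ig). Qed.

Lemma L1Z c h : L1 h -> L1 (fun x => c * h x).
Proof. by move=> ih; exact: (integrableZl measurableT c ih). Qed.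

Lemma L1N h : L1 h -> L1 (fun x => - h x).
Proof. by move=> ih; exact: (integrableN ih). Qed.

Lemma L1B h g : L1 h -> L1 g -> L1 (fun x => h x - g x).
Proof. by move=> ih /L1N; exact: L1D. Qed.

Lemma L1_abs h : L1 h -> L1 (fun x => `|h x|).
Proof. exact: integrable_norm. Qed.

Lemma L1_le h g : measurable_fun setT h -> (forall x, `|h x| <= g x) ->
  L1 g -> L1 h.
Proof.
move=> mh hg; apply: le_integrable => //; first exact/measurable_EFinP.
by move=> x _ /=; rewrite lee_fin (le_trans (hg x))// ler_norm.
Qed.

Lemma L1M h g M : measurable_fun setT g -> (forall x, `|g x| <= M) ->
  L1 h -> L1 (fun x => h x * g x).
Proof.
move=> mg gM ih; apply: (@L1_le _ (fun x => M * `|h x|)).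
- by apply: measurable_funM => //; exact: L1_measurable.
- by move=> x; rewrite normrM mulrC ler_wpM2r.
- exact/L1Z/L1_abs.
Qed.

Lemma L1S (A : set R) h : measurable A -> L1 h ->
  mu.-integrable A (EFin \o h).
Proof. by move=> mA; exact: integrableS. Qed.

Lemma le_tail h g x : L1 h -> L1 g -> (forall t, x <= t -> h t <= g t) ->
  tail h x <= tail g x.
Proof.
move=> ih ig hg; apply: le_Rintegral; [by []|exact: L1S|exact: L1S|].
by move=> t; rewrite /= in_itv/= andbT; exact: hg.
Qed.

Lemma eq_tail h g x : (forall t, x <= t -> h t = g t) -> tail h x = tail g x.
Proof.
by move=> hg; apply: eq_Rintegral => t; rewrite inE/= in_itv/= andbT; exact: hg.
Qed.

Lemma norm_tail_le h x : L1 h -> `|tail h x| <= tail (fun t => `|h t|) x.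
Proof. by move=> ih; apply: le_normr_Rintegral => //; exact: L1S. Qed.

Lemma tail_ge0 h x : (forall t, 0 <= h t) -> 0 <= tail h x.
Proof. by move=> h0; apply: Rintegral_ge0 => *; exact: h0. Qed.

Lemma tailD h g x : L1 h -> L1 g ->
  tail (fun t => h t + g t) x = tail h x + tail g x.
Proof. by move=> ih ig; apply: RintegralD => //; exact: L1S. Qed.

Lemma tailB h g x : L1 h -> L1 g ->
  tail (fun t => h t - g t) x = tail h x - tail g x.
Proof. by move=> ih ig; apply: RintegralB => //; exact: L1S. Qed.

Lemma tailZ c h x : L1 h -> tail (fun t => c * h t) x = c * tail h x.
Proof. by move=> ih; apply: RintegralZl => //; exact: L1S. Qed.

Lemma tail_split h x y : L1 h -> x <= y ->
  tail h x = \int[mu]_(t in `[x, y[) h t + tail h y.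
Proof.
move=> ih xy; rewrite /tail -Rintegral_setU//; last 2 first.
- by apply: L1S => //; exact: measurableU.
- apply/disj_setPLR => t /=; rewrite !in_itv/= andbT.
  by move=> /andP[_ ty]; apply/negP; rewrite -ltNge.
congr (Rintegral _ _ _); apply/seteqP; split => t /=; rewrite !in_itv/= !andbT.
- by move=> xt; have [ty|yt] := ltP t y; [left; rewrite xt|right].
- by case=> [/andP[]//|]; exact: le_trans.
Qed.

Lemma tailB_itv h x y : L1 h -> x <= y ->
  tail h x - tail h y = \int[mu]_(t in `[x, y[) h t.
Proof. by move=> ih xy; rewrite (tail_split ih xy) addrK. Qed.

Lemma tail_nonincreasing h x y : L1 h -> (forall t, 0 <= h t) -> x <= y ->
  tail h y <= tail h x.
Proof.
move=> ih h0 xy; rewrite (tail_split ih xy) lerDr.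
by apply: Rintegral_ge0 => *; exact: h0.
Qed.

(** Turns [tail] into an integral from [-oo], the form to which the Lebesgue differentiation theorem
    is applied. *)
Lemma tailE h x : L1 h ->
  tail h x = \int[mu]_t h t - \int[mu]_(t in `]-oo, x]) h t.
Proof.
move=> ih; rewrite -Rintegral_itv_bndo_bndc; last exact: L1S.
apply/eqP; rewrite eq_sym subr_eq addrC /tail -Rintegral_setU//; last 2 first.
- by apply: L1S => //; exact: measurableU.
- apply/disj_setPLR => t /=; rewrite !in_itv/= andbT => tx.
  by apply/negP; rewrite -ltNge.
apply/eqP; congr (Rintegral _ _ _); apply/seteqP; split => t //= _.
by rewrite !in_itv/= andbT; have [tx|yt] := ltP t x; [left|right].
Qed.

Lemma ae_is_derive_tail h : L1 h ->
  {ae mu, forall x, is_derive x 1 (tail h) (- h x)}.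
Proof.
move=> ih.
have lh : locally_integrable setT h.
  by apply: open_integrable_locally => //; exact: openT.
have ihy y : mu.-integrable `]-oo, y] (EFin \o h) by exact: L1S.
have := FTC1Ny ihy lh.
apply: filterS; first exact: (ae_filter_ringOfSetsType mu).
move=> x [dF F'].
have dF' : is_derive x 1 (fun x => \int[mu]_(t in `]-oo, x]) h t) (h x).
  by apply: DeriveDef => //; rewrite -F' derive1E.
rewrite (_ : tail h = fun x => \int[mu]_t h t - \int[mu]_(t in `]-oo, x]) h t).
  have := is_deriveB (is_derive_cst (\int[mu]_t h t) x 1) dF'.
  by rewrite sub0r.
by apply/funext => y; rewrite tailE.
Qed.

Lemma L1_dominated (f_ : nat -> R -> R) h g :
  (forall n, measurable_fun setT (f_ n)) ->
  (forall x, f_ ^~ x @ \oo --> h x) -> L1 g ->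
  (forall n x, `|f_ n x| <= g x) ->
  L1 h /\ forall A, measurable A ->
    \int[mu]_(x in A) f_ n x @[n --> \oo] --> \int[mu]_(x in A) h x.
Proof.
move=> mf fh ig fg.
have mh : measurable_fun setT h.
  by apply: (measurable_fun_cvg mf) => // x _; exact: fh.
have ih : L1 h.
  apply: L1_le ig => // x.
  have fhx : `|f_ n x| @[n --> \oo] --> `|h x|.
    by apply: cvg_norm; exact: fh.
  rewrite -(cvg_lim (@Rhausdorff R) fhx).
  apply: limr_le; first by apply/cvg_ex; exists `|h x|.
  by apply: nearW => n; exact: fg.
split => // A mA.
have igA : mu.-integrable A (EFin \o g) by exact: L1S.
have := @dominated_cvg _ _ R mu A mA (fun n => EFin \o f_ n) (EFin \o h)
   (EFin \o g).
move=> dc; apply: fine_cvg; rewrite fineK; last first.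
  by apply: integrable_fin_num => //; apply: L1S.
apply: dc => //.
- by move=> n; apply/measurable_EFinP; exact: (measurable_funTS (mf n)).
- by move=> x _; apply: cvg_EFin; [exact: nearW|exact: fh].
- by move=> n x _; rewrite lee_fin; exact: fg.
Qed.

Lemma measurable_patch (A : set R) h : measurable A -> measurable_fun setT h ->
  measurable_fun setT (h \_ A).
Proof.
by move=> mA mh; apply/(measurable_restrictT _ _).1 => //; exact: measurable_funTS.
Qed.

Lemma norm_patch_le (A : set R) h x : `|(h \_ A) x| <= `|h x|.
Proof. by rewrite patchE; case: ifPn => // _; rewrite normr0. Qed.

Lemma L1_patch (A : set R) h : measurable A -> L1 h -> L1 (h \_ A).
Proof.
move=> mA ih; apply: (L1_le _ (norm_patch_le A h)); last exact: L1_abs.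
by apply: measurable_patch => //; exact: L1_measurable.
Qed.

Lemma tail_cvg0 h : L1 h -> tail h x @[x --> +oo] --> (0 : R).
Proof.
move=> ih; apply/cvg_pinftyP => u uoo.
have [] := @L1_dominated (fun n => h \_ `[u n, +oo[) (cst 0) (fun x => `|h x|).
- by move=> n; apply: measurable_patch => //; exact: L1_measurable.
- move=> x; apply: cvg_near_cst.
  have /cvgryPgt/(_ x) := uoo; apply: filterS => n xu.
  by rewrite patchE memNset//= in_itv/= andbT; apply/negP; rewrite -ltNge.
- exact: L1_abs.
- by move=> n x; exact: norm_patch_le.
move=> _ /(_ setT measurableT); rewrite Rintegral_cst// mul0r.
by apply: cvg_trans; apply: near_eq_cvg; apply: nearW => n; rewrite [RHS]Rintegral_mkcond.
Qed.

Lemma subset_Rintegral (A B : set R) h : measurable A -> measurable B ->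
  A `<=` B -> L1 h -> (forall x, 0 <= h x) ->
  \int[mu]_(x in A) h x <= \int[mu]_(x in B) h x.
Proof.
move=> mA mB AB ih h0; apply: fine_le.
- by apply: integrable_fin_num => //; exact: L1S.
- by apply: integrable_fin_num => //; exact: L1S.
- apply: ge0_subset_integral => //; last by move=> x _; rewrite lee_fin.
  apply/measurable_EFinP; apply: (measurable_funTS (L1_measurable ih)).
Qed.

(** Truncation: by dominated convergence the part of [|h|] above some height n has integral below e
    / 2; the remaining part is at most n + 1, and [d] makes its integral over [A] smaller than e /
    2. *)
Lemma L1_abs_cont h e : L1 h -> 0 < e -> exists2 d, 0 < d &
  forall A, measurable A -> (mu A < d%:E)%E -> \int[mu]_(x in A) `|h x| < e.
Proof.
move=> ih e0.
pose f_ n := (fun x => `|h x|) \_ [set x | n%:R < `|h x|].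
have mh := L1_measurable ih.
have mnh : measurable_fun setT (fun x => `|h x|) by exact: measurableT_comp.
have mS n : measurable [set x | n%:R < `|h x|].
  rewrite -[X in measurable X]setTI.
  by apply: (@measurable_fun_ltr _ _ R setT (cst n%:R) (fun x => `|h x|)).
have [] := @L1_dominated f_ (cst 0) (fun x => `|h x|).
- by move=> n; exact: measurable_patch.
- move=> x; apply: cvg_near_cst; exists (Num.bound `|h x|) => // n /= bn.
  rewrite /f_ patchE memNset//=; apply/negP; rewrite -leNgt.
  by rewrite (le_trans (ltW (archi_boundP (normr_ge0 _))))// ler_nat.
- exact: L1_abs.
- by move=> n x; rewrite (le_trans (norm_patch_le _ _ _))// normr_id.
move=> _ /(_ setT measurableT); rewrite Rintegral_cst// mul0r.
move=> /cvgr0Pnorm_lt /(_ _ (divr_gt0 e0 (ltr0Sn R 1))) [n _ /(_ n (leqnn n))] /=.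
rewrite ger0_norm; last first.
  by apply: Rintegral_ge0 => x _; rewrite /f_ patchE; case: ifPn.
move=> fne; exists (e / 2 / n.+1%:R); first by rewrite !divr_gt0.
move=> A mA Ad.
have if_ : L1 (f_ n) by apply: L1_patch => //; exact: L1_abs.
have muA : (fine (mu A) < e / 2 / n.+1%:R)%R.
  by rewrite -lte_fin fineK// ge0_fin_numE// (lt_trans Ad)// ltry.
have icst : mu.-integrable A (EFin \o cst n.+1%:R).
  apply: measurable_bounded_integrable => //; first by rewrite (lt_trans Ad)// ltry.
  by exists n.+1%:R; split => // M /ltW nM x _; rewrite /= ger0_norm.
apply: (@le_lt_trans _ _ (\int[mu]_(x in A) (f_ n x + n.+1%:R))).
  apply: le_Rintegral => //.
  - by apply: L1S => //; exact: L1_abs.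
  - exact: (integrableD mA (L1S mA if_) icst).
  - move=> x Ax; rewrite /f_ patchE; case: ifPn => [_|]; first by rewrite lerDl.
    by rewrite notin_setE/= => /negP; rewrite -leNgt add0r => /le_trans; apply; rewrite ler_nat.
rewrite RintegralD//; last exact: L1S.
rewrite Rintegral_cst// [ltRHS](splitr e) ltrD//; last first.
  by rewrite mulrC -ltr_pdivlMr.
apply: le_lt_trans fne; apply: subset_Rintegral => // x.
by rewrite /f_ patchE; case: ifPn.
Qed.

End Integrals.

(** * Absolute continuity *)

Section AbsolutelyContinuous.
Variable R : realType.
Implicit Types (h g F G : R -> R) (a b x y : R).
Local Notation mu := (@lebesgue_measure R).

(** The supremum of the points where [Q] holds satisfies [Q] by the left hypothesis, and the right
    hypothesis excludes that it lies below [b]. *)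
Lemma real_induction (Q : R -> Prop) a b : a <= b -> Q a ->
  (forall s, a < s <= b -> exists2 r, 0 < r &
     forall x, a <= x < s -> s - r < x -> Q x -> Q s) ->
  (forall s, a <= s < b -> Q s -> exists2 y, s < y <= b & Q y) ->
  Q b.
Proof.
move=> ab Qa Ql Qr.
pose S := [set x | a <= x <= b /\ Q x].
have Sa : S a by split; rewrite ?lexx.
have ubS : ubound S b by move=> x [/andP[]].
have hsS : has_sup S by split; [exists a | exists b].
have as_ : a <= sup S by apply: ub_le_sup => //; exists b.
have sb : sup S <= b by apply: ge_sup => //; exists a.
have Qs : Q (sup S).
  have [<-//|nas] := eqVneq a (sup S).
  have {nas}as_ : a < sup S by rewrite lt_neqAle nas.
  have [|r r0 Qlr] := Ql (sup S); first by rewrite as_.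
  have [x [/andP[ax xb] Qx] rx] := sup_adherent r0 hsS.
  have [<-//|nxs] := eqVneq x (sup S).
  apply: (Qlr x) => //; rewrite ax lt_neqAle nxs/=.
  by apply: ub_le_sup; [exists b|split => //; rewrite ax].
have [<-//|nsb] := eqVneq (sup S) b.
have [|y /andP[sy yb] Qy] := Qr (sup S) _ Qs; first by rewrite as_ lt_neqAle nsb.
suff : y <= sup S by rewrite leNgt sy.
apply: ub_le_sup; first by exists b.
by split => //; rewrite yb (le_trans as_ (ltW sy)).
Qed.

Lemma mu_bigsetU_itv n (s t : 'I_n -> R) :
  (forall i, s i <= t i) ->
  trivIset [set: 'I_n] (fun i => `]s i, t i[%classic) ->
  mu (\big[setU/set0]_(i < n) `]s i, t i[%classic) = (\sum_(i < n) (t i - s i))%:E.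
Proof.
move=> st tr; rewrite measure_bigsetU_ord// -sumEFin; apply: eq_bigr => i _.
apply: (eq_trans (lebesgue_measure_itv `]s i, t i[)).
rewrite /= lte_fin; case: ltP => //= ts.
by rewrite (@le_anti _ _ (t i) (s i)) ?subrr// ts st.
Qed.

(** The increments are integrals over disjoint intervals, so their sum is at most the integral of
    [|h|] over a set of small measure. *)
Lemma ac_tail h a b : L1 h -> absolutely_continuous_on a b (tail h).
Proof.
move=> ih e e0; have [d d0 hd] := L1_abs_cont ih e0.
exists d => // n s t st tr std.
pose A := \big[setU/set0]_(i < n) `]s i, t i[%classic.
have mA : measurable A by exact: bigsetU_measurable.
have {std}Ad : (mu A < d%:E)%E.
  rewrite /A mu_bigsetU_itv// => i; first by have [_ []] := st i.
apply: le_lt_trans (hd _ mA Ad).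
have ia := L1_abs ih.
rewrite -lee_fin -sumEFin /Rintegral fineK; last first.
  by apply: integrable_fin_num => //; exact: (L1S mA ia).
rewrite /A ge0_integral_bigsetU//.
- apply: lee_sum => i _; have [_ [sti _]] := st i.
  rewrite distrC tailB_itv// EFin_normr_Rintegral//; last exact: L1S.
  rewrite (le_trans (le_abse_integral _ _ _))//.
    by apply/measurable_EFinP; apply: (measurable_funTS (L1_measurable ih)).
  rewrite integral_itv_bndoo//.
  by apply/measurable_EFinP; apply: (measurable_funTS (L1_measurable ia)).
- exact: index_enum_uniq.
- exact: sub_trivIset tr.
- by apply/measurable_EFinP; apply: (measurable_funTS (L1_measurable ia)).
Qed.

Lemma ac_lipschitz F a b M : 0 <= M ->
  (forall x y, a <= x -> x <= y -> y <= b -> `|F y - F x| <= M * (y - x)) ->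
  absolutely_continuous_on a b F.
Proof.
(* The 1 keeps the divisor positive when [M = 0]. *)
move=> M0 lip e e0; exists (e / (M + 1)); first by rewrite divr_gt0// ltr_wpDl.
move=> n s t st _ std.
apply: (@le_lt_trans _ _ (M * \sum_(i < n) (t i - s i))).
  rewrite mulr_sumr; apply: ler_sum => i _.
  by have [? [? ?]] := st i; exact: lip.
apply: (@le_lt_trans _ _ ((M + 1) * \sum_(i < n) (t i - s i))).
  rewrite ler_wpM2r ?lerDl//; apply: sumr_ge0 => i _.
  by rewrite subr_ge0; have [_ []] := st i.
by rewrite mulrC -ltr_pdivlMr// ltr_wpDl.
Qed.

Lemma acD F G a b : absolutely_continuous_on a b F ->
  absolutely_continuous_on a b G ->
  absolutely_continuous_on a b (fun x => F x + G x).
Proof.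
move=> aF aG e e0; have e20 : 0 < e / 2 by rewrite divr_gt0.
have [d1 d10 h1] := aF _ e20; have [d2 d20 h2] := aG _ e20.
exists (Num.min d1 d2); first by rewrite lt_min d10.
move=> n s t st tr; rewrite lt_min => /andP[sd1 sd2].
rewrite [ltRHS](splitr e).
apply: le_lt_trans (ltrD (h1 n s t st tr sd1) (h2 n s t st tr sd2)).
rewrite -big_split/=; apply: ler_sum => i _.
by rewrite opprD addrACA ler_normD.
Qed.

Lemma acM F G a b M : 0 < M -> (forall x, a <= x <= b -> `|F x| <= M) ->
  (forall x, a <= x <= b -> `|G x| <= M) ->
  absolutely_continuous_on a b F -> absolutely_continuous_on a b G ->
  absolutely_continuous_on a b (fun x => F x * G x).
Proof.
move=> M0 FM GM aF aG e e0.
have e20 : 0 < e / 2 / M by rewrite !divr_gt0.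
have [d1 d10 h1] := aF _ e20; have [d2 d20 h2] := aG _ e20.
exists (Num.min d1 d2); first by rewrite lt_min d10.
move=> n s t st tr; rewrite lt_min => /andP[sd1 sd2].
have {h1 h2} := ltrD (h1 n s t st tr sd1) (h2 n s t st tr sd2).
rewrite -mulrDl -splitr ltr_pdivlMr//; apply: le_lt_trans.
rewrite -big_split/= mulr_suml; apply: ler_sum => i _.
have [asi [sti tib]] := st i.
rewrite (_ : _ - _ = G (t i) * (F (t i) - F (s i)) + F (s i) * (G (t i) - G (s i))); last by ring.
rewrite (le_trans (ler_normD _ _))// !normrM mulrDl.
rewrite lerD// mulrC ler_wpM2l//.
- by rewrite GM// (le_trans asi sti).
- by rewrite FM// asi (le_trans sti tib).
Qed.

(** For a single interval and tolerance 1, absolute continuity bounds each increment over a length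
    of at most d / 2 by 1, and finitely many such steps lead from [a] to any point. *)
Lemma ac_bounded F a b : absolutely_continuous_on a b F ->
  exists2 M, 0 < M & forall x, a <= x <= b -> `|F x| <= M.
Proof.
move=> aF; have [d d0 hd] := aF _ (ltr01 : 0 < 1 :> R).
have d20 : 0 < d / 2 by rewrite divr_gt0.
have step x y : a <= x -> x <= y -> y <= b -> y - x <= d / 2 ->
    `|F y - F x| < 1.
  move=> ax xy yb yx.
  have := hd 1%N (fun=> x) (fun=> y).
  rewrite !big_ord1; apply.
  - by [].
  - by move=> i j _ _ _; rewrite !ord1.
  - by rewrite (le_lt_trans yx)// gtr_pMr// invf_lt1// ltr1n.
have claim n x : a <= x <= b -> x <= a + n%:R * (d / 2) -> `|F x - F a| <= n%:R.
  elim: n x => [|n ih] x /andP[ax xb].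
    rewrite mul0r addr0 => xa; have -> : x = a by apply/eqP; rewrite eq_le xa.
    by rewrite subrr normr0.
  move=> xn; have [xa|ax'] := leP x (a + d / 2).
    apply: (@le_trans _ _ 1); last by rewrite ler1n.
    by apply/ltW/step => //; rewrite lerBlDl.
  rewrite (_ : _ - _ = (F x - F (x - d / 2)) + (F (x - d / 2) - F a)); last by ring.
  rewrite (le_trans (ler_normD _ _))// -[n.+1]add1n natrD lerD//.
  - apply/ltW/step => //.
    + by rewrite lerBrDr ltW.
    + by rewrite gerBl ltW.
    + by rewrite opprB addrC subrK.
  - apply: ih; last first.
      by rewrite lerBlDr (le_trans xn)// -natr1 mulrDl mul1r addrA.
    by rewrite lerBrDr (ltW ax')/= (le_trans _ xb)// gerBl ltW.
pose n := Num.bound ((b - a) / (d / 2)).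
exists (n%:R + `|F a| + 1); first by rewrite ltr_wpDl// addr_ge0.
move=> x xab; rewrite -[F x](subrK (F a)) (le_trans (ler_normD _ _))//.
rewrite -addrA lerD//; last by rewrite lerDl.
apply: claim => //; move/andP: xab => [ax xb].
rewrite -lerBlDl -ler_pdivrMr// (le_trans _ (ltW (archi_boundP _)))//.
- by rewrite ler_pM2r ?invr_gt0// lerB.
- by rewrite divr_ge0 ?subr_ge0 ?(le_trans ax xb)// ltW.
Qed.

Lemma is_derive_dist F x l e : is_derive x 1 F l -> 0 < e ->
  exists2 r, 0 < r &
    forall y, `|y - x| < r -> `|F y - F x - l * (y - x)| <= e * `|y - x|.
Proof.
move=> [dF <-] e0.
have /cvgrPdist_le /(_ _ e0) := dF.
move=> [r /= r0 hr]; exists r => // y yr.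
have [->|yx] := eqVneq y x; first by rewrite !subrr mulr0 subr0 normr0 mulr0.
have := hr (y - x); rewrite /= sub0r normrN subr_eq0 => /(_ yr yx).
rewrite /GRing.scale/= mulr1 subrK.
have yx0 : y - x != 0 by rewrite subr_eq0.
rewrite -(ler_pM2r (_ : 0 < `|y - x|)) ?normr_gt0// -normrM mulrBl.
by rewrite mulrAC mulVf// mul1r distrC.
Qed.

(* The exceptional null set lies in an open set [O] of small measure; real
   induction covers [a, b] by intervals on which [G] is almost constant and
   intervals inside [O], on which absolute continuity bounds the variation. *)
Lemma ac_derive0 G a b : a <= b -> absolutely_continuous_on a b G ->
  {ae mu, forall x, a < x < b -> is_derive x 1 G 0} -> G b = G a.
Proof.
move=> ab aG [N [mN N0 subN]].
suff bound e : 0 < e -> `|G b - G a| <= e * (b - a) + e.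
  apply/eqP; rewrite -subr_eq0 -normr_le0; apply/ler_addgt0Pr => e e0.
  have k0 : 0 < b - a + 1 by rewrite ltr_wpDl// subr_ge0.
  rewrite add0r (le_trans (bound _ (divr_gt0 e0 k0)))//.
  by rewrite -[X in _ + X]mulr1 -mulrDr divfK// gt_eqF.
move=> e0; have [d d0 hd] := aG _ e0.
(* The derivative is known only inside the interval, so the endpoints join the exceptional set. *)
pose N' := N `|` [set a; b].
have mN' : measurable N' by apply: measurableU => //; exact: measurableU.
have N'0 : mu N' = 0%E.
  apply: null_set_setU => //; first exact: measurableU.
  by apply: countable_lebesgue_measure0; exact: finite_set_countable.
have [|O [oO NO muO]] := @lebesgue_regularity_outer _ N' d mN' _ d0.
  by rewrite [X in (X < _)%E]N'0 ltry.
have mO : measurable O by exact: open_measurable.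
have {}muO : (mu O < d%:E)%E.
  rewrite -(setDUK NO) measureU//; last first.
  - by rewrite setDIK.
  - exact: measurableD.
  by rewrite [X in (X + _)%E]N'0 add0e.
(* Invariant of the induction: slope at most [e], up to the variation over finitely many intervals
   inside [O]. Keeping these in increasing order makes them disjoint. *)
pose Q x := exists n (s t : nat -> R),
  [/\ forall i, (i < n)%N -> a <= s i /\ s i <= t i /\ t i <= x,
      forall i, (i < n)%N -> `]s i, t i[%classic `<=` O,
      forall i j, (i < j < n)%N -> t i <= s j &
      `|G x - G a| <= e * (x - a) + \sum_(i < n) `|G (t i) - G (s i)|].
have good x y : x <= y -> `|G y - G x| <= e * (y - x) -> Q x -> Q y.
  move=> xy Gxy [n [s [t [st sO ord Gn]]]]; exists n, s, t; split => //.
    by move=> i /st[? [? tx]]; split => //; split => //; exact: le_trans xy.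
  rewrite (_ : _ - _ = (G y - G x) + (G x - G a)); last by ring.
  rewrite (le_trans (ler_normD _ _))// (le_trans (lerD Gxy Gn))//.
  by rewrite addrA -mulrDr addrA subrK.
have bad x y : a <= x -> x <= y -> `]x, y[%classic `<=` O -> Q x -> Q y.
  move=> ax xy xyO [n [s [t [st sO ord Gn]]]].
  exists n.+1, (fun i => if i == n then x else s i),
   (fun i => if i == n then y else t i); split.
  - move=> i; rewrite ltnS leq_eqVlt; case: eqVneq => [//|_ /= /st[? [? tx]]].
    by split => //; split => //; exact: le_trans xy.
  - by move=> i; rewrite ltnS leq_eqVlt; case: eqVneq => [//|_ /= /sO].
  - move=> i j /andP[ij]; rewrite ltnS leq_eqVlt.
    case: eqVneq => [jn _|_ /= jn].
      have iltn : (i < n)%N by rewrite -jn.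
      by rewrite ltn_eqF//; have [_ []] := st _ iltn.
    by rewrite ltn_eqF ?(ltn_trans ij)//; apply: ord; rewrite ij.
  - rewrite big_ord_recr/= eqxx.
    rewrite (eq_bigr (fun i : 'I_n => `|G (t i) - G (s i)|)); last first.
      by move=> i _; rewrite ltn_eqF.
    rewrite (_ : _ - _ = (G x - G a) + (G y - G x)); last by ring.
    rewrite (le_trans (ler_normD _ _))// addrA lerD// (le_trans Gn)// lerD2r.
    by rewrite ler_wpM2l ?lerB// ltW.
have : Q b.
  have loc s : a <= s <= b -> (exists2 r, 0 < r & `]s - r, s + r[%classic `<=` O) \/
     (exists2 r, 0 < r & forall y, `|y - s| < r -> `|G y - G s| <= e * `|y - s|).
    move=> /andP[as_ sb]; have [sN|sN] := pselect (N' s).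
      left; have /nbhs_ballP[r /= r0 hr] := open_nbhs_nbhs (conj oO (NO _ sN)).
      exists r => // y; rewrite /= in_itv/= => ys; apply: hr.
      by rewrite /ball/= ltr_distlC.
    right; have dG : is_derive s 1 G 0.
      have : (~` N) s by move=> Ns; apply: sN; left.
      move=> /(subsetC subN); rewrite setCK /=; apply.
      rewrite !lt_neqAle as_ sb !andbT; apply/andP; split; apply/eqP => E.
        by apply: sN; right; left.
      by apply: sN; right; right.
    have [r r0 hr] := is_derive_dist dG e0.
    by exists r => // y /hr; rewrite mul0r subr0.
  apply: (real_induction ab).
  - exists 0%N, (fun=> a), (fun=> a); split => //.
    by rewrite !subrr normr0 big_ord0 mulr0 addr0.
  - move=> s /andP[as_ sb].
    have [|[r r0 hr]|[r r0 hr]] := loc s; first by rewrite ltW.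
    + exists r => // x /andP[ax xs] sx; apply: bad => //; first exact: ltW.
      move=> y /=; rewrite in_itv/= => /andP[xy ys].
      by apply: hr => /=; rewrite in_itv/= (lt_trans sx xy) ltr_wpDr// ltW.
    + exists r => // x /andP[ax xs] sx; apply: good; first exact: ltW.
      rewrite distrC (_ : s - x = `|x - s|); last by rewrite distrC gtr0_norm ?subr_gt0.
      by apply: hr; rewrite ltr_distl sx (lt_trans xs)// ltrDl.
  - move=> s /andP[as_ sb] Qs; pose y r := Num.min b (s + r / 2).
    have ys r : 0 < r -> s < y r by move=> r0; rewrite lt_min sb ltrDl divr_gt0.
    have yr r : 0 < r -> y r < s + r.
      move=> r0; rewrite gt_min ltrD2l gtr_pMr// invf_lt1// ltr1n.
      by rewrite orbT.
    have yb r : y r <= b by rewrite ge_min lexx.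
    have [|[r r0 hr]|[r r0 hr]] := loc s; first by rewrite as_ ltW.
    + exists (y r); first by rewrite ys// yb.
      apply: bad Qs => //; first by rewrite ltW// ys.
      move=> z /=; rewrite in_itv/= => /andP[sz zy].
      apply: hr => /=; rewrite in_itv/= (lt_trans _ sz) ?ltrBlDr ?ltrDl//=.
      by rewrite (lt_trans zy)// yr.
    + exists (y r); first by rewrite ys// yb.
      apply: good Qs; first by rewrite ltW// ys.
      rewrite -[y r - s]gtr0_norm ?subr_gt0 ?ys//; apply: hr.
      by rewrite ltr_distl yr// (lt_trans _ (ys _ r0))// ltrBlDr ltrDl.
move=> [n [s [t [st sO ord Gn]]]].
apply: (le_trans Gn); rewrite lerD2l; apply/ltW.
have tr : trivIset [set: 'I_n] (fun i => `]s i, t i[%classic).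
  apply/trivIsetP => i j _ _ ij.
  wlog ltij : i j ij / (i < j)%N.
    move=> W; have : (i < j)%N || (j < i)%N by rewrite -neq_ltn.
    by case/orP => [/W ->//|ji]; rewrite setIC W// eq_sym.
  apply/seteqP; split => // z [] /=; rewrite !in_itv/= => /andP[_ zt] /andP[sz _].
  have : t i <= s j by apply: ord; rewrite ltij /=.
  by rewrite leNgt (lt_trans sz zt).
apply: hd => //; first by move=> i; exact: st.
rewrite -lte_fin -(@mu_bigsetU_itv n (fun i => s i) (fun i => t i))//; last first.
  by move=> i; have [_ []] := st i (ltn_ord i).
apply: le_lt_trans muO; apply: le_measure; rewrite ?inE//.
  exact: bigsetU_measurable.
by rewrite -(bigcup_mkord n (fun i => `]s i, t i[%classic)); apply: bigcup_sub => i; exact: sO.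
Qed.

(** [F + tail g] is absolutely continuous with derivative zero almost everywhere, so [ac_derive0]
    applies to it. *)
Lemma ac_FTC F g a b : a <= b -> absolutely_continuous_on a b F -> L1 g ->
  {ae mu, forall x, a < x < b -> is_derive x 1 F (g x)} ->
  F b - F a = tail g a - tail g b.
Proof.
move=> ab aF ig dF.
have aG : absolutely_continuous_on a b (fun x => F x + tail g x).
  by apply: acD => //; exact: ac_tail.
suff : F b + tail g b = F a + tail g a by lra.
apply: (ac_derive0 ab aG).
have := ae_is_derive_tail ig; apply: filterS2 dF.
  exact: (ae_filter_ringOfSetsType mu).
move=> x dF dt xab.
have := is_deriveD (dF xab) dt.
by rewrite subrr.
Qed.

End AbsolutelyContinuous.

(** * Solutions on the half-line *)

Section HalfLineDerivative.
Variable R : realType.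
Implicit Types (h g F G : R -> R) (a b x y l : R).
Local Notation mu := (@lebesgue_measure R).

(** The limit of [diff_quot_Rp] with the division cleared: [y = x] need not be excluded, and the
    one-sided derivative at 0 is treated like all others. *)
Definition Rp_deriv F x l : Prop := forall e, 0 < e ->
  exists2 r, 0 < r & forall y, 0 <= y -> `|y - x| < r ->
    `|F y - F x - l * (y - x)| <= e * `|y - x|.

Lemma cvg_diff_quot_Rp F x l : diff_quot_Rp F x --> l <-> Rp_deriv F x l.
Proof.
split.
- move=> /cvgrPdist_le cF e e0; have [r /= r0 hr] := cF _ e0.
  exists r => // y y0 yr; have [->|yx] := eqVneq y x.
    by rewrite !subrr mulr0 subr0 normr0 mulr0.
  have := hr y; rewrite /ball/= distrC => /(_ yr yx).
  rewrite in_itv/= y0 => /(_ isT).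
  have yx0 : y - x != 0 by rewrite subr_eq0.
  rewrite -(ler_pM2r (_ : 0 < `|y - x|)) ?normr_gt0// -normrM mulrBl.
  by rewrite divfK// distrC.
- move=> dF; apply/cvgrPdist_le => e e0; have [r r0 hr] := dF e e0.
  exists r => //= y; rewrite /ball/= distrC => yr yx; rewrite in_itv/= andbT => y0.
  have yx0 : y - x != 0 by rewrite subr_eq0.
  rewrite -(ler_pM2r (_ : 0 < `|y - x|)) ?normr_gt0// -normrM mulrBl.
  by rewrite divfK// distrC; exact: hr.
Qed.

Lemma derivable_Rp_deriv F x : derivable_Rp F x -> Rp_deriv F x (derive_Rp F x).
Proof. by move=> dF; apply/cvg_diff_quot_Rp. Qed.

(** Properness makes the limit behind [derive_Rp] unique. Points slightly to the right of [x] are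
    always available, also at [x = 0]. *)
Lemma proper_within_Rp x : 0 <= x -> ProperFilter (within `[0, +oo[ x^').
Proof.
move=> x0; split; last exact: within_filter.
rewrite /within/= => -[r /= r0] /(_ (x + r / 2)); rewrite /ball/=.
rewrite opprD addrA subrr add0r normrN gtr0_norm ?divr_gt0//.
apply => //.
- by rewrite gtr_pMr// invf_lt1// ltr1n.
- by rewrite gt_eqF// ltrDl divr_gt0.
- by rewrite in_itv/= andbT addr_ge0// divr_ge0// ltW.
Qed.

Lemma Rp_deriv_derive F x l : 0 <= x -> Rp_deriv F x l ->
  derivable_Rp F x /\ derive_Rp F x = l.
Proof.
move=> x0 /cvg_diff_quot_Rp Fl; split; first by apply/cvg_ex; exists l.
have := proper_within_Rp x0 => ?.
by apply: cvg_lim => //; exact: Rhausdorff.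
Qed.

Lemma Rp_deriv_is_derive F x l : 0 < x -> Rp_deriv F x l -> is_derive x 1 F l.
Proof.
move=> x0 dF.
have cF : h^-1 *: (F (h *: 1 + x) - F x) @[h --> 0^'] --> l.
  apply/cvgrPdist_le => e e0; have [r r0 hr] := dF e e0.
  exists (Num.min r x) => /=; first by rewrite lt_min r0.
  move=> h /=; rewrite sub0r normrN lt_min => /andP[hlr hx] h0.
  rewrite -(ler_pM2r (_ : 0 < `|h|)) ?normr_gt0// -normrM mulrBl.
  rewrite /GRing.scale/= mulr1 mulrAC mulVf// mul1r distrC.
  have := hr (h + x); rewrite addrK; apply => //.
  by rewrite -lerBlDr sub0r; move: hx; rewrite ltr_norml => /andP[/ltW].
have dF' : derivable F x 1 by apply/cvg_ex; exists l.
by apply: DeriveDef => //; apply: cvg_lim => //; exact: Rhausdorff.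
Qed.

Lemma is_derive_Rp_deriv F x l : is_derive x 1 F l -> Rp_deriv F x l.
Proof.
move=> dF e e0; have [r r0 hr] := is_derive_dist dF e0.
by exists r => // y _; exact: hr.
Qed.

Lemma eq_Rp_deriv F G x l : 0 <= x -> (forall y, 0 <= y -> F y = G y) ->
  Rp_deriv F x l -> Rp_deriv G x l.
Proof.
move=> x0 FG dF e /dF[r r0 hr]; exists r => // y y0 yx.
by rewrite -!FG// hr.
Qed.

(** Mean value inequality for half-line derivatives: with an excess [e] in the slope it holds near
    each point, real induction spreads it over the interval, and [e] is arbitrary. *)
Lemma Rp_deriv_lipschitz F dF b M : 0 <= M ->
  (forall x, 0 <= x <= b -> Rp_deriv F x (dF x)) ->
  (forall x, 0 <= x <= b -> `|dF x| <= M) ->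
  forall x y, 0 <= x -> x <= y -> y <= b -> `|F y - F x| <= M * (y - x).
Proof.
move=> M0 dFF dFM x y x0 xy yb.
apply/ler_addgt0Pr => e' e0'.
have k0 : 0 < y - x + 1 by rewrite ltr_wpDl// subr_ge0.
pose e := e' / (y - x + 1); have e0 : 0 < e by rewrite divr_gt0.
apply: (@le_trans _ _ ((M + e) * (y - x))); last first.
  rewrite mulrDl lerD2l /e mulrAC ler_pdivrMr// ler_wpM2l ?(ltW e0')//.
  by rewrite lerDl.
have loc s : x <= s <= y -> exists2 r, 0 < r & forall z, 0 <= z -> `|z - s| < r ->
    `|F z - F s| <= (M + e) * `|z - s|.
  move=> /andP[xs sy].
  have s0b : 0 <= s <= b by rewrite (le_trans x0 xs) (le_trans sy yb).
  have [r r0 hr] := dFF s s0b e e0; exists r => // z z0 zs.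
  rewrite (_ : _ - _ = (F z - F s - dF s * (z - s)) + dF s * (z - s)); last by ring.
  rewrite (le_trans (ler_normD _ _))// [M + e]addrC mulrDl lerD ?hr//.
  by rewrite normrM ler_wpM2r// dFM.
pose Q z := `|F z - F x| <= (M + e) * (z - x).
have step w z : w <= z -> `|F z - F w| <= (M + e) * (z - w) -> Q w -> Q z.
  rewrite /Q => wz Fwz Qw.
  rewrite (_ : _ - _ = (F z - F w) + (F w - F x)); last by ring.
  rewrite (le_trans (ler_normD _ _))// (le_trans (lerD Fwz Qw))//.
  by rewrite -mulrDr addrA subrK.
apply: (real_induction (Q := Q) xy).
- by rewrite /Q !subrr normr0 mulr0.
- move=> s /andP[xs sy]; have [|r r0 hr] := loc s; first by rewrite ltW.
  exists r => // w /andP[xw ws] sw; apply: step; first exact: ltW.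
  rewrite distrC (_ : s - w = `|w - s|); last by rewrite distrC gtr0_norm ?subr_gt0.
  by apply: hr; rewrite ?(le_trans x0)// ltr_distl sw (lt_trans ws)// ltrDl.
- move=> s /andP[xs sy] Qs; have [|r r0 hr] := loc s; first by rewrite xs ltW.
  have sz : s < Num.min y (s + r / 2) by rewrite lt_min sy ltrDl divr_gt0.
  exists (Num.min y (s + r / 2)); first by rewrite sz ge_min lexx.
  apply: step Qs; first exact: ltW.
  set z := Num.min _ _ in sz *.
  rewrite (_ : z - s = `|z - s|); last by rewrite gtr0_norm ?subr_gt0.
  apply: hr.
    by rewrite (le_trans x0)// (le_trans xs)// ltW.
  rewrite ltr_distl (lt_trans _ sz) ?ltrBlDr ?ltrDl//=.
  by rewrite gt_min ltrD2l gtr_pMr// invf_lt1// ltr1n orbT.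
Qed.

(** For real [k] the real and imaginary parts of a solution satisfy this separately. The derivative
    is an argument of its own so that explicit formulas can stand in for [derive_Rp]. *)
Definition real_solution (q : R -> R) (k : R) (u du : R -> R) : Prop :=
  [/\ forall x, 0 <= x -> Rp_deriv u x (du x),
      forall b, 0 < b -> absolutely_continuous_on 0 b du
    & {ae mu, forall x, 0 < x -> is_derive x 1 du ((q x - k ^+ 2) * u x)}].

Lemma real_solution_ac q k u du b : real_solution q k u du -> 0 < b ->
  absolutely_continuous_on 0 b u.
Proof.
move=> [du_ acd _] b0; have [M M0 dM] := ac_bounded (acd b b0).
apply: (ac_lipschitz (ltW M0)); apply: (Rp_deriv_lipschitz (ltW M0)) dM.
by move=> x /andP[x0 _]; exact: du_.
Qed.

(** The Wronskian has derivative (q1 - q2) u1 u2 almost everywhere. A separate [g] is integrated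
    because the solutions are uncontrolled at negative arguments, whereas [L1] refers to the whole
    line. *)
Lemma wronskian q1 q2 k u1 du1 u2 du2 g b : 0 < b ->
  real_solution q1 k u1 du1 -> real_solution q2 k u2 du2 -> L1 g ->
  (forall x, 0 <= x -> g x = (q1 x - q2 x) * u1 x * u2 x) ->
  (du1 b * u2 b - u1 b * du2 b) - (du1 0 * u2 0 - u1 0 * du2 0) =
  tail g 0 - tail g b.
Proof.
move=> b0 s1 s2 ig gE.
have ac1 := real_solution_ac s1 b0; have ac2 := real_solution_ac s2 b0.
have [d1 ad1 e1] := s1; have [d2 ad2 e2] := s2.
have acm F G : absolutely_continuous_on 0 b F -> absolutely_continuous_on 0 b G ->
    absolutely_continuous_on 0 b (fun x => F x * G x).
  move=> aF aG; have [M M0 FM] := ac_bounded aF; have [N N0 GN] := ac_bounded aG.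
  apply: (acM (M := Num.max M N)) => //; first by rewrite lt_max M0.
  - by move=> x /FM h; rewrite le_max h.
  - by move=> x /GN h; rewrite le_max h orbT.
have acc c : absolutely_continuous_on 0 b (fun=> c : R).
  by apply: (@ac_lipschitz _ _ _ _ 0) => // *; rewrite subrr normr0 mul0r.
rewrite -(@ac_FTC _ (fun x => du1 x * u2 x + -1 * (u1 x * du2 x)) g 0 b (ltW b0))//.
- by ring.
- apply: acD; first by apply: (acm) => //; exact: ad1.
  by apply: (acm) => //; apply: (acm) => //; exact: ad2.
- have := e2; apply: filterS2 e1; first exact: (ae_filter_ringOfSetsType mu).
  move=> x D1 D2 /andP[x0 xb].
  rewrite gE ?(ltW x0)//.
  have dd1 := D1 x0; have dd2 := D2 x0.
  have du1' := Rp_deriv_is_derive x0 (d1 x (ltW x0)).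
  have du2' := Rp_deriv_is_derive x0 (d2 x (ltW x0)).
  apply: is_derive_eq; rewrite /GRing.scale/=.
  ring.
Qed.

End HalfLineDerivative.

(** * Passage between complex solutions for real k and pairs of real solutions *)

Section ComplexLink.
Variable R : realType.
Implicit Types (q u v du dv : R -> R) (f : R -> R[i]) (k x : R).
Local Notation mu := (@lebesgue_measure R).
Local Notation RE := (@complex.Re R).
Local Notation IM := (@complex.Im R).

Lemma plane_waveE k x :
  plane_wave (real_complex R k) x = Complex (cos (k * x)) (sin (k * x)).
Proof.
rewrite /plane_wave /cexp /=.
by rewrite !(mul0r, mulr0, mul1r, sub0r, addr0, add0r, subr0, oppr0, expR0).
Qed.

Lemma schrodinger_solution_real q k f :
  schrodinger_solution q (real_complex R k) f ->
  real_solution q k (RE \o f) (derive_Rp (RE \o f)) /\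
  real_solution q k (IM \o f) (derive_Rp (IM \o f)).
Proof.
move=> [df acf eqf]; split; split.
- by move=> x /df[dr _]; exact: derivable_Rp_deriv.
- by move=> b /acf[].
- move: eqf; apply: filterS; first exact: (ae_filter_ringOfSetsType mu).
  move=> x + x0 => /(_ x0)[[dr _]] /(congr1 RE).
  have dE := Rp_deriv_is_derive x0 (derivable_Rp_deriv dr).
  rewrite expr2 /=; case: (f x) => a c /= E.
  apply: is_derive_eq; apply/eqP; move: E => /eqP.
  set D := derive_Rp _ _ => /eqP E; apply/eqP; lra.
- by move=> x /df[_ dr]; exact: derivable_Rp_deriv.
- by move=> b /acf[].
- move: eqf; apply: filterS; first exact: (ae_filter_ringOfSetsType mu).
  move=> x + x0 => /(_ x0)[[_ dr]] /(congr1 IM).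
  have dE := Rp_deriv_is_derive x0 (derivable_Rp_deriv dr).
  rewrite expr2 /=; case: (f x) => a c /= E.
  apply: is_derive_eq; apply/eqP; move: E => /eqP.
  set D := derive_Rp _ _ => /eqP E; apply/eqP; lra.
Qed.

Lemma real_solution_schrodinger q k u du v dv :
  real_solution q k u du -> real_solution q k v dv ->
  schrodinger_solution q (real_complex R k) (fun x => Complex (u x) (v x)).
Proof.
move=> [du_ adu edu] [dv_ adv edv].
have uE x : 0 <= x -> derivable_Rp u x /\ derive_Rp u x = du x.
  by move=> x0; apply: Rp_deriv_derive => //; exact: du_.
have vE x : 0 <= x -> derivable_Rp v x /\ derive_Rp v x = dv x.
  by move=> x0; apply: Rp_deriv_derive => //; exact: dv_.
have acE F G b : (forall x, 0 <= x -> F x = G x) ->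
    absolutely_continuous_on 0 b F -> absolutely_continuous_on 0 b G.
  move=> FG aF e /aF[d d0 hd]; exists d => // n s t st tr std.
  apply: le_lt_trans (hd n s t st tr std).
  apply: ler_sum => i _; have [s0 [sti _]] := st i.
  by rewrite !FG// (le_trans s0).
split.
- by move=> x x0; split; [exact: (uE x x0).1|exact: (vE x x0).1].
- move=> b b0; split.
  + by apply: acE (adu b b0) => x x0; rewrite -(uE x x0).2.
  + by apply: acE (adv b b0) => x x0; rewrite -(vE x x0).2.
- have := edv; apply: filterS2 edu; first exact: (ae_filter_ringOfSetsType mu).
  move=> x du2 dv2 x0; have {}du2 := du2 x0; have {}dv2 := dv2 x0.
  have derE F dF d2 : (forall x, 0 <= x -> derivable_Rp F x /\ derive_Rp F x = dF x) ->
      is_derive x 1 dF d2 -> derivable_Rp (derive_Rp F) x /\ derive_Rp (derive_Rp F) x = d2.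
    move=> FE d2F; apply: Rp_deriv_derive; first exact: ltW.
    apply: (@eq_Rp_deriv _ dF); [exact: ltW| |exact: is_derive_Rp_deriv].
    by move=> y y0; rewrite (FE y y0).2.
  have [u1 u2] := derE _ _ _ uE du2; have [v1 v2] := derE _ _ _ vE dv2.
  split; first by split.
  rewrite /cderive.
  rewrite (_ : derive_Rp (RE \o _) x = derive_Rp (derive_Rp u) x)//.
  rewrite (_ : derive_Rp (IM \o _) x = derive_Rp (derive_Rp v) x)//.
  rewrite u2 v2 expr2; apply/eqP; rewrite eq_complex /=; apply/andP; split; apply/eqP; ring.
Qed.

Definition asymptotic u g : Prop := (u x - g x @[x --> +oo] --> (0 : R)).

(** For real [k] the exponential weight is 1, and the modulus of a complex number lies between the
    absolute value of either coordinate and the sum of both. *)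
Lemma jost_asymptotics_real k f : jost_asymptotics (real_complex R k) f <->
  asymptotic (RE \o f) (fun x => cos (k * x)) /\
  asymptotic (IM \o f) (fun x => sin (k * x)).
Proof.
have normcE x : expR (IM (real_complex R k) * x) *
    Normc.normc (f x - plane_wave (real_complex R k) x) =
    Num.sqrt ((RE (f x) - cos (k * x)) ^+ 2 + (IM (f x) - sin (k * x)) ^+ 2).
  by rewrite /= mul0r expR0 mul1r plane_waveE; case: (f x).
have le_sqrt (a c : R) : `|a| <= Num.sqrt (a ^+ 2 + c ^+ 2).
  by rewrite -sqrtr_sqr ler_sqrt ?lerDl ?sqr_ge0// addr_ge0 ?sqr_ge0.
split.
- move=> jf.
  have {}jf : Num.sqrt ((RE (f x) - cos (k * x)) ^+ 2 + (IM (f x) - sin (k * x)) ^+ 2) @[x --> +oo] --> (0 : R).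
    by apply: cvg_trans jf; apply: near_eq_cvg; apply: nearW => x; exact: normcE.
  split; apply/norm_cvg0P; apply: squeeze_cvgr (@cvg_cst _ (0 : R) _ _ _) jf;
    apply: nearW => x; rewrite normr_ge0/=.
  + exact: le_sqrt.
  + by rewrite [X in Num.sqrt X]addrC; exact: le_sqrt.
- move=> [ja jb].
  have : `|RE (f x) - cos (k * x)| + `|IM (f x) - sin (k * x)| @[x --> +oo] --> (0 : R).
    by rewrite -[0]addr0; apply: cvgD; apply/norm_cvg0P.
  apply: squeeze_cvgr (@cvg_cst _ (0 : R) _ _ _).
  apply: nearW => x; rewrite normcE sqrtr_ge0/=.
  move: (RE _ - _) (IM _ - _) => a c.
  rewrite (_ : `|a| + `|c| = Num.sqrt ((`|a| + `|c|) ^+ 2)); last first.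
    by rewrite sqrtr_sqr [RHS]ger0_norm ?addr_ge0.
  rewrite ler_sqrt ?sqr_ge0// sqrrD !real_normK ?num_real// [leRHS]addrAC lerDl.
  by rewrite mulrn_wge0// mulr_ge0.
Qed.

End ComplexLink.

(** * Volterra equations *)

Section Volterra.
Variable R : realType.
Implicit Types (q u v g w h : R -> R) (k x t : R).
Local Notation mu := (@lebesgue_measure R).

(** Vanishing at negative arguments lets integrals run over the whole line; the first moment matches
    the bound t - x on the Volterra kernel. *)
Definition potential q : Prop :=
  [/\ L1 q, L1 (fun x => x * q x) & forall x, x < 0 -> q x = 0].

Lemma potential_patch q : L11 q -> potential (q \_ `[0, +oo[).
Proof.
move=> [mq iq _].
have mp : measurable_fun setT (q \_ `[0, +oo[).
  by apply/(measurable_restrictT _ _).1.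
have i1 : L1 (fun x => (1 + x) * (q \_ `[0, +oo[) x).
  apply/integrableP; split.
    apply/measurable_EFinP; apply: measurable_funM => //.
    exact: measurable_funD.
  apply: le_lt_trans iq; rewrite [leRHS]integral_mkcond.
  apply: ge0_le_integral => //.
  - apply: measurableT_comp => //; apply/measurable_EFinP.
    by apply: measurable_funM => //; exact: measurable_funD.
  - apply/(measurable_restrictT _ _).1 => //; apply/measurable_EFinP.
    apply: measurable_funM; last exact: measurableT_comp.
    exact: measurable_funD.
  - move=> x _; rewrite /= !patchE; case: ifPn; last by rewrite mulr0 normr0.
    by rewrite inE/= in_itv/= andbT => x0; rewrite lee_fin normrM ger0_norm// addr_ge0.
have neg x : x < 0 -> (q \_ `[0, +oo[) x = 0.
  by move=> x0; rewrite patchE memNset//= in_itv/= andbT leNgt x0.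
have i0 : L1 (q \_ `[0, +oo[).
  apply: (L1_le _ _ (L1_abs i1)) => // x; rewrite normrM.
  have [x0|x0] := ltP x 0; first by rewrite neg// normr0 mulr0.
  by rewrite ler_peMl// ger0_norm ?addr_ge0// lerDl.
split => //.
apply: (eq_integrable measurableT) (L1B i1 i0) => // x _ /=.
by congr (_%:E); rewrite mulrDl mul1r addrC addKr.
Qed.

Lemma L1_potentialM q h B : potential q -> measurable_fun setT h ->
  (forall x, 0 <= x -> `|h x| <= B) -> L1 (fun x => q x * h x).
Proof.
move=> [iq _ qneg] mh hB; apply: (@L1_le _ _ (fun x => `|q x| * B)).
- by apply: measurable_funM => //; exact: L1_measurable.
- move=> x; rewrite normrM; have [x0|x0] := ltP x 0.
    by rewrite qneg// normr0 !mul0r.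
  by rewrite ler_wpM2l// hB.
- apply: (@eq_integrable _ _ _ mu setT measurableT (EFin \o (fun x => B * `|q x|))).
    by move=> x _ /=; rewrite mulrC.
  exact/L1Z/L1_abs.
Qed.

Lemma potentialM q h B : potential q -> measurable_fun setT h ->
  (forall x, 0 <= x -> `|h x| <= B) -> potential (fun x => q x * h x).
Proof.
move=> pq mh hB; have [iq ixq qneg] := pq; split.
- exact: L1_potentialM hB.
- have pxq : potential (fun x => q x * 1) -> True by [].
  apply: (@L1_le _ _ (fun x => `|x * q x| * B)).
  + apply: measurable_funM => //; apply: measurable_funM => //.
    exact: L1_measurable.
  + move=> x; rewrite mulrA normrM; have [x0|x0] := ltP x 0.
      by rewrite qneg// mulr0 normr0 !mul0r.
    by rewrite ler_wpM2l// hB.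
  + apply: (@eq_integrable _ _ _ mu setT measurableT (EFin \o (fun x => B * `|x * q x|))).
      by move=> x _ /=; rewrite mulrC.
    exact/L1Z/L1_abs.
- by move=> x x0; rewrite qneg// mul0r.
Qed.

Lemma potential_abs q : potential q -> potential (fun x => `|q x|).
Proof.
move=> [iq ixq qneg]; split; first exact: L1_abs.
- apply: (L1_le _ _ (L1_abs ixq)).
    by apply: measurable_funM => //; apply: measurableT_comp => //; exact: L1_measurable.
  by move=> x; rewrite !normrM normr_id.
- by move=> x /qneg ->; rewrite normr0.
Qed.

Lemma L1_potential_shift q x : potential q -> L1 (fun t => q t * (t - x)).
Proof.
move=> [iq ixq qneg].
apply: (@eq_integrable _ _ _ mu setT measurableT (EFin \o (fun t => t * q t - x * q t))).
  by move=> t _ /=; congr (_%:E); ring.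
by apply: L1B => //; exact: L1Z.
Qed.

(* The iteration of the Volterra operators is a contraction by 1/2 in the norm
   weighted by [w]. *)
Definition weight q w d M : Prop :=
  [/\ measurable_fun setT w, 0 < d, forall x, d <= w x <= M
    & forall x, 0 <= x -> tail (fun t => `|q t| * w t * (t - x)) x <= w x / 2].

(* [w t = exp (- lam t) + d]: a large [lam] makes the exponential absorb the
   mass of [q] on bounded intervals, and [d] the small remainder at infinity. *)
Lemma weight_exists q : potential q -> exists w d M, weight q w d M.
Proof.
move=> pq; have pa := potential_abs pq; have [ia ixa _] := pa.
pose N := tail (fun t => `|q t|) 0.
have N0 : 0 <= N by apply: tail_ge0.
(* Makes N / lam at most 1/4, so that the exponential part contributes at most a quarter of [E]; the
   1 keeps [lam] positive. *)
pose lam := 4 * N + 1.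
have lam0 : 0 < lam by rewrite ltr_wpDl// mulr_ge0.
pose gam x := tail (fun t => t * `|q t|) x.
have gam_le x : 0 <= x -> gam x <= gam 0.
  move=> x0; rewrite /gam (tail_split ixa x0) lerDr; apply: Rintegral_ge0 => t /=.
  by rewrite in_itv/= => /andP[t0 _]; exact: mulr_ge0.
have gam0 x : 0 <= x -> 0 <= gam x.
  move=> x0; apply: Rintegral_ge0 => t /=; rewrite in_itv/= andbT => xt.
  by rewrite mulr_ge0// (le_trans x0).
(* Beyond [X] the remaining first moment is so small that the constant [d] in the weight absorbs its
   own contribution. *)
have [X X0 gX] : exists2 X, 0 <= X & forall x, X <= x -> gam x <= 1 / 2.
  have /cvgr0Pnorm_lt/(_ (1/2))[|X [_ hX]] := tail_cvg0 ixa.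
    by rewrite divr_gt0.
  exists (Num.max 0 (X + 1)); first by rewrite le_max lexx.
  move=> x; rewrite ge_max => /andP[x0 Xx].
  by apply: le_trans (ler_norm _) (ltW (hX x _)); rewrite (lt_le_trans _ Xx)// ltrDl.
pose Gam := gam 0 + 1.
have Gam0 : 0 < Gam by rewrite ltr_wpDl// gam0.
(* Before [X], where exp(- lam X) <= exp(- lam x), the contribution of [d] is at most a quarter of
   [E]. *)
pose d := expR (- lam * X) / (4 * Gam).
have d0 : 0 < d by rewrite divr_gt0 ?expR_gt0// mulr_gt0.
pose w x := expR (- lam * `|x|) + d.
have me : measurable_fun setT (fun x : R => expR (- lam * `|x|)).
  by apply: measurableT_comp => //; apply: measurable_funM.
have e1 x : expR (- lam * `|x|) <= 1.
  by rewrite -expR0 ler_expR mulNr oppr_le0 mulr_ge0// ltW.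
exists w, d, (1 + d); split => //.
- exact: measurable_funD.
- by move=> x; rewrite /w lerDr expR_ge0 lerD2r/= e1.
move=> x x0.
pose E := expR (- lam * x).
apply: (@le_trans _ _ (tail (fun t => E / lam * `|q t| + d * (t * `|q t|)) x)).
  apply: le_tail.
  - apply: (@eq_integrable _ _ _ mu setT measurableT (EFin \o (fun t => `|q t| * (t - x) * w t))).
      by move=> t _ /=; congr (_%:E); rewrite mulrAC.
    apply: (@L1M _ _ w (1 + d)).
    + exact: measurable_funD.
    + move=> t; rewrite ger0_norm /w; last by rewrite addr_ge0 ?expR_ge0// ltW.
      by rewrite lerD2r e1.
    + exact: L1_potential_shift.
  - by apply: L1D; exact: L1Z.
  - move=> t xt; have t0 : 0 <= t by exact: le_trans xt.
    rewrite /w (_ : _ * _ * _ = `|q t| * (t - x) * expR (- lam * `|t|) +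
      d * ((t - x) * `|q t|)); last by ring.
    rewrite lerD//; last by rewrite ler_pM2l// ler_wpM2r// gerBl.
    rewrite (ger0_norm t0) [leLHS](_ : _ = (t - x) * expR (- lam * t) * `|q t|); last by ring.
    rewrite ler_wpM2r//.
    rewrite (_ : - lam * t = - lam * x + - (lam * (t - x))); last by ring.
    (* In the variable [y] the claim is y exp(-y) <= 1. *)
    rewrite expRD -/E; set y := lam * (t - x).
    rewrite [leLHS](_ : _ = E / lam * (y * expR (- y))); last first.
      by rewrite /y; field; rewrite gt_eqF.
    rewrite ger_pMr ?divr_gt0 ?expR_gt0// expRN ler_pdivrMr ?expR_gt0// mul1r.
    by rewrite (le_trans _ (expR_ge1Dx _))// lerDr.
rewrite tailD; [|exact: L1Z|exact: L1Z]; rewrite !tailZ// -/(gam x).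
have E0 : 0 < E by exact: expR_gt0.
have wE : w x = E + d by rewrite /w ger0_norm.
have h1 : E / lam * tail (fun t => `|q t|) x <= E / 4.
  rewrite -mulrA ler_pM2l// mulrC ler_pdivrMr//.
  have : tail (fun t => `|q t|) x <= N by exact: tail_nonincreasing.
  rewrite /lam; lra.
have [Xx|xX] := leP X x.
  have h2 : d * gam x <= d * (1 / 2) by rewrite ler_pM2l// gX.
  rewrite wE; lra.
have h2 : d * gam x <= E / 4.
  rewrite /d -mulrA; apply: (@le_trans _ _ (E * ((4 * Gam)^-1 * gam x))).
    rewrite ler_wpM2r//.
      by rewrite mulr_ge0 ?gam0// invr_ge0 ltW// mulr_gt0.
    by rewrite ler_expR !mulNr lerN2 ler_pM2l// ltW.
  rewrite ler_pM2l// invfM -mulrA ger_pMr ?invr_gt0//.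
  rewrite mulrC ler_pdivrMr// mul1r (le_trans (gam_le _ x0))// lerDl.
  by [].
rewrite wE; lra.
Qed.

End Volterra.

(** * The Volterra operator and its contraction estimate *)

Section VolterraEquation.
Variable R : realType.
Implicit Types (q u v g w h F : R -> R) (k x t : R).
Local Notation mu := (@lebesgue_measure R).

Lemma abs_sin_le x : 0 <= x -> `|sin x| <= x.
Proof.
rewrite le_eqVlt => /orP[/eqP<-|x0]; first by rewrite sin0 normr0.
have [c _] : exists2 c : R, c \in `]0, x[%R & sin x - sin 0 = cos c * (x - 0).
  apply: (@MVT R sin cos) => //; apply: continuous_subspaceT; exact: continuous_sin.
rewrite sin0 !subr0 => ->; rewrite normrM (gtr0_norm x0) ger_pMl//.
exact: cos_max.
Qed.

(** This bound is uniform in [k] and drives the contraction; the next one, at fixed [k], gives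
    integrability and global boundedness. *)
Lemma abs_sinc_le k x : 0 < k -> 0 <= x -> `|sin (k * x) / k| <= x.
Proof.
move=> k0 x0; rewrite normrM normfV (gtr0_norm k0) ler_pdivrMr// mulrC.
by rewrite abs_sin_le// mulr_ge0// ltW.
Qed.

Lemma abs_sinc_le_inv k x : 0 < k -> `|sin (k * x) / k| <= k^-1.
Proof.
move=> k0; rewrite normrM normfV (gtr0_norm k0) ger_pMl ?invr_gt0//.
exact: sin_max.
Qed.

Lemma ac_continuous F : (forall a b, absolutely_continuous_on a b F) ->
  continuous F.
Proof.
move=> aF x; apply/cvgrPdist_lt => e e0.
have [d d0 hd] := aF (x - 1) (x + 1) e e0.
have step s t : x - 1 <= s -> s <= t -> t <= x + 1 -> t - s < d -> `|F t - F s| < e.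
  move=> h1 h2 h3 h4; have := hd 1%N (fun=> s) (fun=> t); rewrite !big_ord1; apply => //.
  by move=> i j _ _ _; rewrite !ord1.
near=> y; rewrite /=.
have yx1 : `|y - x| < 1.
  by near: y; exists 1 => //= z; rewrite /ball/= distrC.
have yxd : `|y - x| < d.
  by near: y; exists d => //= z; rewrite /ball/= distrC.
have /andP[y1 y2] : x - 1 < y < x + 1 by rewrite -ltr_distl.
have /andP[y3 y4] : x - d < y < x + d by rewrite -ltr_distl.
have [xy|yx] := leP x y.
  by rewrite distrC; apply: step => //; [rewrite gerBl|exact: ltW|rewrite ltrBlDl].
by apply: step; [exact: ltW|exact: ltW|rewrite lerDl|rewrite ltrBlDl -ltrBlDr].
Unshelve. all: by end_near. Qed.

Lemma continuous_tail h : L1 h -> continuous (tail h).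
Proof. by move=> ih; apply: ac_continuous => a b; exact: ac_tail. Qed.

(** Variation of constants from infinity: a bounded solution of u'' = (q - k^2) u that behaves like
    the free wave g at infinity satisfies u = g + vol u. *)
Definition vol k q u x : R :=
  tail (fun t => q t * u t * (sin (k * (t - x)) / k)) x.

Lemma measurable_sin_lin (a b : R) : measurable_fun setT (fun t : R => sin (a * t + b)).
Proof.
apply: continuous_measurable_fun => x.
apply: (@continuous_comp _ _ _ (fun t : R => a * t + b) sin); last exact: continuous_sin.
by apply: cvgD; [apply: cvgM; [exact: cvg_cst|exact: cvg_id]|exact: cvg_cst].
Qed.

Lemma measurable_cos_lin (a b : R) : measurable_fun setT (fun t : R => cos (a * t + b)).
Proof.
apply: continuous_measurable_fun => x.
apply: (@continuous_comp _ _ _ (fun t : R => a * t + b) cos); last exact: continuous_cos.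
by apply: cvgD; [apply: cvgM; [exact: cvg_cst|exact: cvg_id]|exact: cvg_cst].
Qed.

Lemma L1_sin h k : L1 h -> L1 (fun t => h t * sin (k * t)).
Proof.
move=> ih; apply: (L1M _ _ ih) => [|x]; last exact: sin_max.
by have := measurable_sin_lin k 0; under eq_fun do rewrite addr0.
Qed.

Lemma L1_cos h k : L1 h -> L1 (fun t => h t * cos (k * t)).
Proof.
move=> ih; apply: (L1M _ _ ih) => [|x]; last exact: cos_max.
by have := measurable_cos_lin k 0; under eq_fun do rewrite addr0.
Qed.

Lemma L1_vol k x h : 0 < k -> L1 h -> L1 (fun t => h t * (sin (k * (t - x)) / k)).
Proof.
move=> k0 ih; apply: (L1M _ _ ih) => [|t]; last exact: abs_sinc_le_inv.
apply: measurable_funM => //.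
by have := measurable_sin_lin k (- (k * x)); under eq_fun do rewrite -mulrBr.
Qed.

(** The addition formula separates [x] from [t], which reduces measurability and continuity in [x],
    and later the differential equation, to properties of tails. *)
Lemma volE k q u x : L1 (fun t => q t * u t) ->
  vol k q u x = cos (k * x) / k * tail (fun t => q t * u t * sin (k * t)) x -
                sin (k * x) / k * tail (fun t => q t * u t * cos (k * t)) x.
Proof.
move=> iqu; have is_ := L1_sin k iqu; have ic := L1_cos k iqu.
rewrite -!tailZ// -tailB; [|exact: L1Z|exact: L1Z].
by apply: eq_tail => t _; rewrite mulrBr sinB; ring.
Qed.

Lemma measurable_vol k q u : L1 (fun t => q t * u t) ->
  measurable_fun setT (vol k q u).
Proof.
move=> iqu; have is_ := L1_sin k iqu; have ic := L1_cos k iqu.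
rewrite (_ : vol k q u = fun x =>
    cos (k * x) / k * tail (fun t => q t * u t * sin (k * t)) x -
    sin (k * x) / k * tail (fun t => q t * u t * cos (k * t)) x); last first.
  by apply/funext => x; exact: volE.
have mc : measurable_fun setT (fun x : R => cos (k * x)).
  by have := measurable_cos_lin k 0; under eq_fun do rewrite addr0.
have ms : measurable_fun setT (fun x : R => sin (k * x)).
  by have := measurable_sin_lin k 0; under eq_fun do rewrite addr0.
by apply: measurable_funB; apply: measurable_funM; do ?[exact: measurable_funM];
  apply: continuous_measurable_fun; exact: continuous_tail.
Qed.

(** The kernel is at most t - x in absolute value, so the inequality defining the weight halves the
    weighted norm, with the same [w] for every [k]. *)
Lemma vol_le k q u w d M D x : 0 < k -> potential q -> weight q w d M ->
  measurable_fun setT u -> 0 <= D ->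
  (forall t, 0 <= t -> `|u t| <= D * w t) -> 0 <= x ->
  `|vol k q u x| <= D * w x / 2.
Proof.
move=> k0 pq [mw d0 wdM wx] mu_ D0 uD x0; have [iq _ _] := pq.
have w0 t : 0 < w t by rewrite (lt_le_trans d0)//; case/andP: (wdM t).
have uB t : 0 <= t -> `|u t| <= D * M.
  by move=> t0; rewrite (le_trans (uD _ t0))// ler_wpM2l//; case/andP: (wdM t).
have iqu := L1_potentialM pq mu_ uB.
have iv := L1_vol x k0 iqu.
have iw : L1 (fun t => `|q t| * w t * (t - x)).
  apply: L1_potential_shift; apply: (@potentialM _ _ _ M) => //.
    exact: potential_abs.
  by move=> t _; rewrite gtr0_norm//; case/andP: (wdM t).
rewrite (le_trans (norm_tail_le _ iv))// -mulrA.
apply: le_trans (ler_wpM2l D0 (wx x x0)).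
rewrite -tailZ//; apply: le_tail; [exact: L1_abs|exact: L1Z|].
move=> t xt; rewrite !normrM -[_ * `|k^-1|]normrM.
rewrite [leRHS](_ : _ = `|q t| * (D * w t) * (t - x)); last by ring.
rewrite ler_pM// ?mulr_ge0//; last by rewrite abs_sinc_le// subr_ge0.
by rewrite ler_wpM2l// uD// (le_trans x0).
Qed.

Lemma le0_geometric (V A : R) : (forall n, V <= A * 2^-1 ^+ n) -> V <= 0.
Proof.
move=> VA; rewrite leNgt; apply/negP => V0.
have A0 : 0 <= A / V by rewrite divr_ge0 ?(ltW V0)// (le_trans (ltW V0))// (le_trans (VA 0%N))// expr0 mulr1.
have := VA (Num.bound (A / V)); set n := Num.bound _.
rewrite exprVn ler_pdivlMr ?exprn_gt0// leNgt => /negP; apply.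
rewrite mulrC -ltr_pdivrMr//; apply: (lt_le_trans (archi_boundP A0)).
by rewrite -/n -natrX ler_nat ltnW// ltn_expl.
Qed.

End VolterraEquation.

(** * Existence and uniqueness for the Volterra equation *)

Section VolterraSolutions.
Variable R : realType.
Implicit Types (q u v g w h F : R -> R) (k x t : R).
Local Notation mu := (@lebesgue_measure R).

Lemma volB k q u v x : 0 < k -> L1 (fun t => q t * u t) -> L1 (fun t => q t * v t) ->
  vol k q (fun t => u t - v t) x = vol k q u x - vol k q v x.
Proof.
move=> k0 iu iv; rewrite /vol -tailB; [|exact: L1_vol|exact: L1_vol].
by apply: eq_tail => t _; ring.
Qed.

(** The difference of two solutions is fixed by the operator, so its weighted norm can be halved
    indefinitely. *)
Lemma volterra_unique k q g u v B : 0 < k -> potential q ->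
  measurable_fun setT u -> measurable_fun setT v ->
  (forall x, 0 <= x -> `|u x| <= B) -> (forall x, 0 <= x -> `|v x| <= B) ->
  (forall x, 0 <= x -> u x = g x + vol k q u x) ->
  (forall x, 0 <= x -> v x = g x + vol k q v x) ->
  forall x, 0 <= x -> u x = v x.
Proof.
move=> k0 pq mu_ mv uB vB uE vE x x0.
have [w [d [M wM]]] := weight_exists pq.
have [mw d0 wd _] := wM.
have iu := L1_potentialM pq mu_ uB; have iv := L1_potentialM pq mv vB.
have B0 : 0 <= B by exact: le_trans (uB 0 (lexx 0)).
have duv n : forall t, 0 <= t -> `|u t - v t| <= (2 * B / d * 2^-1 ^+ n) * w t.
  elim: n => [|n ih] t t0.
    rewrite expr0 mulr1 (le_trans (ler_normB _ _))//.
    rewrite mulrAC; apply: (@le_trans _ _ (2 * B)).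
      by rewrite mulr_natl mulr2n lerD ?uB ?vB.
    rewrite ler_pdivlMr// ler_wpM2l ?mulr_ge0//.
    by case/andP: (wd t).
  rewrite uE// vE// opprD addrACA subrr add0r -volB//.
  rewrite (le_trans (vol_le k0 pq wM _ _ ih t0))//.
  - exact: measurable_funB.
  - by rewrite mulr_ge0 ?exprn_ge0// divr_ge0 ?mulr_ge0// ltW.
  - by rewrite exprSr mulrA mulrAC.
apply/eqP; rewrite -subr_eq0 -normr_le0.
apply: (@le0_geometric _ _ (2 * B / d * w x)) => n.
by rewrite mulrAC; exact: duv.
Qed.

Lemma volterra_exists k q g G : 0 < k -> potential q ->
  measurable_fun setT g -> (forall x, `|g x| <= G) ->
  exists u B, [/\ measurable_fun setT u, forall x, `|u x| <= B &
    forall x, u x = g x + vol k q u x].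
Proof.
move=> k0 pq mg gG.
have [w [d [M wM]]] := weight_exists pq.
have [mw d0 wd _] := wM; have [iq _ qneg] := pq.
have w0 t : 0 <= w t by rewrite (le_trans (ltW d0))//; case/andP: (wd t).
have wleM t : w t <= M by case/andP: (wd t).
have G0 : 0 <= G by rewrite (le_trans _ (gG 0)).
have [D D0 gDw] : exists2 D, 0 <= D & forall t, `|g t| <= D * w t.
  exists (G / d) => [|t]; first by rewrite divr_ge0// ltW.
  rewrite (le_trans (gG t))// mulrAC ler_pdivlMr// ler_wpM2l//.
  by case/andP: (wd t).
(* The weight inequality holds for [x >= 0] only; cutting the iterates to 0 elsewhere keeps them
   bounded on the whole line. *)
pose T u := (fun x => g x + vol k q u x) \_ `[0, +oo[.
have TE u x : 0 <= x -> T u x = g x + vol k q u x.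
  by move=> x0; rewrite /T patchE mem_set//= in_itv/= x0.
have Tneg u x : x < 0 -> T u x = 0.
  by move=> x0; rewrite /T patchE memNset//= in_itv/= andbT leNgt x0.
pose U n := iter n T (fun=> 0).
have UE n x : 0 <= x -> U n.+1 x = g x + vol k q (U n) x.
  by move=> x0; rewrite /U iterS TE.
(* The radius [2 * D] is preserved: [D] comes from [g], and half of [2 * D] from [vol]. *)
have UP n : measurable_fun setT (U n) /\ forall t, 0 <= t -> `|U n t| <= 2 * D * w t.
  elim: n => [|n [mU Uw]].
    split; first exact: measurable_cst.
    by move=> t _; rewrite /U/= normr0 !mulr_ge0.
  have UB t : 0 <= t -> `|U n t| <= 2 * D * M.
    by move=> t0; rewrite (le_trans (Uw t t0))// ler_wpM2l// mulr_ge0.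
  split.
    apply: measurable_patch => //; apply: measurable_funD => //.
    apply: measurable_vol; exact: L1_potentialM UB.
  move=> t t0; rewrite UE// (le_trans (ler_normD _ _))//.
  have D20 : 0 <= 2 * D by rewrite mulr_ge0.
  have := vol_le k0 pq wM mU D20 Uw t0; have := gDw t; lra.
have mU n := (UP n).1.
have UB n t : `|U n t| <= 2 * D * M.
  have [t0|t0] := ltP t 0; last first.
    by rewrite (le_trans ((UP n).2 t t0))// ler_wpM2l// mulr_ge0.
  have -> : U n t = 0 by case: n => // n; rewrite /U iterS Tneg.
  by rewrite normr0 !mulr_ge0// (le_trans (w0 0)).
have iU n : L1 (fun t => q t * U n t).
  by apply: (L1_potentialM pq (mU n)) => t _; exact: UB.
have dU n : forall t, 0 <= t -> `|U n.+1 t - U n t| <= D * 2^-1 ^+ n * w t.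
  elim: n => [|n ih] t t0.
    rewrite expr0 mulr1 /U/= subr0 TE//.
    rewrite (_ : vol _ _ _ _ = 0) ?addr0//.
    rewrite /vol (eq_tail (g := fun=> 0 * 0)); last by move=> s _; ring.
    by rewrite tailZ ?mul0r//; exact: integrable0.
  rewrite (UE n.+1)// (UE n)//.
  rewrite opprD addrACA subrr add0r -volB//.
  rewrite (le_trans (vol_le k0 pq wM _ _ ih t0))//.
  - exact: measurable_funB.
  - by rewrite mulr_ge0 ?exprn_ge0.
  - by rewrite exprSr mulrA mulrAC.
have cU t : cvgn (fun n => U n t).
  rewrite (_ : (fun n => U n t) = (fun n => U 0%N t + series (telescope (U^~ t)) n)); last first.
    by apply/funext => n; rewrite -(eq_sum_telescope (U^~ t)).
  apply: is_cvgD; first exact: is_cvg_cst.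
  apply: normed_cvg; apply: (@series_le_cvg _ _ (geometric (D * M) 2^-1)).
  - by move=> n; rewrite /= normr_ge0.
  - by move=> n; rewrite /= !mulr_ge0// ?exprn_ge0// (le_trans (w0 0)).
  - move=> n; change (`|U n.+1 t - U n t| <= D * M * 2^-1 ^+ n).
    have [t0|t0] := ltP t 0.
      have U0 m : U m t = 0 by case: m => // m; rewrite /U iterS Tneg.
      rewrite !U0 subrr normr0.
      by rewrite !mulr_ge0// ?exprn_ge0// (le_trans (w0 0)).
    rewrite (le_trans (dU n t t0))// [leRHS]mulrAC ler_wpM2l//.
    by rewrite mulr_ge0 ?exprn_ge0.
  - by apply: is_cvg_geometric_series; rewrite ger0_norm ?invr_ge0// invf_lt1// ltr1n.
pose u t := limn (fun n => U n t).
have Uu t : U n t @[n --> \oo] --> u t by exact: cU.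
have mu_ : measurable_fun setT u by apply: (measurable_fun_cvg mU) => t _; exact: Uu.
have uB t : `|u t| <= 2 * D * M.
  have cn : `|U n t| @[n --> \oo] --> `|u t| by apply: cvg_norm; exact: Uu.
  rewrite -(cvg_lim (@Rhausdorff R) cn).
  apply: limr_le; first by apply/cvg_ex; exists `|u t|.
  by apply: nearW => n; exact: UB.
have iu : L1 (fun t => q t * u t).
  by apply: (L1_potentialM pq mu_) => t _; exact: uB.
have uE x : 0 <= x -> u x = g x + vol k q u x.
  move=> x0; apply: (@cvg_unique _ (@Rhausdorff R) (U n.+1 x @[n --> \oo])).
    by have := Uu x; rewrite -(cvg_shiftS (fun n => U n x)).
  rewrite (_ : (fun n => U n.+1 x) = (fun n => g x + vol k q (U n) x)); last first.
    by apply/funext => n; rewrite UE.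
  apply: cvgD; first exact: cvg_cst.
  have ia := L1_abs iq.
  have [||||_] := @L1_dominated R (fun n t => q t * U n t * (sin (k * (t - x)) / k))
     (fun t => q t * u t * (sin (k * (t - x)) / k))
     (fun t => 2 * D * M / k * `|q t|).
  - by move=> n; apply: L1_measurable; exact: L1_vol.
  - by move=> t; apply: cvgM; [apply: cvgM; [exact: cvg_cst|exact: Uu]|exact: cvg_cst].
  - exact: L1Z.
  - move=> n t; rewrite !normrM -[_ * `|k^-1|]normrM.
    rewrite [leRHS](_ : _ = `|q t| * (2 * D * M) * k^-1); last by ring.
    by rewrite ler_pM ?mulr_ge0// ?abs_sinc_le_inv// ler_wpM2l.
  - by apply.
have iv x := L1_vol x k0 iu.
(* The limit [u] solves the equation for [x >= 0] only. One more application of g + vol gives a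
   solution at every real [x], because [q] hides negative arguments from [vol]. *)
have qE : vol k q (fun x => g x + vol k q u x) =1 vol k q u.
  move=> x; apply: eq_tail => t _; have [t0|t0] := ltP t 0.
    by rewrite qneg// !mul0r.
  by rewrite uE.
exists (fun x => g x + vol k q u x), (G + 2 * D * M / k * \int[mu]_t `|q t|); split.
- by apply: measurable_funD => //; exact: measurable_vol.
- move=> x; rewrite (le_trans (ler_normD _ _))// lerD//.
  rewrite (le_trans (norm_tail_le _ (iv x)))// -RintegralZl//; last exact: (L1_abs iq).
  apply: (@le_trans _ _ (tail (fun t => 2 * D * M / k * `|q t|) x)).
    apply: le_tail; [exact/L1_abs/iv|exact/L1Z/L1_abs|move=> t _].
    rewrite !normrM -[_ * `|k^-1|]normrM.
    rewrite [leRHS](_ : _ = `|q t| * (2 * D * M) * k^-1); last by ring.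
    by rewrite ler_pM ?mulr_ge0// ?abs_sinc_le_inv// ler_wpM2l.
  apply: subset_Rintegral => //; first exact/L1Z/L1_abs.
  move=> t; rewrite !mulr_ge0// ?invr_ge0 ?(ltW k0)//.
  by rewrite (le_trans (w0 0)).
- by move=> x; rewrite qE.
Qed.

End VolterraSolutions.

(** * From the Volterra equation to the differential equation *)

Section VolterraODE.
Variable R : realType.
Implicit Types (q u v g w h F G : R -> R) (k x t a b : R).
Local Notation mu := (@lebesgue_measure R).

Definition bounded_ac F : Prop :=
  (exists2 M, 0 < M & forall x, `|F x| <= M) /\
  (forall a b, absolutely_continuous_on a b F).

Lemma bounded_acD F G : bounded_ac F -> bounded_ac G ->
  bounded_ac (fun x => F x + G x).
Proof.
move=> [[M M0 FM] aF] [[N N0 GN] aG]; split.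
  exists (M + N) => [|x]; first exact: addr_gt0.
  by rewrite (le_trans (ler_normD _ _))// lerD.
by move=> a b; exact: acD.
Qed.

Lemma bounded_acM F G : bounded_ac F -> bounded_ac G ->
  bounded_ac (fun x => F x * G x).
Proof.
move=> [[M M0 FM] aF] [[N N0 GN] aG]; split.
  exists (M * N) => [|x]; first exact: mulr_gt0.
  by rewrite normrM ler_pM.
move=> a b; apply: (acM (M := Num.max M N)) => //; first by rewrite lt_max M0.
- by move=> x _; rewrite le_max FM.
- by move=> x _; rewrite le_max GN orbT.
Qed.

Lemma bounded_ac_cst a : bounded_ac (fun=> a).
Proof.
split; first by exists (`|a| + 1) => [|x]; [rewrite ltr_wpDl|rewrite lerDl].
by move=> c d; apply: (@ac_lipschitz _ _ _ _ 0) => // *; rewrite subrr normr0 mul0r.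
Qed.

Lemma bounded_ac_tail h : L1 h -> bounded_ac (tail h).
Proof.
move=> ih; split; last by move=> a b; exact: ac_tail.
have ia := L1_abs ih.
exists (\int[mu]_t `|h t| + 1) => [|x].
  by rewrite ltr_wpDl// Rintegral_ge0.
rewrite (le_trans (norm_tail_le _ ih))// ler_wpDr//.
exact: subset_Rintegral.
Qed.

Lemma bounded_ac_lip F dF M : 0 < M -> (forall x, `|F x| <= M) ->
  (forall x, is_derive x 1 F (dF x)) -> (forall x, `|dF x| <= M) -> bounded_ac F.
Proof.
move=> M0 FM dF' dFM; split; first by exists M.
move=> a b; apply: (ac_lipschitz (ltW M0)) => x y _ xy _.
move: xy; rewrite le_eqVlt => /orP[/eqP->|xy]; first by rewrite !subrr normr0 mulr0.
have [c _ ->] : exists2 c : R, c \in `]x, y[%R & F y - F x = dF c * (y - x).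
  apply: (@MVT R F dF) => //; apply: continuous_subspaceT => z.
  apply: differentiable_continuous; apply/derivable1_diffP.
  by have := dF' z => -[].
by rewrite normrM (gtr0_norm (_ : 0 < y - x)) ?subr_gt0// ler_wpM2r// ltW// subr_gt0.
Qed.

Lemma is_derive_sinM k x : is_derive x 1 (fun t => sin (k * t)) (k * cos (k * x)).
Proof.
have d1 : is_derive x 1 (fun t : R => k * t) k.
  by apply: is_derive_eq; rewrite /GRing.scale/= mulr1 ?addr0.
by have := is_derive1_comp (is_derive_sin (k * x)) d1; rewrite mulrC.
Qed.

Lemma is_derive_cosM k x : is_derive x 1 (fun t => cos (k * t)) (- (k * sin (k * x))).
Proof.
have d1 : is_derive x 1 (fun t : R => k * t) k.
  by apply: is_derive_eq; rewrite /GRing.scale/= mulr1 ?addr0.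
by have := is_derive1_comp (is_derive_cos (k * x)) d1; rewrite mulrC mulrN.
Qed.

Lemma bounded_ac_sin k : bounded_ac (fun t => sin (k * t)).
Proof.
apply: (@bounded_ac_lip _ (fun x => k * cos (k * x)) (`|k| + 1)).
- by rewrite ltr_wpDl.
- by move=> x; rewrite (le_trans (sin_max _))// lerDr.
- by move=> x; exact: is_derive_sinM.
- by move=> x; rewrite normrM ler_wpDr// ler_piMr// cos_max.
Qed.

Lemma bounded_ac_cos k : bounded_ac (fun t => cos (k * t)).
Proof.
apply: (@bounded_ac_lip _ (fun x => - (k * sin (k * x))) (`|k| + 1)).
- by rewrite ltr_wpDl.
- by move=> x; rewrite (le_trans (cos_max _))// lerDr.
- by move=> x; exact: is_derive_cosM.
- by move=> x; rewrite normrN normrM ler_wpDr// ler_piMr// sin_max.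
Qed.

Section FromVolterra.
Variables (k : R) (q u : R -> R) (a b : R).
Hypotheses (k0 : 0 < k) (iqu : L1 (fun t => q t * u t)).
Hypothesis uE : forall x, u x = a * cos (k * x) + b * sin (k * x) + vol k q u x.

(** Variation of parameters: this and [vol_sin_coef] are the amplitudes A, B in u = A cos(kx) + B
    sin(kx). Almost everywhere A' cos(kx) + B' sin(kx) = 0, so u' is obtained by differentiating
    only the waves, as in [vol_deriv]. *)
Definition vol_cos_coef x := a + k^-1 * tail (fun t => q t * u t * sin (k * t)) x.
Definition vol_sin_coef x := b - k^-1 * tail (fun t => q t * u t * cos (k * t)) x.
Definition vol_deriv x :=
  k * (cos (k * x) * vol_sin_coef x - sin (k * x) * vol_cos_coef x).

Lemma vol_coefE x : u x = cos (k * x) * vol_cos_coef x + sin (k * x) * vol_sin_coef x.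
Proof. by rewrite uE volE// /vol_cos_coef /vol_sin_coef; ring. Qed.

(** The free wave with amplitudes frozen at [x]; it is tangent to [u] there. *)
Let p x y := cos (k * y) * vol_cos_coef x + sin (k * y) * vol_sin_coef x.

(** The difference is an integral between x and y with a kernel at most |y - x|, hence o(|y - x|).
    This gives the derivative of [u] at every point, although the amplitudes are known to be
    differentiable only almost everywhere. *)
Lemma vol_remainder x y :
  `|u y - p x y| <= `|y - x| * `|tail (fun t => `|q t * u t|) y - tail (fun t => `|q t * u t|) x|.
Proof.
pose h t := q t * u t * (sin (k * (t - y)) / k).
have ih : L1 h by exact: L1_vol.
have hE z : p z y = a * cos (k * y) + b * sin (k * y) + tail h z.
  rewrite (_ : tail h z = cos (k * y) / k * tail (fun t => q t * u t * sin (k * t)) z -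
                sin (k * y) / k * tail (fun t => q t * u t * cos (k * t)) z).
    by rewrite /p /vol_cos_coef /vol_sin_coef; ring.
  have is_ := L1_sin k iqu; have ic := L1_cos k iqu.
  rewrite -!tailZ// -tailB; [|exact: L1Z|exact: L1Z].
  by apply: eq_tail => t _; rewrite /h mulrBr sinB; ring.
have -> : u y - p x y = tail h y - tail h x by rewrite uE hE /vol -/h; ring.
have ia := L1_abs iqu.
have key c d : c <= d -> (c = y) \/ (d = y) ->
    `|tail h c - tail h d| <= (d - c) * (tail (fun t => `|q t * u t|) c - tail (fun t => `|q t * u t|) d).
  move=> cd cdy; rewrite !tailB_itv//.
  apply: (le_trans (le_normr_Rintegral _ _)) => //; first exact: L1S.
  rewrite -RintegralZl//; last exact: L1S.
  apply: le_Rintegral => //.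
  - by apply: L1S => //; exact: L1_abs.
  - by apply: L1S => //; exact: L1Z.
  move=> t /=; rewrite in_itv/= => /andP[ct td].
  rewrite /h [leLHS]normrM mulrC ler_wpM2r//.
  case: cdy => E.
    by rewrite E in ct *; rewrite (le_trans (abs_sinc_le k0 _)) ?subr_ge0// lerB// ltW.
  rewrite -E -opprB mulrN sinN mulNr normrN (le_trans (abs_sinc_le k0 _)) ?subr_ge0//.
    exact: ltW.
  by rewrite lerD2l lerN2.
have mono c d : c <= d -> 0 <= tail (fun t => `|q t * u t|) c - tail (fun t => `|q t * u t|) d.
  by move=> cd; rewrite subr_ge0 tail_nonincreasing.
have [yx|xy] := leP y x.
  rewrite (_ : `|y - x| = x - y); last by rewrite distrC ger0_norm ?subr_ge0.
  by rewrite (ger0_norm (mono _ _ yx)); apply: key => //; left.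
have xy' := ltW xy.
rewrite (gtr0_norm (_ : 0 < y - x)) ?subr_gt0//.
rewrite [X in _ * X]distrC (ger0_norm (mono _ _ xy')) distrC.
by apply: key => //; right.
Qed.

Lemma vol_Rp_deriv x : Rp_deriv u x (vol_deriv x).
Proof.
move=> e e0; have e20 : 0 < e / 2 by rewrite divr_gt0.
have dp : is_derive x 1 (p x) (vol_deriv x).
  have dc := is_derive_cosM k x; have ds := is_derive_sinM k x.
  apply: is_derive_eq; rewrite /GRing.scale/= /vol_deriv; ring.
have [r1 r10 h1] := is_derive_dist dp e20.
have ia := L1_abs iqu.
have /cvgrPdist_lt/(_ _ e20)[r2 /= r20 h2] := continuous_tail ia (x := x).
exists (Num.min r1 r2); first by rewrite lt_min r10.
move=> y _; rewrite lt_min => /andP[y1 y2].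
have -> : u y - u x - vol_deriv x * (y - x) =
    (u y - p x y) + (p x y - p x x - vol_deriv x * (y - x)).
  by rewrite [u x]vol_coefE -/(p x x); ring.
rewrite (le_trans (ler_normD _ _))// [e]splitr mulrDl lerD ?h1//.
rewrite (le_trans (vol_remainder x y))// mulrC ler_wpM2r// distrC ltW//.
by apply: h2; rewrite /ball/= distrC.
Qed.

Lemma vol_real_solution : real_solution q k u vol_deriv.
Proof.
have is_ := L1_sin k iqu; have ic := L1_cos k iqu.
split.
- by move=> x _; exact: vol_Rp_deriv.
- move=> c _.
  have ba_cos : bounded_ac vol_cos_coef.
    apply: bounded_acD; first exact: bounded_ac_cst.
    by apply: bounded_acM; [exact: bounded_ac_cst|exact: bounded_ac_tail].
  have ba_sin : bounded_ac vol_sin_coef.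
    rewrite (_ : vol_sin_coef = fun x => b + - k^-1 * tail (fun t => q t * u t * cos (k * t)) x); last first.
      by apply/funext => x; rewrite /vol_sin_coef mulNr.
    apply: bounded_acD; first exact: bounded_ac_cst.
    by apply: bounded_acM; [exact: bounded_ac_cst|exact: bounded_ac_tail].
  suff [] : bounded_ac vol_deriv by [].
  apply: bounded_acM; first exact: bounded_ac_cst.
  apply: bounded_acD; first by apply: bounded_acM => //; exact: bounded_ac_cos.
  rewrite (_ : (fun x => - _) = fun x => -1 * (sin (k * x) * vol_cos_coef x)); last first.
    by apply/funext => x; rewrite mulN1r.
  apply: bounded_acM; first exact: bounded_ac_cst.
  by apply: bounded_acM => //; exact: bounded_ac_sin.
- have := ae_is_derive_tail is_; apply: filterS2 (ae_is_derive_tail ic).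
    exact: (ae_filter_ringOfSetsType mu).
  move=> x Dc Ds _; have dc := is_derive_cosM k x; have ds := is_derive_sinM k x.
  rewrite /vol_deriv /vol_sin_coef /vol_cos_coef.
  apply: is_derive_eq; rewrite /GRing.scale/=.
  have kn0 : k != 0 by rewrite gt_eqF.
  transitivity (q x * u x * (cos (k * x) ^+ 2 + sin (k * x) ^+ 2) -
      k ^+ 2 * (cos (k * x) * vol_cos_coef x + sin (k * x) * vol_sin_coef x)).
    by rewrite /vol_sin_coef /vol_cos_coef; field.
  by rewrite cos2Dsin2 -vol_coefE; ring.
Qed.

Lemma vol_coef_cvg : (vol_cos_coef x @[x --> +oo] --> a) /\
  (vol_sin_coef x @[x --> +oo] --> b).
Proof.
have is_ := L1_sin k iqu; have ic := L1_cos k iqu.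
split.
- rewrite -[X in _ --> X]addr0; apply: cvgD; first exact: cvg_cst.
  by rewrite -(mulr0 k^-1); apply: cvgM; [exact: cvg_cst|exact: tail_cvg0].
- rewrite -[X in _ --> X]subr0; apply: cvgB; first exact: cvg_cst.
  by rewrite -(mulr0 k^-1); apply: cvgM; [exact: cvg_cst|exact: tail_cvg0].
Qed.

Lemma cvg0_bounded_mul F G : (forall x, `|F x| <= 1) -> G x @[x --> +oo] --> (0 : R) ->
  F x * G x @[x --> +oo] --> (0 : R).
Proof.
move=> F1 G0; apply/norm_cvg0P.
have {}G0 : `|G x| @[x --> +oo] --> (0 : R) by apply/norm_cvg0P.
apply: squeeze_cvgr (@cvg_cst _ (0 : R) _ _ _) G0.
by apply: nearW => x; rewrite normr_ge0/= normrM ler_piMl.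
Qed.

Lemma vol_asymptotic : asymptotic u (fun x => a * cos (k * x) + b * sin (k * x)).
Proof.
have [ca cb] := vol_coef_cvg; rewrite /asymptotic.
rewrite (_ : (fun x => _) = fun x => cos (k * x) * (vol_cos_coef x - a) +
    sin (k * x) * (vol_sin_coef x - b)); last first.
  by apply/funext => x; rewrite vol_coefE; ring.
rewrite -[0]addr0; apply: cvgD; apply: cvg0_bounded_mul.
- by move=> x; exact: cos_max.
- by rewrite -(subrr a); apply: cvgB => //; exact: cvg_cst.
- by move=> x; exact: sin_max.
- by rewrite -(subrr b); apply: cvgB => //; exact: cvg_cst.
Qed.

End FromVolterra.

(** Along the points 2 pi n / k the combination is constantly [a], and along (pi / 2 + 2 pi n) / k
    it is constantly [b]. *)
Lemma trig_asymptotic0 k a b : 0 < k ->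
  a * cos (k * x) + b * sin (k * x) @[x --> +oo] --> (0 : R) -> a = 0 /\ b = 0.
Proof.
move=> k0 /cvg_pinftyP cab.
have seq_oo c : (c + (pi *+ 2) *+ n) / k @[n --> \oo] --> +oo.
  apply/cvgryPge => A; have := archi_boundP (normr_ge0 (A * k - c)).
  set N := Num.bound _ => hN; exists N => // n /= Nn.
  rewrite ler_pdivlMr// -lerBlDl (le_trans (ler_norm _))// (le_trans (ltW hN))//.
  rewrite -[_ *+ n]mulr_natr -[N%:R]mul1r ler_pM// ?ler_nat//.
  rewrite mulr2n (le_trans _ (lerD (pi_ge2 R) (pi_ge2 R)))//.
  by rewrite -natrD ler1n.
have kn0 : k != 0 by rewrite gt_eqF.
have := cab _ (seq_oo 0); have := cab _ (seq_oo (pi / 2)).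
under eq_fun do rewrite [k * _]mulrC divfK// (periodicn (@cosD2pi R)) (periodicn (@sinD2pi R)).
rewrite cos_pihalf sin_pihalf mulr0 add0r mulr1 => cb.
under eq_fun do rewrite [k * _]mulrC divfK// (periodicn (@cosD2pi R)) (periodicn (@sinD2pi R)).
rewrite cos0 sin0 mulr0 addr0 mulr1 => ca.
split.
- exact: (cvg_unique (@Rhausdorff R) (cvg_cst a) ca).
- exact: (cvg_unique (@Rhausdorff R) (cvg_cst b) cb).
Qed.

End VolterraODE.

(** * Jost solutions *)

Section JostSolutions.
Variable R : realType.
Implicit Types (q u v g w h F G : R -> R) (k x t a b : R).
Local Notation mu := (@lebesgue_measure R).
Local Notation RE := (@complex.Re R).
Local Notation IM := (@complex.Im R).

(** Clamping the argument replaces the arbitrary values at negative arguments by [F 0]; the clamp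
    does not increase distances. *)
Lemma Rp_deriv_continuous_max F dF : (forall x, 0 <= x -> Rp_deriv F x (dF x)) ->
  continuous (fun x => F (Num.max 0 x)).
Proof.
move=> FdF x; set m := Num.max 0 x.
have m0 : 0 <= m by rewrite le_max lexx.
have [r r0 hr] := FdF m m0 1 ltr01.
have K0 : 0 < `|dF m| + 1 by rewrite ltr_wpDl.
apply/cvgrPdist_lt => e e0.
exists (Num.min r (e / (`|dF m| + 1))) => /=; first by rewrite lt_min r0 divr_gt0.
move=> y; rewrite /ball/= distrC lt_min => /andP[yr ye]; rewrite -/m.
set n := Num.max 0 y; have n0 : 0 <= n by rewrite le_max lexx.
have nm : `|n - m| <= `|y - x|.
  rewrite /n /m; have [?|?] := leP 0 y; have [?|?] := leP 0 x => //.
  - by rewrite subr0 ger0_norm// ger0_norm; lra.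
  - by rewrite sub0r normrN ger0_norm// ler0_norm; lra.
  - by rewrite subrr normr0.
rewrite distrC (_ : F n - F m = (F n - F m - dF m * (n - m)) + dF m * (n - m)); last by ring.
rewrite (le_lt_trans (ler_normD _ _))//.
apply: (@le_lt_trans _ _ ((`|dF m| + 1) * `|y - x|)); last first.
  by rewrite mulrC -ltr_pdivlMr.
apply: (@le_trans _ _ ((`|dF m| + 1) * `|n - m|)); last by rewrite ler_wpM2l// ltW.
rewrite addrC mulrDl normrM lerD2l; apply: hr => //.
exact: le_lt_trans yr.
Qed.

Lemma real_solution_cos k : real_solution (fun=> 0) k (fun x => cos (k * x))
  (fun x => - (k * sin (k * x))).
Proof.
split.
- by move=> x _; apply: is_derive_Rp_deriv; exact: is_derive_cosM.
- move=> b _; suff [_] : bounded_ac (fun x => - k * sin (k * x)).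
    move/(_ 0 b); rewrite (_ : (fun x => - k * _) = fun x => - (k * sin (k * x)))//.
    by apply/funext => x; rewrite mulNr.
  by apply: bounded_acM; [exact: bounded_ac_cst|exact: bounded_ac_sin].
- apply: aeW => x _; have ds := is_derive_sinM k x.
  by apply: is_derive_eq; rewrite /GRing.scale/=; ring.
Qed.

Lemma real_solution_sin k : real_solution (fun=> 0) k (fun x => sin (k * x))
  (fun x => k * cos (k * x)).
Proof.
split.
- by move=> x _; apply: is_derive_Rp_deriv; exact: is_derive_sinM.
- move=> b _; suff [_] : bounded_ac (fun x => k * cos (k * x)) by [].
  by apply: bounded_acM; [exact: bounded_ac_cst|exact: bounded_ac_cos].
- apply: aeW => x _; have ds := is_derive_cosM k x.
  by apply: is_derive_eq; rewrite /GRing.scale/=; ring.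
Qed.

Lemma real_solution_bounded q k u du a b : real_solution q k u du ->
  asymptotic u (fun x => a * cos (k * x) + b * sin (k * x)) ->
  exists B, forall x, 0 <= x -> `|u x| <= B.
Proof.
move=> su /cvgr0Pnorm_lt/(_ 1 ltr01)[X [_ hX]].
have X0 : 0 < `|X| + 1 by rewrite ltr_wpDl.
have [M M0 uM] := ac_bounded (real_solution_ac su X0).
exists (M + (`|a| + `|b| + 1)) => x x0.
have [xX|Xx] := leP x (`|X| + 1).
  by rewrite (le_trans (uM x _)) ?x0// lerDl !addr_ge0.
have /hX/ltW ux : X < x.
  by rewrite (le_lt_trans (ler_norm X))// (lt_trans _ Xx)// ltrDl.
rewrite -[u x](subrK (a * cos (k * x) + b * sin (k * x))).
rewrite (le_trans (ler_normD _ _))// addrC (le_trans (lerD (ler_normD _ _) ux))//.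
rewrite ler_wpDl ?(ltW M0)// lerD2r !normrM lerD// ler_piMr// ?cos_max ?sin_max//.
Qed.

(** The Wronskians with cos(kx) and sin(kx) express [u] and [du] through tails and two constants.
    Solving for [u] gives the Volterra equation up to a free wave, which the asymptotics
    identify. *)
Lemma real_solution_volterra q k u du a b : 0 < k -> potential q ->
  real_solution q k u du ->
  asymptotic u (fun x => a * cos (k * x) + b * sin (k * x)) ->
  let U x := u (Num.max 0 x) in
  [/\ measurable_fun setT U, exists B, forall x, `|U x| <= B &
    forall x, 0 <= x -> U x = a * cos (k * x) + b * sin (k * x) + vol k q U x].
Proof.
move=> k0 pq su asy U.
have UE x : 0 <= x -> U x = u x by move=> x0; rewrite /U; congr u; apply/max_idPr.
have mU : measurable_fun setT U.
  apply: continuous_measurable_fun; have [dF _ _] := su.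
  exact: Rp_deriv_continuous_max dF.
have [B uB] := real_solution_bounded su asy.
have UB x : `|U x| <= B by rewrite /U uB// le_max lexx.
split; [by []|by exists B|].
have iqU : L1 (fun t => q t * U t) by apply: (L1_potentialM pq mU) => x _; exact: UB.
have is_ := L1_sin k iqU; have ic := L1_cos k iqU.
pose S := tail (fun t => q t * U t * sin (k * t)).
pose C := tail (fun t => q t * U t * cos (k * t)).
have [al hal] : exists al, forall x, 0 < x ->
    du x * cos (k * x) + k * u x * sin (k * x) = al - C x.
  exists (du 0 + C 0) => x x0.
  have gE t : 0 <= t -> q t * U t * cos (k * t) = (q t - 0) * u t * cos (k * t).
    by move=> t0; rewrite UE// subr0.
  have := wronskian x0 su (real_solution_cos k) ic gE.
  by rewrite mulr0 cos0 sin0 -/(C 0) -/(C x); lra.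
have [be hbe] : exists be, forall x, 0 < x ->
    du x * sin (k * x) - k * u x * cos (k * x) = be - S x.
  exists (- k * u 0 + S 0) => x x0.
  have gE t : 0 <= t -> q t * U t * sin (k * t) = (q t - 0) * u t * sin (k * t).
    by move=> t0; rewrite UE// subr0.
  have := wronskian x0 su (real_solution_sin k) is_ gE.
  by rewrite mulr0 cos0 sin0 -/(S 0) -/(S x); lra.
have kn0 : k != 0 by rewrite gt_eqF.
have uE x : 0 < x -> u x = k^-1 * (sin (k * x) * (al - C x) - cos (k * x) * (be - S x)).
  move=> x0; rewrite -hal// -hbe//.
  transitivity (u x * (cos (k * x) ^+ 2 + sin (k * x) ^+ 2)).
    by rewrite cos2Dsin2 mulr1.
  by field.
have /(trig_asymptotic0 k0)[aE bE] :
    (a + be / k) * cos (k * x) + (b - al / k) * sin (k * x) @[x --> +oo] --> (0 : R).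
  have h1 : k^-1 * (cos (k * x) * S x - sin (k * x) * C x) @[x --> +oo] --> (0 : R).
    rewrite -(mulr0 k^-1); apply: cvgM; first exact: cvg_cst.
    rewrite -[0]subr0; apply: cvgB; apply: cvg0_bounded_mul.
    - by move=> x; exact: cos_max.
    - exact: (tail_cvg0 is_).
    - by move=> x; exact: sin_max.
    - exact: (tail_cvg0 ic).
  have h2 : k^-1 * (cos (k * x) * S x - sin (k * x) * C x) -
      (u x - (a * cos (k * x) + b * sin (k * x))) @[x --> +oo] --> (0 : R).
    by rewrite -[0]subr0; exact: cvgB h1 asy.
  apply: cvg_trans h2; apply: near_eq_cvg.
  exists 0; split => // x x0.
  by rewrite uE//; field.
have pos x : 0 < x -> U x = a * cos (k * x) + b * sin (k * x) + vol k q U x.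
  move=> x0; rewrite UE ?(ltW x0)// uE// volE// -/(S x) -/(C x).
  have -> : a = - (be / k) by lra.
  have -> : b = al / k by lra.
  by field.
have cU : continuous U.
  by have [dF _ _] := su; exact: Rp_deriv_continuous_max dF.
have cV : continuous (fun x => a * cos (k * x) + b * sin (k * x) + vol k q U x).
  rewrite (_ : (fun x => _) = fun x => a * cos (k * x) + b * sin (k * x) +
     (cos (k * x) / k * S x - sin (k * x) / k * C x)); last first.
    by apply/funext => x; rewrite volE.
  have cS : continuous S by exact: (continuous_tail is_).
  have cC : continuous C by exact: (continuous_tail ic).
  have cc : continuous (fun x => cos (k * x)).
    by have [_ /ac_continuous] := bounded_ac_cos k.
  have cs : continuous (fun x => sin (k * x)).
    by have [_ /ac_continuous] := bounded_ac_sin k.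
  move=> x; apply: cvgD; first by apply: cvgD; apply: cvgM; [exact: cvg_cst|exact: cc|exact: cvg_cst|exact: cs].
  apply: cvgB; apply: cvgM => //.
  - by apply: cvgM; [exact: cc|exact: cvg_cst].
  - exact: cS.
  - by apply: cvgM; [exact: cs|exact: cvg_cst].
  - exact: cC.
(* The Wronskian identity was applied on [0, x] with [x > 0]; the endpoint 0 follows by continuity
   from the right. *)
move=> x; rewrite le_eqVlt => /orP[/eqP <-|]; last exact: pos.
apply: (@cvg_unique _ (@Rhausdorff R) (U x @[x --> 0^'+])).
  by apply: cvg_at_right_filter; exact: cU.
have := cvg_at_right_filter (cV 0); apply: cvg_trans; apply: near_eq_cvg.
by apply: filterS (nbhs_right_gt 0) => y /pos.
Qed.

End JostSolutions.

(** * Wronskians at infinity and the I-function *)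

Section IFunction.
Variable R : realType.
Implicit Types (q u v g w h F G : R -> R) (k x t a b : R).
Local Notation mu := (@lebesgue_measure R).
Local Notation RE := (@complex.Re R).
Local Notation IM := (@complex.Im R).

(* [u] is the bounded solution of [u'' = (q - k^2) u] with
   [u(x) ~ a cos(kx) + b sin(kx)] at infinity. *)
Definition scattering_solution q k a b u : Prop :=
  [/\ measurable_fun setT u, exists B, forall x, `|u x| <= B &
    forall x, u x = a * cos (k * x) + b * sin (k * x) + vol k q u x].

Lemma scattering_solution_exists q k a b : 0 < k -> potential q ->
  exists u, scattering_solution q k a b u.
Proof.
move=> k0 pq.
pose g x := a * cos (k * x) + b * sin (k * x).
have mg : measurable_fun setT g.
  apply: continuous_measurable_fun; apply: ac_continuous.
  suff [] : bounded_ac g by [].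
  by apply: bounded_acD; apply: bounded_acM; [exact: bounded_ac_cst|
    exact: bounded_ac_cos|exact: bounded_ac_cst|exact: bounded_ac_sin].
have gG x : `|g x| <= `|a| + `|b|.
  rewrite (le_trans (ler_normD _ _))// !normrM lerD// ler_piMr//.
    exact: cos_max.
  exact: sin_max.
have [u [B [mu_ uB uE]]] := volterra_exists k0 pq mg gG.
by exists u; split => //; exists B.
Qed.

Lemma scattering_L1 q k a b u : potential q -> scattering_solution q k a b u ->
  L1 (fun t => q t * u t).
Proof.
by move=> pq [mu_ [B uB] _]; apply: (L1_potentialM pq mu_) => t _; exact: uB.
Qed.

Lemma scattering_real_solution q k a b u : 0 < k -> potential q ->
  scattering_solution q k a b u -> real_solution q k u (vol_deriv k q u a b).
Proof.
move=> k0 pq su; have [_ _ uE] := su.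
by apply: vol_real_solution => //; exact: scattering_L1 su.
Qed.

Lemma eq_real_solution q1 q2 k u du : (forall x, 0 <= x -> q1 x = q2 x) ->
  real_solution q1 k u du -> real_solution q2 k u du.
Proof.
move=> q12 [d a e]; split => //.
move: e; apply: filterS; first exact: (ae_filter_ringOfSetsType mu).
by move=> x + x0 => /(_ x0); rewrite q12// ltW.
Qed.

(** The Wronskian equals k times the determinant of the amplitudes, and these converge to the
    prescribed coefficients at infinity. *)
Lemma scattering_wronskian q1 q2 k a1 b1 u1 a2 b2 u2 : 0 < k ->
  potential q1 -> potential q2 ->
  scattering_solution q1 k a1 b1 u1 -> scattering_solution q2 k a2 b2 u2 ->
  tail (fun t => (q1 t - q2 t) * u1 t * u2 t) 0 =
  k * (b1 * a2 - a1 * b2) -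
  (vol_deriv k q1 u1 a1 b1 0 * u2 0 - u1 0 * vol_deriv k q2 u2 a2 b2 0).
Proof.
move=> k0 pq1 pq2 s1 s2.
have rs1 := scattering_real_solution k0 pq1 s1.
have rs2 := scattering_real_solution k0 pq2 s2.
have i1 := scattering_L1 pq1 s1; have i2 := scattering_L1 pq2 s2.
have [m1 [B1 uB1] uE1] := s1; have [m2 [B2 uB2] uE2] := s2.
pose g t := (q1 t - q2 t) * u1 t * u2 t.
have ig : L1 g.
  apply: (L1M m2 uB2); apply: (L1M m1 uB1).
  by apply: L1B; [case: pq1|case: pq2].
have W b : 0 < b -> vol_deriv k q1 u1 a1 b1 b * u2 b - u1 b * vol_deriv k q2 u2 a2 b2 b
     = vol_deriv k q1 u1 a1 b1 0 * u2 0 - u1 0 * vol_deriv k q2 u2 a2 b2 0 + tail g 0 - tail g b.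
  by move=> b0; have := wronskian b0 rs1 rs2 ig (fun x _ => erefl); lra.
set W0 := _ - u1 0 * _ in W *.
have [ca1 cb1] := vol_coef_cvg k a1 b1 i1.
have [ca2 cb2] := vol_coef_cvg k a2 b2 i2.
have lim1 : k * (vol_sin_coef k q1 u1 b1 x * vol_cos_coef k q2 u2 a2 x -
   vol_cos_coef k q1 u1 a1 x * vol_sin_coef k q2 u2 b2 x) @[x --> +oo] -->
   k * (b1 * a2 - a1 * b2).
  by apply: cvgM; [exact: cvg_cst|apply: cvgB; exact: cvgM].
have lim2 : W0 + tail g 0 - tail g x @[x --> +oo] --> W0 + tail g 0.
  rewrite -[X in _ --> X]subr0; apply: cvgB; first exact: cvg_cst.
  exact: tail_cvg0.
suff : k * (b1 * a2 - a1 * b2) = W0 + tail g 0 by move=> ->; rewrite addrC addKr.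
apply: (cvg_unique (@Rhausdorff R) lim1).
apply: cvg_trans lim2; apply: near_eq_cvg; exists 0; split => // x x0.
rewrite -W// /vol_deriv (vol_coefE i1 uE1 x) (vol_coefE i2 uE2 x).
set A1 := vol_cos_coef _ _ _ _ _; set A2 := vol_cos_coef _ _ _ _ _.
set C1 := vol_sin_coef _ _ _ _ _; set C2 := vol_sin_coef _ _ _ _ _.
transitivity (k * (C1 * A2 - A1 * C2) * (cos (k * x) ^+ 2 + sin (k * x) ^+ 2)).
  by ring.
by rewrite cos2Dsin2 mulr1.
Qed.

(** [F] with clamped argument and [u] satisfy the same Volterra equation on [0, +oo[; the
    derivatives at 0 then agree as limits of the same one-sided quotient. *)
Lemma scattering_uniq q k a b u F dF : 0 < k -> potential q ->
  scattering_solution q k a b u -> real_solution q k F dF ->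
  asymptotic F (fun x => a * cos (k * x) + b * sin (k * x)) ->
  (forall x, 0 <= x -> F x = u x) /\ dF 0 = vol_deriv k q u a b 0.
Proof.
move=> k0 pq su sF asyF.
have [mu_ [B uB] uE] := su.
have [mU [B' UB] UE] := real_solution_volterra k0 pq sF asyF.
have Fu x : 0 <= x -> F x = u x.
  move=> x0; rewrite -[LHS](_ : F (Num.max 0 x) = _); last first.
    by congr F; apply/max_idPr.
  apply: (volterra_unique (B := Num.max B B') k0 pq mU mu_) (UE) _ x x0.
  - by move=> y _; rewrite le_max UB orbT.
  - by move=> y _; rewrite le_max uB.
  - by move=> y _; exact: uE.
split => //.
have [dFF _ _] := sF.
have h1 : Rp_deriv u 0 (dF 0) by apply: (eq_Rp_deriv (lexx 0) Fu); exact: dFF.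
have h2 : Rp_deriv u 0 (vol_deriv k q u a b 0).
  by have [d _ _] := scattering_real_solution k0 pq su; exact: d.
have [_ <-] := Rp_deriv_derive (lexx 0) h1.
by have [_ <-] := Rp_deriv_derive (lexx 0) h2.
Qed.

(** The pair (u, v) shows that a Jost solution exists, so the choice made by [xget] is one, and
    uniqueness on [0, +oo[ identifies its value and derivative at 0. *)
Lemma jost_solution_at0 q k (q' := q \_ `[0, +oo[) u v : L11 q -> 0 < k ->
  scattering_solution q' k 1 0 u -> scattering_solution q' k 0 1 v ->
  jost_solution q (real_complex R k) 0 = Complex (u 0) (v 0) /\
  cderive (jost_solution q (real_complex R k)) 0 =
    Complex (vol_deriv k q' u 1 0 0) (vol_deriv k q' v 0 1 0).
Proof.
move=> hq k0 su sv.
have pq : potential q' by exact: potential_patch.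
have qq' x : 0 <= x -> q' x = q x.
  by move=> x0; rewrite /q' patchE mem_set//= in_itv/= x0.
have asyE : ((fun x => 1 * cos (k * x) + 0 * sin (k * x)) = fun x => cos (k * x)) /\
    ((fun x => 0 * cos (k * x) + 1 * sin (k * x)) = fun x => sin (k * x)).
  by split; apply/funext => x; rewrite !(mul1r, mul0r, add0r, addr0).
have iu := scattering_L1 pq su; have iv := scattering_L1 pq sv.
have jex : is_jost_solution q (real_complex R k) (fun x => Complex (u x) (v x)).
  split.
    apply: real_solution_schrodinger; apply: (eq_real_solution qq').
      exact: scattering_real_solution su.
    exact: scattering_real_solution sv.
  apply/jost_asymptotics_real; split.
    by rewrite -asyE.1; have [_ _ uE] := su; exact: (vol_asymptotic iu uE).
  by rewrite -asyE.2; have [_ _ uE] := sv; exact: (vol_asymptotic iv uE).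
have [sj aj] : is_jost_solution q (real_complex R k) (jost_solution q (real_complex R k)).
  by rewrite /jost_solution; apply: (xgetPex (fun=> 0) (ex_intro _ _ jex)).
set f := jost_solution _ _ in sj aj *.
have [r1 r2] := schrodinger_solution_real sj.
have [a1 a2] := (jost_asymptotics_real _ _).1 aj.
have q'q x : 0 <= x -> q x = q' x by move=> x0; rewrite qq'.
rewrite -asyE.1 in a1; rewrite -asyE.2 in a2.
have [f1 df1] := scattering_uniq k0 pq su (eq_real_solution q'q r1) a1.
have [f2 df2] := scattering_uniq k0 pq sv (eq_real_solution q'q r2) a2.
split; last by rewrite /cderive df1 df2.
by rewrite -f1// -f2//=; case: (f 0).
Qed.

(** The Wronskian of [u] and [v] is constant and equals -k at infinity, so both cannot vanish at 0.
    Hence [I_function] is a genuine quotient for [k > 0], never the default value of a division by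
    zero. *)
Lemma scattering_neq0 q k u v : 0 < k -> potential q ->
  scattering_solution q k 1 0 u -> scattering_solution q k 0 1 v ->
  Complex (u 0) (v 0) != 0.
Proof.
move=> k0 pq su sv; apply/negP; rewrite eq_complex /= => /andP[/eqP u0 /eqP v0].
have := scattering_wronskian k0 pq pq su sv; rewrite u0 v0.
rewrite (eq_tail (g := fun=> 0 * 0)); last by move=> s _; ring.
rewrite tailZ ?mul0r//; last exact: integrable0.
by move=> E; lra.
Qed.

(** These are the real and imaginary parts of the integral of p f1 f2. Equality of the quotients
    kills the complex Wronskian at 0, and at infinity it vanishes because both solutions behave like
    exp(ikx). *)
Lemma I_function_orthogonality q1 q2 k u1 v1 u2 v2
    (p := fun x => (q1 \_ `[0, +oo[) x - (q2 \_ `[0, +oo[) x) :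
  L11 q1 -> L11 q2 -> 0 < k ->
  I_function q1 (real_complex R k) = I_function q2 (real_complex R k) ->
  scattering_solution (q1 \_ `[0, +oo[) k 1 0 u1 ->
  scattering_solution (q1 \_ `[0, +oo[) k 0 1 v1 ->
  scattering_solution (q2 \_ `[0, +oo[) k 1 0 u2 ->
  scattering_solution (q2 \_ `[0, +oo[) k 0 1 v2 ->
  tail (fun x => p x * (u1 x * u2 x - v1 x * v2 x)) 0 = 0 /\
  tail (fun x => p x * (u1 x * v2 x + v1 x * u2 x)) 0 = 0.
Proof.
move=> hq1 hq2 k0 I12 su1 sv1 su2 sv2.
have pq1 := potential_patch hq1; have pq2 := potential_patch hq2.
have ip f g a b c d : scattering_solution (q1 \_ `[0, +oo[) k a b f ->
    scattering_solution (q2 \_ `[0, +oo[) k c d g ->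
    L1 (fun t => p t * f t * g t).
  move=> [mf [B fB] _] [mg [C gC] _].
  apply: (L1M mg gC); apply: (L1M mf fB).
  by apply: L1B; [case: pq1|case: pq2].
have wuu := scattering_wronskian k0 pq1 pq2 su1 su2.
have wvv := scattering_wronskian k0 pq1 pq2 sv1 sv2.
have wuv := scattering_wronskian k0 pq1 pq2 su1 sv2.
have wvu := scattering_wronskian k0 pq1 pq2 sv1 su2.
have n1 := scattering_neq0 k0 pq1 su1 sv1.
have n2 := scattering_neq0 k0 pq2 su2 sv2.
move: I12; rewrite /I_function /jost_function.
have [-> ->] := jost_solution_at0 hq1 k0 su1 sv1.
have [-> ->] := jost_solution_at0 hq2 k0 su2 sv2.
move=> /eqP; rewrite eqr_div// => /eqP E.
have {E} /= [Er Ei] := (congr1 RE E, congr1 IM E).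
split.
- rewrite (eq_tail (g := fun t => p t * u1 t * u2 t - p t * v1 t * v2 t)); last first.
    by move=> t _; ring.
  rewrite tailB; [|exact: ip su1 su2|exact: ip sv1 sv2].
  rewrite wuu wvv; lra.
- rewrite (eq_tail (g := fun t => p t * u1 t * v2 t + p t * v1 t * u2 t)); last first.
    by move=> t _; ring.
  rewrite tailD; [|exact: ip su1 sv2|exact: ip sv1 su2].
  rewrite wuv wvu; lra.
Qed.

End IFunction.

(** * Convolutions *)

Section Convolution.
Variable R : realType.
Implicit Types (a b g : R -> R) (x r s c : R).
Local Notation mu := (@lebesgue_measure R).

Lemma lebesgue_measure_shift c (A : set R) : measurable A ->
  pushforward mu (fun x : measurableTypeR R => x + c : measurableTypeR R) A = mu A.
Proof.
have mc : measurable_fun setT (fun x : R => x + c) by exact: measurable_funD.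
move=> mA; apply/esym/lebesgue_measure_unique => //= _ [[y z]] _ <-.
rewrite /pushforward (_ : _ @^-1` _ = `]y - c, z - c]%classic); last first.
  by apply/seteqP; split => t /=; rewrite !in_itv/= ltrBlDr lerBrDr.
rewrite !lebesgue_measure_itv/= !lte_fin ltrD2r; case: ifPn => // _.
by rewrite -!EFinD; congr (_%:E); lra.
Qed.

Lemma integral_shift (f : R -> \bar R) c : measurable_fun setT f ->
  (forall x, 0 <= f x)%E ->
  (\int[mu]_x f (x + c)%R = \int[mu]_x f x)%E.
Proof.
have mc : measurable_fun setT (fun x : R => x + c) by exact: measurable_funD.
move=> mf f0; rewrite -[RHS](@eq_measure_integral _ _ _ setT mu
   (pushforward mu (fun x : measurableTypeR R => x + c : measurableTypeR R))).
  by rewrite ge0_integral_pushforward//=; exact: measurable_funTS.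
by move=> A mA _; exact: lebesgue_measure_shift.
Qed.

Lemma tonelli (f : R * R -> \bar R) : measurable_fun setT f ->
  (forall z, 0 <= f z)%E ->
  (\int[mu]_x \int[mu]_y f (x, y) = \int[mu]_y \int[mu]_x f (x, y))%E.
Proof. by move=> mf f0; exact: (@fubini_tonelli _ _ _ _ R mu mu f mf f0). Qed.

Lemma measurable_tonelli (f : R * R -> \bar R) : measurable_fun setT f ->
  (forall z, 0 <= f z)%E ->
  measurable_fun setT (fun x => \int[mu]_y f (x, y))%E.
Proof. by move=> mf f0; exact: (@measurable_fun_fubini_tonelli_F _ _ _ _ R mu f mf f0). Qed.

Definition convolution a b r : R := \int[mu]_s (a s * b (r - s)).

Section ConvolutionTheory.
Variables (a b : R -> R) (B : R).
Hypotheses (ia : L1 a) (ib : L1 b) (a0 : forall x, 0 <= a x)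
  (b0 : forall x, 0 <= b x) (bB : forall x, b x <= B).

Let mb : measurable_fun setT b := L1_measurable ib.
Let ma : measurable_fun setT a := L1_measurable ia.

Let L1ab r : L1 (fun s => a s * b (r - s)).
Proof.
apply: (@L1M _ a (fun s => b (r - s)) B _ _ ia).
  by apply: (measurableT_comp mb); exact: measurable_funB.
by move=> x; rewrite ger0_norm.
Qed.

Let convE r : (convolution a b r)%:E = (\int[mu]_s (a s * b (r - s))%:E)%E.
Proof. by rewrite /convolution /Rintegral fineK//; apply: integrable_fin_num => //; exact: L1ab. Qed.

Lemma convolution_ge0 r : 0 <= convolution a b r.
Proof. by apply: Rintegral_ge0 => s _; rewrite mulr_ge0. Qed.

Lemma convolution_le r : convolution a b r <= B * \int[mu]_s a s.
Proof.
rewrite -RintegralZl//; apply: le_Rintegral; [by []|exact: L1ab|exact: L1Z|].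
by move=> s _; rewrite mulrC ler_wpM2r.
Qed.

Let mconv2 (g : R -> R) : measurable_fun setT g ->
  measurable_fun setT (fun z : R * R => (a z.1 * b (z.2 - z.1) * g z.2)%:E).
Proof.
move=> mg; apply/measurable_EFinP; apply: measurable_funM.
  apply: measurable_funM; first exact: (measurableT_comp ma measurable_fst).
  apply: (measurableT_comp mb); apply: measurable_funB.
    exact: measurable_snd.
  exact: measurable_fst.
exact: (measurableT_comp mg measurable_snd).
Qed.

Lemma measurable_convolution : measurable_fun setT (convolution a b).
Proof.
apply/measurable_EFinP.
rewrite (_ : EFin \o convolution a b = fun r => (\int[mu]_s (a s * b (r - s))%:E)%E); last first.
  by apply/funext => r; exact: convE.
pose f (z : R * R) := (a z.2 * b (z.1 - z.2))%:E.
apply: (@measurable_tonelli f); last first.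
  by move=> z; rewrite lee_fin mulr_ge0.
apply/measurable_EFinP; apply: measurable_funM.
  exact: (measurableT_comp ma measurable_snd).
apply: (measurableT_comp mb); apply: measurable_funB.
  exact: measurable_fst.
exact: measurable_snd.
Qed.

(** Tonelli after a translation. It serves twice: to compose the error kernels of the two
    potentials, and to move the resulting kernel onto [|P|]. *)
Lemma integral_convolution (g : R -> R) : measurable_fun setT g -> (forall x, 0 <= g x) ->
  (\int[mu]_s ((a s)%:E * \int[mu]_z (b z * g (s + z))%:E) =
   \int[mu]_r (convolution a b r * g r)%:E)%E.
Proof.
move=> mg g0.
transitivity (\int[mu]_s \int[mu]_r (a s * b (r - s) * g r)%:E)%E.
  apply: eq_integral => s _.
  rewrite -(@integral_shift (fun r => (a s * b (r - s) * g r)%:E) s); last 2 first.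
  - apply/measurable_EFinP; apply: measurable_funM => //; apply: measurable_funM => //.
    by apply: (measurableT_comp mb); exact: measurable_funB.
  - by move=> r; rewrite lee_fin !mulr_ge0.
  rewrite -ge0_integralZl//=; last 3 first.
  - apply/measurable_EFinP; apply: measurable_funM => //.
    by apply: (measurableT_comp mg); exact: measurable_funD.
  - by move=> z _; rewrite lee_fin mulr_ge0.
  - by rewrite lee_fin.
  by apply: eq_integral => z _; rewrite -EFinM addrK [z + s]addrC mulrA.
rewrite (@tonelli (fun z => (a z.1 * b (z.2 - z.1) * g z.2)%:E)) /=; last 2 first.
- exact: mconv2.
- by move=> z; rewrite lee_fin !mulr_ge0.
apply: eq_integral => r _.
rewrite EFinM convE -ge0_integralZr//.
- by apply/measurable_EFinP; exact: L1_measurable (L1ab r).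
- by move=> s _; rewrite lee_fin mulr_ge0.
- by rewrite lee_fin.
Qed.

(** [integral_convolution] with [g = 1] computes the integral as the product of those of [a] and
    [b]. *)
Lemma L1_convolution : L1 (convolution a b).
Proof.
apply/integrableP; split; first by apply/measurable_EFinP; exact: measurable_convolution.
under eq_integral do rewrite /= ger0_norm ?convolution_ge0// -[convolution a b _]mulr1.
rewrite -(@integral_convolution (fun=> 1))//.
under eq_integral do under eq_integral do rewrite mulr1.
rewrite ge0_integralZr//.
- apply: lte_mul_pinfty; [by apply: integral_ge0 => x _; rewrite lee_fin| |].
    by apply: integrable_fin_num => //; exact: ib.
  by apply: integrable_lty => //; exact: ia.
- exact/measurable_EFinP.
- by move=> x _; rewrite lee_fin.
- by apply: integral_ge0 => x _; rewrite lee_fin.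
Qed.

End ConvolutionTheory.
End Convolution.

(** * Transformation operators *)

Section TrigPolynomials.
Variable R : realType.
Implicit Types (q g w h F : R -> R) (a b k x y t r s L : R) (p : seq (R * R * R)).
Local Notation mu := (@lebesgue_measure R).

(** Writes regions such as 0 <= s <= t - x as factors of the integrand, so that Tonelli is applied
    on the whole plane. *)
Definition heaviside : R -> R := \1_(`[0, +oo[%classic : set R).

Lemma heaviside1 s : 0 <= s -> heaviside s = 1.
Proof. by move=> s0; rewrite /heaviside indicE mem_set//= in_itv/= s0. Qed.

Lemma heaviside0 s : s < 0 -> heaviside s = 0.
Proof. by move=> s0; rewrite /heaviside indicE memNset//= in_itv/= andbT leNgt s0. Qed.

Lemma heaviside_ge0 s : 0 <= heaviside s.
Proof. by have [/heaviside0->|/heaviside1->] := ltP s 0. Qed.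

Lemma measurable_heaviside : measurable_fun setT heaviside.
Proof. exact: measurable_indic. Qed.

Lemma integral_heaviside L : 0 <= L ->
  (\int[mu]_s (heaviside s * heaviside (L - s))%:E = L%:E)%E.
Proof.
move=> L0.
transitivity (\int[mu]_s (\1_(`[0%R, L]%classic : set R) s)%:E)%E.
  apply: eq_integral => s _; congr (_%:E); rewrite indicE.
  have [s0|s0] := ltP s 0.
    by rewrite heaviside0// mul0r memNset//= in_itv/= leNgt s0.
  have [sL|Ls] := leP s L.
    by rewrite !heaviside1 ?subr_ge0// mulr1 mem_set//= in_itv/= s0.
  by rewrite [heaviside (L - s)]heaviside0 ?subr_lt0// mulr0 memNset//= in_itv/= [s <= L]leNgt Ls andbF.
rewrite integral_indic// setIT; apply: (eq_trans (lebesgue_measure_itv `[0, L])).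
rewrite /= lte_fin; case: ltP => [_|L0']; first by rewrite sube0.
by rewrite (@le_anti _ _ L 0)// L0'.
Qed.

Lemma is_derive_bigsum p (f f' : R * R * R -> R -> R) x :
  (forall c, c \in p -> is_derive x 1 (f c) (f' c x)) ->
  is_derive x 1 (fun y => \sum_(c <- p) f c y) (\sum_(c <- p) f' c x).
Proof.
elim: p => [_|c p ih H].
  rewrite big_nil (_ : (fun y => _) = fun=> 0); first exact: is_derive_cst.
  by apply/funext => y; rewrite big_nil.
have d1 : is_derive x 1 (f c) (f' c x) by apply: H; rewrite mem_head.
have d2 := ih (fun e ep => H e (mem_behead (ep : e \in behead (c :: p)))).
rewrite big_cons (_ : (fun y => _) = fun y => f c y + \sum_(e <- p) f e y).
  exact: is_deriveD.
by apply/funext => y; rewrite big_cons.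
Qed.

(** An entry ((a, b), k) stands for the real part of (a - ib) exp(2ikr). *)
Definition trigpoly p r : R :=
  \sum_(c <- p) (c.1.1 * cos (2 * c.2 * r) + c.1.2 * sin (2 * c.2 * r)).

Lemma bigsum_bounded p (f : R * R * R -> R -> R -> R) :
  (forall c, c \in p -> exists M, forall x y, `|f c x y| <= M) ->
  exists M, forall x y, `|\sum_(c <- p) f c x y| <= M.
Proof.
elim: p => [_|c p ih H].
  by exists 0 => x y; rewrite big_nil normr0.
have [M1 h1] := H c (mem_head _ _).
have [M2 h2] := ih (fun e ep => H e (mem_behead (ep : e \in behead (c :: p)))).
exists (M1 + M2) => x y; rewrite big_cons (le_trans (ler_normD _ _))//.
by rewrite lerD.
Qed.

Lemma norm_trig_comb a b A B al be : `|al| <= 1 -> `|be| <= 1 -> `|A| <= a -> `|B| <= b ->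
  `|al * A + be * B| <= a + b :> R.
Proof.
move=> al1 be1 Aa Bb; rewrite (le_trans (ler_normD _ _))// !normrM.
by rewrite lerD//; [apply: le_trans Aa|apply: le_trans Bb]; rewrite ler_piMl.
Qed.

Lemma trigpoly_bounded p : exists2 M, 0 <= M & forall r, `|trigpoly p r| <= M.
Proof.
have [|M h] := @bigsum_bounded p
  (fun c _ r => c.1.1 * cos (2 * c.2 * r) + c.1.2 * sin (2 * c.2 * r)).
  move=> c _; exists (`|c.1.1| + `|c.1.2|) => _ r.
  by rewrite ![_ * cos _]mulrC ![_ * sin _]mulrC norm_trig_comb ?cos_max ?sin_max.
exists M => [|r]; last exact: (h 0).
exact: le_trans (h 0 0).
Qed.

Lemma continuous_trigpoly p : continuous (trigpoly p).
Proof.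
move=> r; apply: differentiable_continuous; apply/derivable1_diffP.
have := @is_derive_bigsum p
  (fun c r => c.1.1 * cos (2 * c.2 * r) + c.1.2 * sin (2 * c.2 * r))
  (fun c r => c.1.1 * - (2 * c.2 * sin (2 * c.2 * r)) + c.1.2 * (2 * c.2 * cos (2 * c.2 * r))) r _.
case=> // c _; have ds := is_derive_sinM (2 * c.2) r.
have dc := is_derive_cosM (2 * c.2) r.
by apply: is_derive_eq; rewrite /GRing.scale/=; ring.
Qed.

Lemma measurable_trigpoly p : measurable_fun setT (trigpoly p).
Proof. by apply: continuous_measurable_fun; exact: continuous_trigpoly. Qed.

Section Transform.
Variables (q : R -> R) (u v : R -> R -> R).
Hypothesis pq : potential q.
Hypothesis su : forall k, 0 < k -> scattering_solution q k 1 0 (u k).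
Hypothesis sv : forall k, 0 < k -> scattering_solution q k 0 1 (v k).

(* Real and imaginary parts of [exp (i k y) f(t, k)]. *)
Definition wave_re k y t := cos (k * y) * u k t - sin (k * y) * v k t.
Definition wave_im k y t := sin (k * y) * u k t + cos (k * y) * v k t.

(* If [trigpoly p r] is the real part of [\sum c exp (2 i k r)], this is the
   real part of [\sum c exp (2 i k r) m(x, k)] with [m = exp (- i k x) f]. *)
Definition transform p x r :=
  \sum_(c <- p) (c.1.1 * wave_re c.2 (2 * r - x) x + c.1.2 * wave_im c.2 (2 * r - x) x).

(* Primitive in [s] of [transform p t (r + s)], at [s = t - x]. *)
Definition transform_int p x r t :=
  \sum_(c <- p) (c.1.1 * wave_re c.2 (2 * r - x) t + c.1.2 * wave_im c.2 (2 * r - x) t) *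
    (sin (c.2 * (t - x)) / c.2).

Definition positive_freq p := all (fun c => 0 < c.2) p.

Lemma scattering_pair_bounded k : 0 < k -> exists2 M, 0 <= M &
  forall t, `|u k t| <= M /\ `|v k t| <= M.
Proof.
move=> k0; have [_ [M1 h1] _] := su k0; have [_ [M2 h2] _] := sv k0.
exists (Num.max M1 M2).
  by rewrite le_max (le_trans (normr_ge0 _) (h1 0)).
by move=> t; rewrite !le_max h1 h2 orbT.
Qed.

Lemma wave_bounded k a b : 0 < k -> exists M, forall y t,
  `|a * wave_re k y t + b * wave_im k y t| <= M.
Proof.
move=> k0; have [M M0 uvM] := scattering_pair_bounded k0.
exists (`|a| * (M + M) + `|b| * (M + M)) => y t.
have [uM vM] := uvM t.
rewrite (le_trans (ler_normD _ _))// !normrM lerD// ler_wpM2l//.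
  rewrite /wave_re -mulNr; apply: norm_trig_comb => //; first exact: cos_max.
  by rewrite normrN sin_max.
by rewrite /wave_im; apply: norm_trig_comb => //; [exact: sin_max|exact: cos_max].
Qed.

Lemma transform_bounded p : positive_freq p ->
  exists2 M, 0 <= M & forall x r, `|transform p x r| <= M.
Proof.
move=> /allP pp.
have [|M h] := @bigsum_bounded p (fun c x r =>
  c.1.1 * wave_re c.2 (2 * r - x) x + c.1.2 * wave_im c.2 (2 * r - x) x).
  move=> c /pp c0; have [M h] := wave_bounded c.1.1 c.1.2 c0.
  by exists M => x r; exact: h.
exists M => [|x r]; last exact: h.
exact: le_trans (h 0 0).
Qed.

Lemma L1_transform_int p x r : positive_freq p ->
  L1 (fun t => q t * transform_int p x r t).
Proof.
rewrite /transform_int; elim: p => [_|c p ih /= /andP[c0 pp]].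
  apply: (@eq_integrable _ _ _ mu setT measurableT (EFin \o (fun=> 0))); last exact: integrable0.
  by move=> t _ /=; rewrite big_nil mulr0.
apply: (@eq_integrable _ _ _ mu setT measurableT (EFin \o (fun t =>
  q t * (c.1.1 * wave_re c.2 (2 * r - x) t + c.1.2 * wave_im c.2 (2 * r - x) t) *
    (sin (c.2 * (t - x)) / c.2) + q t * \sum_(c <- p) (c.1.1 * wave_re c.2 (2 * r - x) t + c.1.2 * wave_im c.2 (2 * r - x) t) *
    (sin (c.2 * (t - x)) / c.2)))).
  by move=> t _ /=; congr (_%:E); rewrite big_cons; ring.
apply: L1D; last exact: ih.
apply: L1_vol => //.
have [M h] := wave_bounded c.1.1 c.1.2 c0.
apply: (L1_potentialM pq (B := M)) => [|t _]; last exact: h.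
have [mu_ _ _] := su c0; have [mv _ _] := sv c0.
by apply: measurable_funD; apply: measurable_funM => //;
  [apply: measurable_funB|apply: measurable_funD]; apply: measurable_funM.
Qed.

(** The Volterra equation multiplied by exp(ik(2r - x)): the free wave exp(ikx) becomes exp(2ikr),
    which is the polynomial itself. *)
Lemma transformE p x r : positive_freq p ->
  transform p x r = trigpoly p r + tail (fun t => q t * transform_int p x r t) x.
Proof.
move=> pp; rewrite /transform /trigpoly /transform_int.
elim: p pp => [_|c p ih /= /andP[c0 pp]].
  rewrite !big_nil add0r (eq_tail (g := fun=> 0 * 0)); last first.
    by move=> t _; rewrite big_nil; ring.
  by rewrite tailZ ?mul0r//; exact: integrable0.
have [mu_ _ uE] := su c0; have [mv _ vE] := sv c0.
have iu := scattering_L1 pq (su c0); have iv := scattering_L1 pq (sv c0).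
rewrite !big_cons ih//.
set y := 2 * r - x.
rewrite [X in _ = _ + X](eq_tail (g := fun t => (c.1.1 * cos (c.2 * y) + c.1.2 * sin (c.2 * y)) *
    (q t * u c.2 t * (sin (c.2 * (t - x)) / c.2)) +
  (c.1.2 * cos (c.2 * y) - c.1.1 * sin (c.2 * y)) *
    (q t * v c.2 t * (sin (c.2 * (t - x)) / c.2)) +
  q t * \sum_(c <- p) (c.1.1 * wave_re c.2 y t + c.1.2 * wave_im c.2 y t) *
    (sin (c.2 * (t - x)) / c.2))); last first.
  by move=> t _; rewrite big_cons /wave_re /wave_im -/y; ring.
rewrite tailD; [|by apply: L1D; apply: L1Z; exact: L1_vol|exact: L1_transform_int].
rewrite tailD; [|apply: L1Z; exact: L1_vol|apply: L1Z; exact: L1_vol].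
rewrite !tailZ; [|exact: L1_vol|exact: L1_vol].
rewrite -/(vol c.2 q (u c.2) x) -/(vol c.2 q (v c.2) x).
rewrite {1}/wave_re {1}/wave_im -/y (uE x) (vE x).
have -> : 2 * c.2 * r = c.2 * y + c.2 * x by rewrite /y; ring.
rewrite cosD sinD; ring.
Qed.

(** The complex coefficients multiplied by exp(-ikx) f(x,k), at fixed [x]. Seeing the image as a
    polynomial lets the operator of another potential act on it. *)
Definition transform_coef x p := [seq
  ((c.1.1 * wave_re c.2 (- x) x + c.1.2 * wave_im c.2 (- x) x,
    c.1.2 * wave_re c.2 (- x) x - c.1.1 * wave_im c.2 (- x) x), c.2) | c <- p].

Lemma positive_freq_coef x p : positive_freq (transform_coef x p) = positive_freq p.
Proof. by rewrite /positive_freq all_map. Qed.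

Lemma transform_trigpoly p x r : transform p x r = trigpoly (transform_coef x p) r.
Proof.
rewrite /transform /trigpoly big_map; apply: eq_bigr => c _ /=.
rewrite /wave_re /wave_im.
have -> : c.2 * (2 * r - x) = 2 * c.2 * r + c.2 * - x by ring.
by rewrite cosD sinD; ring.
Qed.

Lemma continuous_transform p x : continuous (transform p x).
Proof.
rewrite (_ : transform p x = trigpoly (transform_coef x p)).
  exact: continuous_trigpoly.
by apply/funext => r; exact: transform_trigpoly.
Qed.

Lemma measurable_transform p x : measurable_fun setT (transform p x).
Proof. by apply: continuous_measurable_fun; exact: continuous_transform. Qed.

Lemma transform_int_le p x r t : x <= t -> positive_freq p ->
  (`|transform_int p x r t|%:E <=
   \int[mu]_s (heaviside s * heaviside (t - x - s) * `|transform p t (r + s)|)%:E)%E.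
Proof.
move=> xt /allP pp.
(* The derivative in L of exp(ik(2r + L - t)) sin(kL) / k is exp(ik(2(r + L) - t)), which makes
   [Phi] the primitive that vanishes at 0. *)
pose Phi L := \sum_(c <- p)
  (c.1.1 * wave_re c.2 (2 * r + L - t) t + c.1.2 * wave_im c.2 (2 * r + L - t) t) *
    (sin (c.2 * L) / c.2).
have dPhi L : is_derive L 1 Phi (transform p t (r + L)).
  apply: (@is_derive_bigsum p (fun c L =>
    (c.1.1 * wave_re c.2 (2 * r + L - t) t + c.1.2 * wave_im c.2 (2 * r + L - t) t) *
    (sin (c.2 * L) / c.2)) (fun c L => c.1.1 * wave_re c.2 (2 * (r + L) - t) t +
    c.1.2 * wave_im c.2 (2 * (r + L) - t) t)) => c /pp c0.
  have cn0 : c.2 != 0 by rewrite gt_eqF.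
  have dy : is_derive L 1 (fun L => c.2 * (2 * r + L - t)) c.2.
    by apply: is_derive_eq; rewrite /GRing.scale/=; ring.
  have dc := @is_derive1_comp R cos (fun L => c.2 * (2 * r + L - t)) L _ _ (is_derive_cos _) dy.
  have ds := @is_derive1_comp R sin (fun L => c.2 * (2 * r + L - t)) L _ _ (is_derive_sin _) dy.
  have dl := is_derive_sinM c.2 L.
  rewrite /wave_re /wave_im.
  apply: is_derive_eq; rewrite /GRing.scale/=.
  have -> : c.2 * (2 * (r + L) - t) = c.2 * (2 * r + L - t) + c.2 * L by ring.
  rewrite cosD sinD /comp.
  by field.
pose f s := transform p t (r + s).
have cf : continuous f.
  move=> s; apply: (@continuous_comp _ _ _ (fun s => r + s) (transform p t)).
    by apply: cvgD; [exact: cvg_cst|exact: cvg_id].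
  exact: continuous_transform.
have mf : measurable_fun setT f by exact: continuous_measurable_fun.
have Phi0 : Phi 0 = 0.
  by rewrite /Phi big1_seq// => c _; rewrite mulr0 sin0 mul0r mulr0.
have PhiE : transform_int p x r t = Phi (t - x).
  rewrite /transform_int /Phi; apply: eq_bigr => c _.
  by rewrite (_ : 2 * r + (t - x) - t = 2 * r - x)//; ring.
rewrite PhiE; move: (t - x) (subr_ge0 x t) => L; rewrite xt => L0.
have -> : (\int[mu]_s (heaviside s * heaviside (L - s) * `|transform p t (r + s)|)%:E
    = \int[mu]_(s in `[0%R, L]) `|f s|%:E)%E.
  rewrite [RHS]integral_mkcond; apply: eq_integral => s _.
  rewrite patchE; have [s0|s0] := ltP s 0.
    by rewrite heaviside0// !mul0r memNset//= in_itv/= leNgt s0.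
  have [sL|Ls] := leP s L.
    by rewrite !heaviside1 ?subr_ge0// !mul1r mem_set//= in_itv/= s0.
  by rewrite [heaviside (L - s)]heaviside0 ?subr_lt0// mulr0 mul0r memNset//= in_itv/= [s <= L]leNgt Ls andbF.
move: L0; rewrite le_eqVlt => /orP[/eqP <-|L0].
  by rewrite Phi0 normr0 integral_ge0// => s _; rewrite lee_fin.
have FTC : (\int[mu]_(s in `[0%R, L]) (f s)%:E = (Phi L)%:E - (Phi 0)%:E)%E.
  have dP s : derivable Phi s 1 by have [] := dPhi s.
  have cP : continuous Phi.
    by move=> s; apply: differentiable_continuous; apply/derivable1_diffP; exact: dP.
  apply: continuous_FTC2 => //.
  - exact: continuous_subspaceT.
  - split.
    + by move=> s _; exact: dP.
    + by apply: cvg_at_right_filter; exact: cP.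
    + by apply: cvg_at_left_filter; exact: cP.
  - by move=> s _; rewrite derive1E; have [_ ->] := dPhi s.
have -> : `|Phi L|%:E = `|\int[mu]_(s in `[0%R, L]) (f s)%:E|%E.
  by rewrite FTC Phi0 sube0.
apply: le_abse_integral => //; apply/measurable_EFinP; exact: measurable_funTS.
Qed.

End Transform.
End TrigPolynomials.

(** * Comparison estimate for one transformation operator *)

Section KernelBound.
Variable R : realType.
Implicit Types (g w h F : R -> R) (a b k x y t r s L : R) (p : seq (R * R * R)).
Local Notation mu := (@lebesgue_measure R).
Local Notation H := (@heaviside R).

Variables (q : R -> R) (u v : R -> R -> R).
Hypothesis pq : potential q.
Hypothesis su : forall k, 0 < k -> scattering_solution q k 1 0 (u k).
Hypothesis sv : forall k, 0 < k -> scattering_solution q k 0 1 (v k).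

Definition tail_abs x := tail (fun t => `|q t|) x.

Let iq : L1 (fun t => `|q t|).
Proof. by apply: L1_abs; case: pq. Qed.

Lemma tail_abs_ge0 x : 0 <= tail_abs x.
Proof. by apply: tail_ge0. Qed.

Lemma tail_abs_nonincreasing x y : x <= y -> tail_abs y <= tail_abs x.
Proof. by move=> xy; apply: tail_nonincreasing. Qed.

Lemma measurable_tail_abs : measurable_fun setT tail_abs.
Proof. by apply: continuous_measurable_fun; apply: continuous_tail. Qed.

Lemma tail_absE x : ((tail_abs x)%:E = \int[mu]_t (H (t - x) * `|q t|)%:E)%E.
Proof.
rewrite /tail_abs /tail /Rintegral fineK; last first.
  by apply: integrable_fin_num => //; exact: (L1S _ iq).
rewrite integral_mkcond; apply: eq_integral => t _; rewrite patchE.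
have [tx|xt] := ltP t x.
  by rewrite heaviside0 ?subr_lt0// mul0r memNset//= in_itv/= andbT leNgt tx.
by rewrite heaviside1 ?subr_ge0// mul1r mem_set//= in_itv/= xt.
Qed.

Let mq : measurable_fun setT (fun t => `|q t|) := L1_measurable iq.

Let mH : measurable_fun setT H := @measurable_heaviside R.

Let mHsub (f g : R * R -> R) : measurable_fun setT f -> measurable_fun setT g ->
  measurable_fun setT (fun z => H (f z - g z)).
Proof.
by move=> mf mg; exact: (measurableT_comp mH (measurable_funB mf mg)).
Qed.

Let m1 : measurable_fun setT (fst : R * R -> R) := measurable_fst.
Let m2 : measurable_fun setT (snd : R * R -> R) := measurable_snd.

(* Tonelli over the region [0 <= s <= t - x]. *)
Lemma tonelli_tail x (g : R -> R) : measurable_fun setT g -> (forall s, 0 <= g s) ->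
  (\int[mu]_t ((`|q t|)%:E * \int[mu]_s (H s * H (t - x - s) * g s)%:E) =
   \int[mu]_s (H s * tail_abs (x + s) * g s)%:E)%E.
Proof.
move=> mg g0.
have mHg : measurable_fun setT (fun s => H s * g s).
  by apply: measurable_funM => //; exact: mH.
pose f (z : R * R) := (`|q z.1| * (H z.2 * H (z.1 - x - z.2) * g z.2))%:E.
have mf : measurable_fun setT f.
  apply/measurable_EFinP; apply: measurable_funM; first exact: (measurableT_comp mq m1).
  apply: measurable_funM; last exact: (measurableT_comp mg m2).
  apply: measurable_funM; first exact: (measurableT_comp mH m2).
  by apply: mHsub => //; exact: measurable_funB.
have f0 z : (0 <= f z)%E by rewrite lee_fin !mulr_ge0// heaviside_ge0.
transitivity (\int[mu]_t \int[mu]_s f (t, s))%E.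
  apply: eq_integral => t _; rewrite -ge0_integralZl//.
  - apply/measurable_EFinP; apply: measurable_funM => //; apply: measurable_funM.
      exact: mH.
    by apply: (measurableT_comp mH); exact: measurable_funB.
  - by move=> s _; rewrite lee_fin !mulr_ge0// heaviside_ge0.
rewrite tonelli//; apply: eq_integral => s _.
rewrite (_ : H s * _ * g s = H s * g s * tail_abs (x + s)); last by ring.
rewrite EFinM tail_absE -ge0_integralZl//.
- apply: eq_integral => t _; rewrite /f -EFinM/=; congr (_%:E).
  by rewrite opprD addrA; ring.
- apply/measurable_EFinP; apply: measurable_funM => //.
  by apply: (measurableT_comp mH); exact: measurable_funB.
- by move=> t _; rewrite lee_fin mulr_ge0// heaviside_ge0.
- by rewrite lee_fin mulr_ge0// heaviside_ge0.
Qed.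

(** By Tonelli the integral of the tails over [0, +oo[ is the first moment of [|q|]. *)
Lemma L1_tail_abs : L1 (fun s => H s * tail_abs s).
Proof.
apply/integrableP; split.
  apply/measurable_EFinP; apply: measurable_funM; first exact: mH.
  exact: measurable_tail_abs.
have := @tonelli_tail 0 (fun=> 1) (measurable_cst _) (fun=> ler01).
under [in X in _ = X -> _]eq_integral do rewrite mulr1 add0r.
under [X in (X < _)%E]eq_integral do rewrite /= ger0_norm ?mulr_ge0 ?heaviside_ge0 ?tail_abs_ge0//.
move=> <-.
have [_ ixq qneg] := potential_abs pq.
apply: (@le_lt_trans _ _ (\int[mu]_t (t * `|q t|)%:E)%E); last exact: integrable_lty.
apply: ge0_le_integral => //.
- move=> t _; rewrite mule_ge0 ?lee_fin//; apply: integral_ge0 => s _.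
  by rewrite lee_fin !mulr_ge0// heaviside_ge0.
- pose f (z : R * R) := (`|q z.1| * (H z.2 * H (z.1 - 0 - z.2) * 1))%:E.
  rewrite (_ : (fun t => _) = fun t => (\int[mu]_s f (t, s))%E); last first.
    apply/funext => t; rewrite -ge0_integralZl//.
    + apply/measurable_EFinP; apply: measurable_funM => //; apply: measurable_funM.
        exact: mH.
      by apply: (measurableT_comp mH); exact: measurable_funB.
    + by move=> s _; rewrite lee_fin !mulr_ge0// heaviside_ge0.
  apply: measurable_tonelli; last by move=> z; rewrite lee_fin !mulr_ge0// heaviside_ge0.
  apply/measurable_EFinP; apply: measurable_funM; first exact: (measurableT_comp mq m1).
  apply: measurable_funM => //.
  apply: measurable_funM; first exact: (measurableT_comp mH m2).
  by apply: mHsub => //; exact: measurable_funB.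
- by apply/measurable_EFinP; exact: L1_measurable ixq.
- move=> t _; have [t0|t0] := ltP t 0; first by rewrite qneg// mul0e mulr0.
  under eq_integral do rewrite subr0 mulr1.
  by rewrite integral_heaviside// -EFinM mulrC.
Qed.

Definition kernel_bound x (g : R -> R) : R := \int[mu]_s (H s * tail_abs (x + s) * g s).


Lemma L1_kernel_bound x (g : R -> R) M : 0 <= x -> measurable_fun setT g ->
  (forall s, `|g s| <= M) -> L1 (fun s => H s * tail_abs (x + s) * g s).
Proof.
move=> x0 mg gM; apply: (L1M mg gM); apply: L1_le L1_tail_abs.
  apply: measurable_funM => //; apply: (measurableT_comp measurable_tail_abs).
  exact: measurable_funD.
move=> s; rewrite ger0_norm ?mulr_ge0 ?heaviside_ge0 ?tail_abs_ge0//.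
by rewrite ler_wpM2l ?heaviside_ge0// tail_abs_nonincreasing// lerDr.
Qed.

Lemma kernel_boundE x (g : R -> R) M : 0 <= x -> measurable_fun setT g ->
  (forall s, `|g s| <= M) ->
  ((kernel_bound x g)%:E = \int[mu]_s (H s * tail_abs (x + s) * g s)%:E)%E.
Proof.
move=> x0 mg gM; rewrite /kernel_bound /Rintegral fineK//.
by apply: integrable_fin_num => //; exact: (L1_kernel_bound x0 mg gM).
Qed.

Lemma kernel_bound_ge0 x (g : R -> R) : (forall s, 0 <= g s) -> 0 <= kernel_bound x g.
Proof.
by move=> g0; apply: Rintegral_ge0 => s _; rewrite !mulr_ge0 ?heaviside_ge0 ?tail_abs_ge0.
Qed.

(** After a translation by [s0] the left side integrates over s >= s0 with the tail taken at t + s -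
    s0, a point not before x + s. This monotonicity over the region of dependence makes K part of a
    supersolution. *)
Lemma kernel_bound_shift x t s0 (g : R -> R) M : 0 <= x -> 0 <= s0 -> x + s0 <= t ->
  measurable_fun setT g -> (forall s, 0 <= g s <= M) ->
  kernel_bound t (fun s => g (s0 + s)) <= kernel_bound x g.
Proof.
move=> x0 s00 xt mg gM.
have gM' s : `|g s| <= M by have /andP[g0 ?] := gM s; rewrite ger0_norm.
have t0 : 0 <= t by rewrite (le_trans _ xt)// addr_ge0.
have mgs : measurable_fun setT (fun s => g (s0 + s)).
  by apply: (measurableT_comp mg); exact: measurable_funD.
rewrite -lee_fin (kernel_boundE t0 mgs (fun s => gM' _)) (kernel_boundE x0 mg gM').
pose f s := (H (s - s0) * tail_abs (t + (s - s0)) * g s)%:E.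
have mf : measurable_fun setT f.
  apply/measurable_EFinP; apply: measurable_funM => //; apply: measurable_funM.
    by apply: (measurableT_comp mH); exact: measurable_funB.
  apply: (measurableT_comp measurable_tail_abs); apply: measurable_funD => //.
  exact: measurable_funB.
have f0 s : (0 <= f s)%E.
  by rewrite lee_fin !mulr_ge0 ?heaviside_ge0 ?tail_abs_ge0//; case/andP: (gM s).
have -> : (\int[mu]_s (H s * tail_abs (t + s) * g (s0 + s))%:E = \int[mu]_s f (s + s0)%R)%E.
  by apply: eq_integral => s _; rewrite /f addrK [s + s0]addrC.
rewrite integral_shift//; apply: ge0_le_integral => //.
- apply/measurable_EFinP; apply: measurable_funM => //; apply: measurable_funM => //.
  by apply: (measurableT_comp measurable_tail_abs); exact: measurable_funD.
move=> s _; rewrite lee_fin ler_wpM2r//; first by case/andP: (gM s).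
have [ss0|s0s] := ltP s s0.
  by rewrite heaviside0 ?subr_lt0// mul0r mulr_ge0 ?heaviside_ge0 ?tail_abs_ge0.
rewrite !heaviside1 ?subr_ge0 ?(le_trans s00)// !mul1r.
by apply: tail_abs_nonincreasing; lra.
Qed.

(* Comparison of the d'Alembert equation with the supersolution
   [|psi| + c w K], up to an error [D w] that is halved at each step. *)
Lemma transform_estimate_step w d M c D p (x r : R) : weight q w d M ->
  positive_freq p -> 0 <= x -> 0 <= c -> 0 <= D ->
  let K t y := kernel_bound t (fun s => `|trigpoly p (y + s)|) in
  (forall t y, 0 <= t ->
     `|transform u v p t y| <= `|trigpoly p y| + c * w t * K t y + D * w t) ->
  `|transform u v p x r - trigpoly p r| <=
     K x r + (c * K x r + D) * (w x / 2).
Proof.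
move=> [mw d0 wd wx] pp x0 c0 D0 K hK.
have [T T0 pT] := trigpoly_bounded p.
have w0 t : 0 <= w t by rewrite (le_trans (ltW d0))//; case/andP: (wd t).
pose g s := `|trigpoly p (r + s)|.
have mg : measurable_fun setT g.
  apply: measurableT_comp => //; apply: (measurableT_comp (@measurable_trigpoly R p)).
  exact: measurable_funD.
have g0 s : 0 <= g s by rewrite normr_ge0.
have gT s : 0 <= g s <= T by rewrite g0 pT.
have K0 : 0 <= K x r by apply: kernel_bound_ge0.
pose A := c * K x r + D.
have A0 : 0 <= A by rewrite addr_ge0// mulr_ge0.
have KE : (K x r)%:E = (\int[mu]_s (H s * tail_abs (x + s) * g s)%:E)%E.
  by apply: (kernel_boundE x0 mg (M := T)) => s; rewrite /g normr_id pT.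
have iN := L1_transform_int pq su sv x r pp.
rewrite (transformE pq su sv)// addrAC subrr add0r.
rewrite (le_trans (norm_tail_le _ iN))// -lee_fin /tail /Rintegral fineK; last first.
  by apply: integrable_fin_num => //; exact: (L1S _ (L1_abs iN)).
pose P t : \bar R := (\int[mu]_s (H s * H (t - x - s) * g s)%:E)%E.
have P0 t : (0 <= P t)%E.
  by apply: integral_ge0 => s _; rewrite lee_fin !mulr_ge0 ?heaviside_ge0.
have mHH t : measurable_fun setT (fun s => H s * H (t - x - s)).
  apply: measurable_funM => //; apply: (measurableT_comp mH).
  exact: measurable_funB.
have mP : measurable_fun setT P.
  pose f (z : R * R) := (H z.2 * H (z.1 - x - z.2) * g z.2)%:E.
  apply: (@measurable_tonelli R f); last by move=> z; rewrite lee_fin !mulr_ge0 ?heaviside_ge0.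
  apply/measurable_EFinP; apply: measurable_funM; last exact: (measurableT_comp mg m2).
  apply: measurable_funM; first exact: (measurableT_comp mH m2).
  by apply: mHsub => //; exact: measurable_funB.
have NP t : x <= t -> (`|transform_int u v p x r t|%:E <= P t + (A * w t * (t - x))%:E)%E.
  move=> xt; apply: (le_trans (transform_int_le u v r xt pp)).
  have -> : (A * w t * (t - x))%:E =
      (\int[mu]_s ((A * w t)%:E * (H s * H (t - x - s))%:E))%E.
    rewrite ge0_integralZl ?integral_heaviside ?subr_ge0//.
    - apply/measurable_EFinP; exact: (mHH t).
    - by move=> s _; rewrite lee_fin mulr_ge0 ?heaviside_ge0.
    - by rewrite lee_fin mulr_ge0.
  rewrite -ge0_integralD//; last 4 first.
  - by move=> s _; rewrite lee_fin !mulr_ge0 ?heaviside_ge0.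
  - by apply/measurable_EFinP; exact: measurable_funM (mHH t) mg.
  - by move=> s _; rewrite -EFinM lee_fin !mulr_ge0 ?heaviside_ge0.
  - by apply: measurable_funeM; apply/measurable_EFinP; exact: (mHH t).
  apply: ge0_le_integral => //.
  - by move=> s _; rewrite lee_fin !mulr_ge0 ?heaviside_ge0.
  - apply/measurable_EFinP; apply: measurable_funM; first exact: (mHH t).
    apply: measurableT_comp => //; apply: (measurableT_comp (measurable_transform u v p t)).
    exact: measurable_funD.
  - apply: emeasurable_funD; first by apply/measurable_EFinP; exact: measurable_funM (mHH t) mg.
    by apply: measurable_funeM; apply/measurable_EFinP; exact: (mHH t).
  move=> s _; rewrite -EFinM -EFinD lee_fin.
  have [s0|s0] := ltP s 0; first by rewrite heaviside0// !mul0r mulr0 addr0.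
  have [st|ts] := leP s (t - x); last first.
    by rewrite [H (t - x - s)]heaviside0 ?subr_lt0// !mulr0 !mul0r addr0.
  rewrite !heaviside1 ?subr_ge0// !mul1r mulr1.
  rewrite (le_trans (hK t (r + s) (le_trans x0 xt)))// -addrA lerD2l /A.
  rewrite mulrDl lerD2r [leRHS]mulrAC ler_wpM2l ?mulr_ge0//.
  (* For 0 <= s <= t - x the value of K at (t, r + s) is at most the one at (x, r). *)
  rewrite /K (_ : (fun z => _) = fun z => g (s + z)); last first.
    by apply/funext => z; rewrite /g addrA.
  by apply: (kernel_bound_shift x0 s0 _ mg gT); rewrite -lerBrDl.
have ia := potential_abs pq.
have iw : L1 (fun t => A * (`|q t| * w t * (t - x))).
  apply: L1Z; apply: L1_potential_shift; apply: (@potentialM _ _ _ M) => //.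
  by move=> t _; rewrite ger0_norm//; case/andP: (wd t).
have -> : (K x r + A * (w x / 2))%:E = ((K x r)%:E + (A * (w x / 2))%:E)%E by [].
apply: (@le_trans _ _ (\int[mu]_(t in `[x, +oo[) ((`|q t|)%:E * P t) +
    \int[mu]_(t in `[x, +oo[) (A * (`|q t| * w t * (t - x)))%:E)%E).
  rewrite -ge0_integralD//; last 4 first.
  - by move=> t _; rewrite mule_ge0// lee_fin.
  - apply: emeasurable_funM; first by apply/measurable_EFinP; exact: measurable_funTS.
    exact: measurable_funTS.
  - move=> t; rewrite /= in_itv/= andbT => xt.
    by rewrite lee_fin !mulr_ge0// subr_ge0.
  - by apply/measurable_EFinP; apply: measurable_funTS; exact: L1_measurable iw.
  apply: ge0_le_integral => //.
  - by apply/measurable_EFinP; apply: measurable_funTS; exact: L1_measurable (L1_abs iN).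
  - apply: emeasurable_funD.
      apply: emeasurable_funM; first by apply/measurable_EFinP; exact: measurable_funTS.
      exact: measurable_funTS.
    by apply/measurable_EFinP; apply: measurable_funTS; exact: L1_measurable iw.
  move=> t; rewrite /= in_itv/= andbT => xt.
  rewrite normrM EFinM (_ : A * _ = `|q t| * (A * w t * (t - x))); last by ring.
  rewrite EFinM -ge0_muleDr//; last by rewrite lee_fin !mulr_ge0// subr_ge0.
  by rewrite lee_wpmul2l ?lee_fin// NP.
(* The |psi| term yields K by [tonelli_tail]; the terms carrying [w] are handled by the weight
   inequality. *)
apply: leeD.
  rewrite KE -tonelli_tail//; apply: ge0_subset_integral => //.
    by apply: emeasurable_funM => //; apply/measurable_EFinP.
  by move=> t _; rewrite mule_ge0// lee_fin.
have := ler_wpM2l A0 (wx x x0); rewrite -tailZ; last first.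
  apply: L1_potential_shift; apply: (@potentialM _ _ _ M) => //.
  by move=> t _; rewrite ger0_norm//; case/andP: (wd t).
rewrite -lee_fin /tail /Rintegral fineK//.
by apply: integrable_fin_num => //; exact: (L1S _ iw).
Qed.

Lemma transform_estimate : exists2 C, 0 <= C & forall p, positive_freq p ->
  forall x r, 0 <= x -> `|transform u v p x r - trigpoly p r| <=
    C * kernel_bound x (fun s => `|trigpoly p (r + s)|).
Proof.
have [w [d [M wM]]] := weight_exists pq; have [mw d0 wd _] := wM.
have w0 t : 0 < w t by rewrite (lt_le_trans d0)//; case/andP: (wd t).
(* With this [c] one has K + c K w / 2 <= c w K, so a step reproduces the term with [c] and only
   halves the error. *)
have [c c0 cw] : exists2 c, 0 <= c & forall t, 1 <= c * w t / 2.
  exists (2 / d) => [|t]; first by rewrite divr_ge0// ltW.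
  rewrite (_ : 2 / d * w t / 2 = w t / d); last by field; rewrite gt_eqF.
  by rewrite ler_pdivlMr// mul1r; case/andP: (wd t).
exists (c * M) => [|p pp x r x0].
  by rewrite mulr_ge0// (le_trans (ltW (w0 0)))//; case/andP: (wd 0).
pose K t y := kernel_bound t (fun s => `|trigpoly p (y + s)|).
have K0 t y : 0 <= K t y by apply: kernel_bound_ge0.
have [B B0 UB] := transform_bounded su sv pp.
have halve n t y : 0 <= t ->
   `|transform u v p t y| <= `|trigpoly p y| + c * w t * K t y + (B / d * 2^-1 ^+ n) * w t.
  elim: n t y => [|n ih] t y t0.
    rewrite expr0 mulr1 (le_trans (UB t y))// ler_wpDl ?addr_ge0 ?mulr_ge0// ?(ltW (w0 _))//.
    by rewrite mulrAC ler_pdivlMr// ler_wpM2l//; case/andP: (wd t).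
  have Dn0 : 0 <= B / d * 2^-1 ^+ n by rewrite mulr_ge0 ?exprn_ge0 ?divr_ge0// ltW.
  have := transform_estimate_step y wM pp t0 c0 Dn0 ih; rewrite -/(K t y) => h.
  rewrite -[transform _ _ _ _ _](subrK (trigpoly p y)) (le_trans (ler_normD _ _))//.
  rewrite addrC -addrA lerD2l (le_trans h)//.
  have : K t y * 1 <= K t y * (c * w t / 2) by rewrite ler_wpM2l.
  by rewrite exprSr; lra.
have final t y : 0 <= t ->
    `|transform u v p t y| <= `|trigpoly p y| + c * w t * K t y + 0 * w t.
  move=> t0; rewrite mul0r addr0 -subr_le0.
  apply: (@le0_geometric _ _ (B / d * w t)) => n.
  by rewrite lerBlDl [X in _ <= _ + X]mulrAC; exact: halve.
(* One more step with zero error converts the bound on the transform into a bound on its difference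
   from the polynomial. *)
have := transform_estimate_step r wM pp x0 c0 (lexx 0) final; rewrite -/(K x r) addr0 => h.
rewrite (le_trans h)//.
have h1 : K x r * 1 <= K x r * (c * w x / 2) by rewrite ler_wpM2l.
have h2 : c * w x * K x r <= c * M * K x r.
  by rewrite ler_wpM2r// ler_wpM2l//; case/andP: (wd x).
lra.
Qed.

End KernelBound.

(** * Composition of the operators of both potentials *)

Section ProductBound.
Variable R : realType.
Implicit Types (g w h F : R -> R) (k x y t r s L : R) (p : seq (R * R * R)).
Local Notation mu := (@lebesgue_measure R).
Local Notation H := (@heaviside R).

(** Replacing the tail at x + s by the larger tail at s removes [x] from the kernel, which makes the
    composed error a convolution. *)
Lemma transform_bound q (u v : R -> R -> R) : potential q ->
  (forall k, 0 < k -> scattering_solution q k 1 0 (u k)) ->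
  (forall k, 0 < k -> scattering_solution q k 0 1 (v k)) ->
  exists a B, [/\ L1 a, forall s, 0 <= a s <= B, forall s, s < 0 -> a s = 0 &
    forall p, positive_freq p -> forall x r, 0 <= x ->
    (`|transform u v p x r - trigpoly p r|%:E <=
      \int[mu]_s (a s * `|trigpoly p (r + s)|)%:E)%E].
Proof.
move=> pq su sv; have [C C0 est] := transform_estimate pq su sv.
have ta0 s : 0 <= tail_abs q s by exact: tail_abs_ge0.
exists (fun s => C * (H s * tail_abs q s)), (C * tail_abs q 0); split.
- by apply: L1Z; exact: L1_tail_abs.
- move=> s; rewrite !mulr_ge0 ?heaviside_ge0//= ler_wpM2l//.
  have [s0|s0] := ltP s 0; first by rewrite heaviside0// mul0r.
  by rewrite heaviside1// mul1r tail_abs_nonincreasing.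
- by move=> s s0; rewrite heaviside0// mul0r mulr0.
move=> p pp x r x0; have [T T0 pT] := trigpoly_bounded p.
pose g s := `|trigpoly p (r + s)|.
have g0 s : 0 <= g s by rewrite normr_ge0.
have mg : measurable_fun setT g.
  apply: measurableT_comp => //; apply: (measurableT_comp (@measurable_trigpoly R p)).
  exact: measurable_funD.
have gT s : `|g s| <= T by rewrite normr_id pT.
have := est p pp x r x0; rewrite -lee_fin => /le_trans; apply.
rewrite EFinM (kernel_boundE pq x0 mg gT) -ge0_integralZl//; last 2 first.
- by apply/measurable_EFinP; exact: (L1_measurable (L1_kernel_bound pq x0 mg gT)).
- by move=> s _; rewrite lee_fin !mulr_ge0 ?heaviside_ge0.
apply: ge0_le_integral => //.
- by move=> s _; rewrite -EFinM lee_fin !mulr_ge0 ?heaviside_ge0.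
- apply: measurable_funeM; apply/measurable_EFinP.
  exact: (L1_measurable (L1_kernel_bound pq x0 mg gT)).
- apply/measurable_EFinP; apply: measurable_funM => //; apply: measurable_funM => //.
  exact: (L1_measurable (L1_tail_abs pq)).
move=> s _; rewrite -EFinM lee_fin mulrA ler_wpM2r// ler_wpM2l//.
by rewrite ler_wpM2l ?heaviside_ge0// tail_abs_nonincreasing// lerDr.
Qed.

Variables (q1 q2 : R -> R) (u1 v1 u2 v2 : R -> R -> R).
Hypotheses (pq1 : potential q1) (pq2 : potential q2).
Hypothesis su1 : forall k, 0 < k -> scattering_solution q1 k 1 0 (u1 k).
Hypothesis sv1 : forall k, 0 < k -> scattering_solution q1 k 0 1 (v1 k).
Hypothesis su2 : forall k, 0 < k -> scattering_solution q2 k 1 0 (u2 k).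
Hypothesis sv2 : forall k, 0 < k -> scattering_solution q2 k 0 1 (v2 k).

Definition jost_product p x := \sum_(c <- p)
  (c.1.1 * (u1 c.2 x * u2 c.2 x - v1 c.2 x * v2 c.2 x) +
   c.1.2 * (u1 c.2 x * v2 c.2 x + v1 c.2 x * u2 c.2 x)).

(** At [r = x] the factor exp(2ikx) restores f1 f2 from the two functions exp(-ikx) f_j(x,k). *)
Lemma jost_productE p x :
  jost_product p x = transform u1 v1 (transform_coef u2 v2 x p) x x.
Proof.
rewrite /jost_product /transform big_map; apply: eq_bigr => c _ /=.
rewrite /wave_re /wave_im (_ : 2 * x - x = x); last by ring.
rewrite mulrN cosN sinN.
set co := cos _; set si := sin _.
have E : co ^+ 2 + si ^+ 2 = 1 by exact: cos2Dsin2.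
set U := u1 _ _; set V := v1 _ _; set U' := u2 _ _; set V' := v2 _ _.
transitivity ((co ^+ 2 + si ^+ 2) * (c.1.1 * (U * U' - V * V') + c.1.2 * (U * V' + V * U'))).
  by rewrite E mul1r.
by ring.
Qed.

(** If A1 and A2 denote the error operators, then (1 + A1)(1 + A2) - 1 = A1 + A2 + A1 A2, which
    explains the kernel a1 + a2 + a1 convolved with a2. *)
Lemma jost_product_bound : exists kap B, [/\ L1 kap, forall s, 0 <= kap s <= B,
    forall s, s < 0 -> kap s = 0 &
    forall p, positive_freq p -> forall x, 0 <= x ->
    (`|jost_product p x - trigpoly p x|%:E <=
      \int[mu]_s (kap s * `|trigpoly p (x + s)|)%:E)%E].
Proof.
have [a1 [B1 [i1 aB1 neg1 est1]]] := transform_bound pq1 su1 sv1.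
have [a2 [B2 [i2 aB2 neg2 est2]]] := transform_bound pq2 su2 sv2.
have a10 s : 0 <= a1 s by case/andP: (aB1 s).
have a20 s : 0 <= a2 s by case/andP: (aB2 s).
have a2B s : a2 s <= B2 by case/andP: (aB2 s).
have c0 := convolution_ge0 a10 a20.
have cB := convolution_le i1 i2 a10 a20 a2B.
have ic := L1_convolution i1 i2 a10 a20 a2B.
exists (fun s => a1 s + a2 s + convolution a1 a2 s), (B1 + B2 + B2 * \int[mu]_s a1 s); split.
- by apply: L1D => //; exact: L1D.
- move=> s; rewrite !addr_ge0//= lerD ?cB// lerD//.
  by case/andP: (aB1 s).
- move=> s s0; rewrite neg1// neg2// !add0r.
  transitivity (\int[mu]_z (0 : R)); last by rewrite Rintegral_cst ?mul0r.
  apply: eq_Rintegral => z _; have [z0|z0] := ltP z 0; first by rewrite neg1// mul0r.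
  by rewrite neg2 ?mulr0//; lra.
move=> p pp x x0; have [T T0 pT] := trigpoly_bounded p.
pose g s := `|trigpoly p (x + s)|.
have g0 s : 0 <= g s by rewrite normr_ge0.
have mg : measurable_fun setT g.
  apply: measurableT_comp => //; apply: (measurableT_comp (@measurable_trigpoly R p)).
  exact: measurable_funD.
pose th r := trigpoly (transform_coef u2 v2 x p) r.
have thE r : th r = transform u2 v2 p x r by rewrite /th -transform_trigpoly.
have m1 := L1_measurable i1; have m2 := L1_measurable i2; have mc := L1_measurable ic.
have pp' : positive_freq (transform_coef u2 v2 x p) by rewrite positive_freq_coef.
have h1 := est1 _ pp' x x x0.
have h2 r := est2 _ pp x r x0.
apply: (@le_trans _ _ (`|jost_product p x - th x|%:E + `|th x - trigpoly p x|%:E)%E).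
  by rewrite -EFinD lee_fin (_ : _ - _ = (jost_product p x - th x) + (th x - trigpoly p x)) ?ler_normD//; ring.
have -> : (\int[mu]_s ((a1 s + a2 s + convolution a1 a2 s) * `|trigpoly p (x + s)|)%:E =
    \int[mu]_s ((a1 s * g s)%:E + (convolution a1 a2 s * g s)%:E + (a2 s * g s)%:E))%E.
  by apply: eq_integral => s _; rewrite -!EFinD -/(g s); congr (_%:E); ring.
have mag (f : R -> R) : measurable_fun setT f -> measurable_fun setT (fun s => (f s * g s)%:E).
  by move=> mf; apply/measurable_EFinP; exact: measurable_funM.
rewrite ge0_integralD//; last 4 first.
- by move=> s _; rewrite adde_ge0// lee_fin mulr_ge0.
- by apply: emeasurable_funD; exact: mag.
- by move=> s _; rewrite lee_fin mulr_ge0.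
- exact: mag.
apply: leeD; last by rewrite thE; exact: h2.
rewrite jost_productE (le_trans h1)//.
rewrite ge0_integralD//; last 4 first.
- by move=> s _; rewrite lee_fin mulr_ge0.
- exact: mag.
- by move=> s _; rewrite lee_fin mulr_ge0.
- exact: mag.
rewrite -(integral_convolution i1 i2 a10 a20 a2B mg g0).
pose f (z : R * R) := (a2 z.2 * g (z.1 + z.2))%:E.
have m1' : measurable_fun setT (fst : R * R -> R) := measurable_fst.
have m2' : measurable_fun setT (snd : R * R -> R) := measurable_snd.
have mf : measurable_fun setT f.
  apply/measurable_EFinP; apply: measurable_funM; first exact: (measurableT_comp m2 m2').
  by apply: (measurableT_comp mg); exact: measurable_funD.
have f0 z : (0 <= f z)%E by rewrite lee_fin mulr_ge0.
have mif : measurable_fun setT (fun s => \int[mu]_z (a2 z * g (s + z))%:E)%E.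
  exact: (measurable_tonelli mf f0).
have if0 s : (0 <= \int[mu]_z (a2 z * g (s + z))%:E)%E.
  by apply: integral_ge0 => z _; rewrite lee_fin mulr_ge0.
rewrite -ge0_integralD//; last 4 first.
- by move=> s _; rewrite lee_fin mulr_ge0.
- exact: mag.
- by move=> s _; rewrite mule_ge0// lee_fin.
- by apply: emeasurable_funM => //; exact/measurable_EFinP.
have mth : measurable_fun setT (fun s => th (x + s)).
  by apply: (measurableT_comp (@measurable_trigpoly R _)); exact: measurable_funD.
apply: ge0_le_integral => //.
- by move=> s _; rewrite lee_fin mulr_ge0.
- by apply/measurable_EFinP; apply: measurable_funM => //; exact: measurableT_comp.
- apply: emeasurable_funD; first exact: mag.
  by apply: emeasurable_funM => //; exact/measurable_EFinP.
move=> s _; rewrite !EFinM -ge0_muleDr ?lee_fin//.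
apply: lee_wpmul2l; first by rewrite lee_fin.
rewrite -/(th (x + s)).
apply: (@le_trans _ _ ((g s)%:E + `|th (x + s) - trigpoly p (x + s)|%:E)%E).
  by rewrite -EFinD lee_fin -[th _](subrK (trigpoly p (x + s))) (le_trans (ler_normD _ _))// addrK addrC.
rewrite leeD2l// thE (le_trans (h2 _))//.
rewrite le_eqVlt; apply/orP; left; apply/eqP.
by apply: eq_integral => z _; rewrite /g addrA.
Qed.

End ProductBound.

(** * The inequality for trigonometric polynomials of positive frequency *)

Section MainInequality.
Variable R : realType.
Implicit Types (g w h F : R -> R) (k x y t r s L : R) (p : seq (R * R * R)).
Local Notation mu := (@lebesgue_measure R).

Lemma tail0E h : (forall x, x < 0 -> h x = 0) -> tail h 0 = \int[mu]_x h x.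
Proof.
move=> h0; rewrite /tail Rintegral_mkcond; apply: eq_Rintegral => x _.
rewrite patchE; have [x0|x0] := ltP x 0; last by rewrite mem_set//= in_itv/= x0.
by rewrite h0// memNset//= in_itv/= andbT leNgt x0.
Qed.

Lemma main_inequality (q1 q2 : R -> R)
    (P := fun x => (q1 \_ `[0, +oo[) x - (q2 \_ `[0, +oo[) x) :
  L11 q1 -> L11 q2 ->
  (forall k, 0 < k ->
     I_function q1 (real_complex R k) = I_function q2 (real_complex R k)) ->
  exists H B, [/\ L1 H, 0 <= B, forall r, 0 <= H r <= B * \int[mu]_(s in `]-oo, r]) `|P s| &
    forall p, positive_freq p ->
      `|\int[mu]_x (P x * trigpoly p x)| <= \int[mu]_x (H x * `|trigpoly p x|)].
Proof.
move=> hq1 hq2 hI.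
have pq1 := potential_patch hq1; have pq2 := potential_patch hq2.
have iP : L1 P by apply: L1B; [case: pq1|case: pq2].
have Pneg x : x < 0 -> P x = 0.
  by move=> x0; rewrite /P; case: pq1 => _ _ ->//; case: pq2 => _ _ ->//; rewrite subrr.
have ex q a b : potential q -> {f : R -> R -> R |
    forall k, 0 < k -> scattering_solution q k a b (f k)}.
  move=> pq; pose f k := xget (fun=> 0) [set u | scattering_solution q k a b u].
  exists f => k k0; have [u su] := scattering_solution_exists a b k0 pq.
  exact: (xgetPex (fun=> 0) (ex_intro _ _ su)).
have [u1 su1] := ex _ 1 0 pq1; have [v1 sv1] := ex _ 0 1 pq1.
have [u2 su2] := ex _ 1 0 pq2; have [v2 sv2] := ex _ 0 1 pq2.
have [kap [B [ik kB kneg est]]] := jost_product_bound pq1 pq2 su1 sv1 su2 sv2.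
have k0 s : 0 <= kap s by case/andP: (kB s).
have kB' s : kap s <= B by case/andP: (kB s).
have B0 : 0 <= B by exact: le_trans (k0 0) (kB' 0).
have iA := L1_abs iP.
have A0 x : 0 <= `|P x| by [].
have mP := L1_measurable iP; have mA := L1_measurable iA.
(* Since [kap] is at most [B] and vanishes for s < 0, the convolution at r sees only the mass of
   [|P|] up to r. *)
exists (convolution (fun x => `|P x|) kap), B; split => //.
- exact: L1_convolution kB'.
- move=> r; rewrite convolution_ge0//=.
  rewrite -RintegralZl//; last exact: (L1S _ iA).
  rewrite Rintegral_mkcond; apply: le_Rintegral => //.
  + apply: (L1M (M := B) _ _ iA) => [|s]; last by rewrite ger0_norm.
    by apply: (measurableT_comp (L1_measurable ik)); exact: measurable_funB.
  + by have := @L1_patch R `]-oo, r] _ _ (L1Z B iA); apply.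
  + move=> s _; rewrite patchE; have [sr|rs] := leP s r.
      by rewrite mem_set//= ?in_itv//= mulrC ler_wpM2r.
    by rewrite kneg ?subr_lt0// mulr0 memNset//= in_itv/= leNgt rs.
move=> p pp.
have [T T0 pT] := trigpoly_bounded p.
have mT := @measurable_trigpoly R p.
have iPT : L1 (fun x => P x * trigpoly p x) by exact: (L1M mT pT iP).
(* Each entry of [p] contributes its two coefficients times the two orthogonality relations at its
   own frequency. *)
have [iPJ PJ0] : L1 (fun x => P x * jost_product u1 v1 u2 v2 p x) /\
    \int[mu]_x (P x * jost_product u1 v1 u2 v2 p x) = 0.
  rewrite /jost_product; elim: p pp {T T0 pT mT iPT} => [_|c p ih /= /andP[c0 pp]].
    split.
      apply: (@eq_integrable _ _ _ mu setT measurableT (EFin \o (fun=> 0))); last exact: integrable0.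
      by move=> t _ /=; rewrite big_nil mulr0.
    transitivity (\int[mu]_x (0 : R)); last by rewrite Rintegral_cst ?mul0r.
    by apply: eq_Rintegral => x _; rewrite big_nil mulr0.
  have [i' e'] := ih pp.
  have bd f q a b : scattering_solution q c.2 a b f ->
      exists M, measurable_fun setT f /\ forall x, `|f x| <= M.
    by move=> [mf [M fM] _]; exists M.
  have [M1 [mu1 bu1]] := bd _ _ _ _ (su1 _ c0); have [M2 [mv1 bv1]] := bd _ _ _ _ (sv1 _ c0).
  have [M3 [mu2 bu2]] := bd _ _ _ _ (su2 _ c0); have [M4 [mv2 bv2]] := bd _ _ _ _ (sv2 _ c0).
  have iuu := L1M mu2 bu2 (L1M mu1 bu1 iP); have ivv := L1M mv2 bv2 (L1M mv1 bv1 iP).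
  have iuv := L1M mv2 bv2 (L1M mu1 bu1 iP); have ivu := L1M mu2 bu2 (L1M mv1 bv1 iP).
  have iRe : L1 (fun x => P x * (u1 c.2 x * u2 c.2 x - v1 c.2 x * v2 c.2 x)).
    by apply: eq_integrable (L1B iuu ivv) => // x _ /=; congr (_%:E); ring.
  have iIm : L1 (fun x => P x * (u1 c.2 x * v2 c.2 x + v1 c.2 x * u2 c.2 x)).
    by apply: eq_integrable (L1D iuv ivu) => // x _ /=; congr (_%:E); ring.
  have [eRe eIm] := I_function_orthogonality hq1 hq2 c0 (hI _ c0)
     (su1 _ c0) (sv1 _ c0) (su2 _ c0) (sv2 _ c0).
  rewrite tail0E in eRe; last by move=> x /Pneg; rewrite /P => ->; rewrite mul0r.
  rewrite tail0E in eIm; last by move=> x /Pneg; rewrite /P => ->; rewrite mul0r.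
  have i1 := L1D (L1Z c.1.1 iRe) (L1Z c.1.2 iIm).
  set J := fun x => _ in i' e'.
  have JE x : P x * \sum_(c <- c :: p)
      (c.1.1 * (u1 c.2 x * u2 c.2 x - v1 c.2 x * v2 c.2 x) +
       c.1.2 * (u1 c.2 x * v2 c.2 x + v1 c.2 x * u2 c.2 x)) =
      c.1.1 * (P x * (u1 c.2 x * u2 c.2 x - v1 c.2 x * v2 c.2 x)) +
      c.1.2 * (P x * (u1 c.2 x * v2 c.2 x + v1 c.2 x * u2 c.2 x)) + J x.
    by rewrite /J big_cons; ring.
  split.
    by apply: eq_integrable (L1D i1 i') => // x _ /=; rewrite JE.
  under eq_Rintegral do rewrite JE.
  rewrite RintegralD// e' addr0 RintegralD//; [|exact: L1Z|exact: L1Z].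
  by rewrite !RintegralZl// /P eRe eIm !mulr0 addr0.
have -> : \int[mu]_x (P x * trigpoly p x) =
    \int[mu]_x (P x * (trigpoly p x - jost_product u1 v1 u2 v2 p x)).
  rewrite -[LHS]subr0 -[X in _ - X]PJ0 -RintegralB//.
  by apply: eq_Rintegral => x _; rewrite mulrBr.
have iPD : L1 (fun x => P x * (trigpoly p x - jost_product u1 v1 u2 v2 p x)).
  by apply: eq_integrable (L1B iPT iPJ) => // x _ /=; rewrite mulrBr.
rewrite (le_trans (le_normr_Rintegral _ iPD))//.
have ic := L1_convolution iA ik A0 k0 kB'.
have mg : measurable_fun setT (fun x => `|trigpoly p x|) by exact: measurableT_comp.
have iR : L1 (fun x => convolution (fun x => `|P x|) kap x * `|trigpoly p x|).
  by apply: (L1M (M := T) mg _ ic) => x; rewrite normr_id.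
rewrite -lee_fin /Rintegral !fineK; last 2 first.
- by apply: integrable_fin_num => //; exact: iR.
- by apply: integrable_fin_num => //; exact: (L1_abs iPD).
rewrite -(integral_convolution iA ik A0 k0 kB' mg)//.
pose f (z : R * R) := (kap z.2 * `|trigpoly p (z.1 + z.2)|)%:E.
have m1' : measurable_fun setT (fst : R * R -> R) := measurable_fst.
have m2' : measurable_fun setT (snd : R * R -> R) := measurable_snd.
have mf : measurable_fun setT f.
  apply/measurable_EFinP; apply: measurable_funM; first exact: (measurableT_comp (L1_measurable ik) m2').
  by apply: (measurableT_comp mg); exact: measurable_funD.
have f0 z : (0 <= f z)%E by rewrite lee_fin mulr_ge0.
have mif : measurable_fun setT (fun s => \int[mu]_z (kap z * `|trigpoly p (s + z)|)%:E)%E.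
  exact: (measurable_tonelli mf f0).
apply: ge0_le_integral => //.
- by apply/measurable_EFinP; exact: (L1_measurable (L1_abs iPD)).
- by apply: emeasurable_funM => //; exact/measurable_EFinP.
move=> x _; rewrite normrM EFinM; have [x0|x0] := ltP x 0.
  by rewrite Pneg// normr0 !mul0e.
by apply: lee_wpmul2l; rewrite ?lee_fin// distrC est.
Qed.

End MainInequality.

(** * Completeness of trigonometric polynomials *)

Section TrigFunctions.
Variable R : realType.
Implicit Types (f g w h F : R -> R) (k x y t r s L : R) (p : seq (R * R * R)).
Local Notation mu := (@lebesgue_measure R).

Definition trig_fun f : Prop := exists p, forall r, f r = trigpoly p r.

Lemma trig_funD f g : trig_fun f -> trig_fun g -> trig_fun (fun r => f r + g r).
Proof.
move=> [p fp] [p' gp]; exists (p ++ p') => r.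
by rewrite fp gp /trigpoly big_cat.
Qed.

Lemma trig_funZ (a : R) f : trig_fun f -> trig_fun (fun r => a * f r).
Proof.
move=> [p fp]; exists [seq ((a * c.1.1, a * c.1.2), c.2) | c <- p] => r.
rewrite fp /trigpoly big_map mulr_sumr; apply: eq_bigr => c _ /=; ring.
Qed.

Lemma eq_trig_fun f g : (forall r, f r = g r) -> trig_fun f -> trig_fun g.
Proof. by move=> fg [p fp]; exists p => r; rewrite -fg. Qed.

Lemma trig_fun_wave (a b k : R) : trig_fun (fun r => a * cos (k * r) + b * sin (k * r)).
Proof.
exists [:: ((a, b), k / 2)] => r; rewrite /trigpoly big_seq1 /=.
by rewrite (_ : 2 * (k / 2) = k)//; field.
Qed.

Lemma trig_fun_mul_wave (a b k : R) f : trig_fun f ->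
  trig_fun (fun r => f r * (a * cos (2 * k * r) + b * sin (2 * k * r))).
Proof.
move=> [p fp].
exists ([seq (((c.1.1 * a - c.1.2 * b) / 2, (c.1.1 * b + c.1.2 * a) / 2), c.2 + k) | c <- p] ++
        [seq (((c.1.1 * a + c.1.2 * b) / 2, (c.1.2 * a - c.1.1 * b) / 2), c.2 - k) | c <- p]) => r.
rewrite fp /trigpoly big_cat !big_map /= -big_split /= mulr_suml; apply: eq_bigr => c _ /=.
rewrite (_ : 2 * (c.2 + k) * r = 2 * c.2 * r + 2 * k * r); last by ring.
rewrite (_ : 2 * (c.2 - k) * r = 2 * c.2 * r - 2 * k * r); last by ring.
by rewrite cosD sinD cosB sinB; field.
Qed.

Lemma trig_funM f g : trig_fun f -> trig_fun g -> trig_fun (fun r => f r * g r).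
Proof.
move=> tf [p gp]; apply: (@eq_trig_fun (fun r => f r * trigpoly p r)).
  by move=> r; rewrite gp.
elim: p {g gp} => [|c p ih].
  apply: eq_trig_fun (trig_funZ 0 tf) => r.
  by rewrite /trigpoly big_nil mul0r mulr0.
apply: eq_trig_fun (trig_funD (trig_fun_mul_wave c.1.1 c.1.2 c.2 tf) ih) => r.
by rewrite /trigpoly big_cons; ring.
Qed.

(** An odd polynomial that fixes -1, 0 and 1 and whose iterates push ]0, 1] towards 1; being a
    polynomial, it preserves [trig_fun]. *)
Definition smooth x : R := x * (3 - x ^+ 2) / 2.

Lemma trig_fun_smooth n f : trig_fun f -> trig_fun (fun r => iter n smooth (f r)).
Proof.
elim: n => [//|n ih] /ih tg.
have t3 := trig_funM tg (trig_funM tg tg).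
apply: eq_trig_fun (trig_funD (trig_funZ (3 / 2) tg) (trig_funZ (- 2^-1) t3)) => r.
by rewrite iterS /smooth; field.
Qed.

Lemma smoothN n x : iter n smooth (- x) = - iter n smooth x.
Proof. by elim: n => [//|n ih]; rewrite !iterS ih /smooth sqrrN !mulNr. Qed.

Lemma smooth_itv n x : 0 <= x <= 1 -> x <= iter n smooth x <= 1.
Proof.
move=> /andP[x0 x1]; elim: n => [|n /andP[xi i1]]; first by rewrite lexx.
rewrite iterS; set z := iter n smooth x in xi i1 *.
have z0 : 0 <= z by exact: le_trans xi.
(* [h1] is twice [smooth z - z], and [h2] twice [1 - smooth z]. *)
have h1 : 0 <= z * (1 - z) * (1 + z) by rewrite !mulr_ge0// ?subr_ge0// addr_ge0.
have h2 : 0 <= (1 - z) * (1 - z) * (2 + z) by rewrite !mulr_ge0// ?subr_ge0// addr_ge0.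
rewrite /smooth expr2; apply/andP; split; lra.
Qed.

Lemma smooth_le1 n x : `|x| <= 1 -> `|iter n smooth x| <= 1.
Proof.
wlog x0 : x / 0 <= x => [W|].
  have [|x0] := leP 0 x; first exact: W.
  by move=> x1; rewrite -normrN -smoothN; apply: W; rewrite ?normrN// oppr_ge0 ltW.
rewrite ger0_norm// => x1; have /andP[h1 h2] := @smooth_itv n x (introT andP (conj x0 x1)).
by rewrite ger0_norm// (le_trans x0).
Qed.

Lemma smooth_cvg x : `|x| <= 1 -> iter n smooth x @[n --> \oo] --> Num.sg x.
Proof.
have pos z : 0 < z -> z <= 1 -> iter n smooth z @[n --> \oo] --> (1 : R).
  move=> z0 z1.
  have bnd n : 1 - iter n smooth z <= (1 - z / 2) ^+ n.
    elim: n => [|n ih]; first by rewrite expr0 gerBl ltW.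
    have /andP[h1 h2] : z <= iter n smooth z <= 1 by rewrite smooth_itv// z1 ltW.
    rewrite iterS exprSr; set y := iter n smooth z in ih h1 h2 *.
    apply: (@le_trans _ _ ((1 - y) * (1 - z / 2))).
      (* Here 1 - smooth y = (1 - y)(1 - y/2 - y^2/2), so the gap shrinks at least by the factor 1 -
         z/2 as long as y >= z. *)
      have : 0 <= (1 - y) * (y - z) by rewrite mulr_ge0// subr_ge0.
      have : 0 <= (1 - y) * (y * y) by rewrite !mulr_ge0 ?subr_ge0// (le_trans (ltW z0)).
      by rewrite /smooth expr2; lra.
    rewrite ler_wpM2r//; lra.
  have c0 : (1 - z / 2) ^+ n @[n --> \oo] --> (0 : R).
    by apply: cvg_expr; rewrite ltr_norml; lra.
  have : 1 - iter n smooth z @[n --> \oo] --> (0 : R).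
    apply: squeeze_cvgr (@cvg_cst _ (0 : R) _ _ _) c0.
    apply: nearW => n; rewrite bnd andbT subr_ge0.
    by have /andP[] : z <= iter n smooth z <= 1 by rewrite smooth_itv// z1 ltW.
  move=> h; rewrite -[X in _ --> X]subr0.
  rewrite (_ : (fun n => iter n smooth z) = fun n => 1 - (1 - iter n smooth z)); last first.
    by apply/funext => n; rewrite opprB addrC subrK.
  by apply: cvgB => //; exact: cvg_cst.
move=> x1; have [x0|x0|<-] := ltgtP 0 x.
- by rewrite gtr0_sg//; apply: pos => //; rewrite (le_trans (ler_norm _)).
- rewrite ltr0_sg//.
  rewrite (_ : (fun n => iter n smooth x) = fun n => - iter n smooth (- x)); last first.
    by apply/funext => n; rewrite smoothN opprK.
  apply: cvgN; apply: pos; first by rewrite oppr_gt0.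
  by rewrite (le_trans (ler_norm _))// normrN.
- rewrite sgr0 (_ : (fun n => iter n smooth 0) = fun=> 0); first exact: cvg_cst.
  by apply/funext => n; elim: n => [//|n ih]; rewrite iterS ih /smooth !mul0r.
Qed.

Lemma trig_fun_sin_shift k (a : R) : trig_fun (fun y => sin (k * (y - a))).
Proof.
apply: eq_trig_fun (trig_fun_wave (- sin (k * a)) (cos (k * a)) k) => y.
by rewrite mulrBr sinB; ring.
Qed.

Lemma trigpoly_le p r : `|trigpoly p r| <= \sum_(c <- p) (`|c.1.1| + `|c.1.2|).
Proof.
rewrite (le_trans (ler_norm_sum _ _ _))//; apply: ler_sum => c _.
by rewrite ![_ * cos _]mulrC ![_ * sin _]mulrC norm_trig_comb ?cos_max ?sin_max.
Qed.

Lemma cvg_bigsum p (f : R * R * R -> nat -> R) (l : R * R * R -> R) :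
  (forall c, f c @ \oo --> l c) ->
  \sum_(c <- p) f c n @[n --> \oo] --> \sum_(c <- p) l c.
Proof.
move=> fl; elim: p => [|c p ih].
  rewrite big_nil (_ : (fun n => _) = fun=> 0); first exact: cvg_cst.
  by apply/funext => n; rewrite big_nil.
rewrite big_cons (_ : (fun n => _) = fun n => f c n + \sum_(e <- p) f e n).
  by apply: cvgD => //; exact: fl.
by apply/funext => n; rewrite big_cons.
Qed.

(** * Extending the inequality by bounded pointwise limits *)

Section Closure.
Variables P H : R -> R.
Hypotheses (iP : L1 P) (iH : L1 H).

Definition dominated f := measurable_fun setT f /\
  `|\int[mu]_x (P x * f x)| <= \int[mu]_x (H x * `|f x|).

Lemma dominated_lim (f_ : nat -> R -> R) f M :
  (forall n x, `|f_ n x| <= M) ->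
  (forall x, f_ ^~ x @ \oo --> f x) -> (forall n, dominated (f_ n)) ->
  dominated f.
Proof.
move=> fM ff df; have mf n := (df n).1.
split; first by apply: (measurable_fun_cvg mf) => x _; exact: ff.
have [||||_ /(_ setT measurableT) c1] := @L1_dominated R (fun n x => P x * f_ n x) (fun x => P x * f x)
    (fun x => M * `|P x|).
- by move=> n; apply: measurable_funM => //; exact: L1_measurable.
- by move=> x; apply: cvgM; [exact: cvg_cst|exact: ff].
- exact/L1Z/L1_abs.
- by move=> n x; rewrite normrM mulrC ler_wpM2r.
have [||||_ /(_ setT measurableT) c2] := @L1_dominated R (fun n x => H x * `|f_ n x|) (fun x => H x * `|f x|)
    (fun x => M * `|H x|).
- move=> n; apply: measurable_funM; first exact: L1_measurable.
  exact: measurableT_comp.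
- by move=> x; apply: cvgM; [exact: cvg_cst|apply: cvg_norm; exact: ff].
- exact/L1Z/L1_abs.
- by move=> n x; rewrite normrM normr_id mulrC ler_wpM2r.
apply: (ler_cvg_to (cvg_norm c1) c2); apply: nearW => n; exact: (df n).2.
Qed.

Hypothesis domP : forall p, positive_freq p ->
  `|\int[mu]_x (P x * trigpoly p x)| <= \int[mu]_x (H x * `|trigpoly p x|).

(** Frequency 0 is reached by shifting all frequencies by 1 / (n + 1); the coefficients give a bound
    independent of n. *)
Lemma dominated_nonneg p : all (fun c => 0 <= c.2) p -> dominated (trigpoly p).
Proof.
move=> pp.
pose pn n := [seq (c.1, c.2 + n.+1%:R^-1) | c <- p].
apply: (@dominated_lim (fun n => trigpoly (pn n)) _ (\sum_(c <- p) (`|c.1.1| + `|c.1.2|))).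
- by move=> n x; rewrite (le_trans (trigpoly_le _ _))// big_map.
- move=> x; rewrite /trigpoly /pn.
  rewrite (_ : (fun n => _) = fun n => \sum_(c <- p) (c.1.1 * cos (2 * (c.2 + n.+1%:R^-1) * x) +
      c.1.2 * sin (2 * (c.2 + n.+1%:R^-1) * x))); last first.
    by apply/funext => n; rewrite big_map.
  apply: cvg_bigsum => c.
  have cl : 2 * (c.2 + n.+1%:R^-1) * x @[n --> \oo] --> 2 * c.2 * x.
    apply: cvgM; last exact: cvg_cst.
    apply: cvgM; first exact: cvg_cst.
    rewrite -[X in _ --> X]addr0; apply: cvgD; first exact: cvg_cst.
    exact: cvg_harmonic.
  apply: cvgD; apply: cvgM; [exact: cvg_cst| |exact: cvg_cst|].
    by apply: (continuous_cvg _ _ cl); exact: continuous_cos.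
  by apply: (continuous_cvg _ _ cl); exact: continuous_sin.
- move=> n; split; first exact: measurable_trigpoly.
  apply: domP; rewrite /positive_freq all_map.
  by apply: sub_all pp => c /= c0; rewrite ltr_wpDl.
Qed.

(** Parity of cosine and sine turns a negative frequency into a positive one. *)
Lemma dominated_trig f : trig_fun f -> dominated f.
Proof.
move=> [p fp]; rewrite (_ : f = trigpoly [seq
    (if 0 <= c.2 then c else ((c.1.1, - c.1.2), - c.2)) | c <- p]).
  apply: dominated_nonneg; rewrite all_map; apply/allP => c _ /=.
  by case: ifPn => //=; rewrite -ltNge oppr_ge0 => /ltW.
apply/funext => r; rewrite fp /trigpoly big_map; apply: eq_bigr => c _.
by case: ifPn => //= _; rewrite mulrN mulNr cosN sinN; ring.
Qed.

(** Both signs are approximated together: [dominated] does not pass to sums, whereas the difference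
    of the approximants is itself a trigonometric function. *)
Lemma dominated_sg_sin k (a b : R) :
  dominated (fun y => Num.sg (sin (k * (y - a))) - Num.sg (sin (k * (y - b)))).
Proof.
apply: (@dominated_lim (fun n y => iter n smooth (sin (k * (y - a))) -
    iter n smooth (sin (k * (y - b)))) _ 2).
- move=> n y; rewrite (le_trans (ler_normB _ _))// (_ : 2 = 1 + 1)// lerD//.
    by apply: smooth_le1; exact: sin_max.
  by apply: smooth_le1; exact: sin_max.
- by move=> y; apply: cvgB; apply: smooth_cvg; exact: sin_max.
- move=> n; apply: dominated_trig.
  apply: eq_trig_fun (trig_funD (trig_fun_smooth n (trig_fun_sin_shift k a))
     (trig_funZ (-1) (trig_fun_smooth n (trig_fun_sin_shift k b)))) => y.
  by rewrite mulN1r.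
Qed.

Lemma dominated_step (a b : R) : dominated (fun y => Num.sg (y - a) - Num.sg (y - b)).
Proof.
have sg1 x : `|Num.sg x| <= 1 by rewrite normr_sg; case: (x != 0).
have sgl (c y : R) : Num.sg (sin (n.+1%:R^-1 * (y - c))) @[n --> \oo] --> Num.sg (y - c).
  apply: cvg_near_cst.
  have : (n.+1%:R^-1 : R) @[n --> \oo] --> (0 : R) by exact: cvg_harmonic.
  have d1 : 0 < `|y - c| + 1 by rewrite ltr_wpDl.
  (* A frequency below this bound gives |k (y - c)| < pi, where the sine has the sign of its
     argument. *)
  have d0 : 0 < pi / (`|y - c| + 1) by rewrite divr_gt0// pi_gt0.
  move=> /cvgr0Pnorm_lt/(_ _ d0); apply: filterS => n.
  rewrite ger0_norm ?invr_ge0// ltr_pdivlMr// mulrDr mulr1 => nlt.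
  have n0 : 0 < n.+1%:R^-1 :> R by rewrite invr_gt0.
  have npi : n.+1%:R^-1 * `|y - c| < pi.
    by rewrite (le_lt_trans _ nlt)// lerDl ltW.
  have [yc|yc|yc] := ltgtP 0 (y - c).
  - rewrite !gtr0_sg// sin_gt0_pi// mulr_gt0//=.
    by rewrite gtr0_norm in npi.
  - rewrite !ltr0_sg// -oppr_gt0 -sinN sin_gt0_pi// -mulrN mulr_gt0 ?oppr_gt0//=.
    by rewrite ltr0_norm in npi.
  - by rewrite -yc mulr0 sin0 sgr0.
apply: (@dominated_lim (fun n y => Num.sg (sin (n.+1%:R^-1 * (y - a))) -
   Num.sg (sin (n.+1%:R^-1 * (y - b)))) _ 2).
- move=> n y; rewrite (le_trans (ler_normB _ _))// (_ : 2 = 1 + 1)// lerD//.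
- by move=> y; apply: cvgB; exact: sgl.
- by move=> n; exact: dominated_sg_sin.
Qed.

(** Moving the endpoints slightly to the left makes the limiting sign at each endpoint +1, so the
    limit is exactly twice the indicator of the half-open interval. *)
Lemma dominated_itv (a b : R) : a <= b ->
  `|\int[mu]_(x in `[a, b[) P x| <= \int[mu]_(x in `[a, b[) H x.
Proof.
move=> ab; pose chi y : R := \1_(`[a, b[%classic : set R) y.
have sg1 x : `|Num.sg x| <= 1 by rewrite normr_sg; case: (x != 0).
have sgl (c y : R) : Num.sg (y - (c - n.+1%:R^-1)) @[n --> \oo] -->
    (if c <= y then 1 else -1 : R).
  apply: cvg_near_cst; case: leP => [cy|yc].
    apply: nearW => n; rewrite gtr0_sg// opprB addrCA addrC -[ltRHS]addrC.
    by rewrite ltr_wpDr ?subr_ge0// invr_gt0.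
  have : (n.+1%:R^-1 : R) @[n --> \oo] --> (0 : R) by exact: cvg_harmonic.
  have d0 : 0 < c - y by rewrite subr_gt0.
  move=> /cvgr0Pnorm_lt/(_ _ d0); apply: filterS => n.
  rewrite ger0_norm ?invr_ge0//; move: (_^-1) => e nlt.
  have : y - (c - e) < 0 by rewrite subr_lt0 ltrBrDr addrC -ltrBrDr.
  by move=> /ltr0_sg ->.
have [_] : dominated (fun y => 2 * chi y).
  apply: (@dominated_lim (fun n y => Num.sg (y - (a - n.+1%:R^-1)) -
     Num.sg (y - (b - n.+1%:R^-1))) _ 2).
  - by move=> n y; rewrite (le_trans (ler_normB _ _))// (_ : 2 = 1 + 1)// lerD.
  - move=> y; rewrite (_ : 2 * chi y = (if a <= y then 1 else -1) - (if b <= y then 1 else -1)).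
      by apply: cvgB; exact: sgl.
    rewrite /chi indicE; case: (leP a y) => [ay|ya]; last first.
      rewrite memNset; last by rewrite /= in_itv/= leNgt ya.
      by rewrite leNgt (lt_le_trans ya ab) mulr0 subrr.
    case: (leP b y) => [by_|yb].
      rewrite memNset; last by rewrite /= in_itv/= ay ltNge by_.
      by rewrite mulr0 subrr.
    by rewrite mem_set/= ?in_itv/= ?ay// mulr1 opprK.
  - by move=> n; exact: dominated_step.
have chiE (F : R -> R) : \int[mu]_x (F x * (2 * chi x)) = \int[mu]_x ((fun x => 2 * F x) \_ `[a, b[) x.
  apply: eq_Rintegral => x _; rewrite patchE /chi indicE.
  by case: ifPn => _; rewrite ?mulr1 ?mulr0// mulrC.
have -> : \int[mu]_x (H x * `|2 * chi x|) = \int[mu]_x (H x * (2 * chi x)).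
  by apply: eq_Rintegral => x _; rewrite ger0_norm// mulr_ge0.
rewrite !chiE -!Rintegral_mkcond !RintegralZl//; [|exact: (L1S _ iH)|exact: (L1S _ iP)].
by rewrite normrM ger0_norm// ler_pM2l.
Qed.

End Closure.
End TrigFunctions.

(** * Differentiation of the inequality and a Gronwall argument *)

Section Gronwall.
Variable R : realType.
Implicit Types (f g w h F : R -> R) (k x y t r s L : R).
Local Notation mu := (@lebesgue_measure R).

Variables (P : R -> R) (B : R).
Hypotheses (iP : L1 P) (B0 : 0 <= B).

Let mass r := \int[mu]_(s in `]-oo, r]) `|P s|.

Let iA : L1 (fun x => `|P x|) := L1_abs iP.

Let massE r : mass r = \int[mu]_s `|P s| - tail (fun s => `|P s|) r.
Proof. by rewrite tailE// opprB addrC subrK. Qed.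

Let mass_nondecreasing x y : x <= y -> mass x <= mass y.
Proof. by move=> xy; rewrite !massE lerD2l lerN2 tail_nonincreasing. Qed.

Let mass_ge0 x : 0 <= mass x.
Proof. by apply: Rintegral_ge0. Qed.

Lemma ae_le_mass :
  (forall a b, a <= b -> `|\int[mu]_(x in `[a, b[) P x| <= B * mass b * (b - a)) ->
  {ae mu, forall x, `|P x| <= B * mass x}.
Proof.
move=> hP; have := ae_is_derive_tail iP.
apply: filterS; first exact: (ae_filter_ringOfSetsType mu).
move=> x dP; apply/ler_addgt0Pr => e e0.
have e20 : 0 < e / 2 by rewrite divr_gt0.
have [r1 r10 h1] := is_derive_dist dP e20.
(* One half of [e] pays for differentiating [tail P], the other for the growth of the mass between
   [x] and [y]; the 1 covers [B = 0]. *)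
have e3 : 0 < e / 2 / (B + 1) by rewrite !divr_gt0// ltr_wpDl.
have /cvgrPdist_lt/(_ _ e3)[r2 /= r20 h2] := continuous_tail iA (x := x).
pose y := x + Num.min r1 r2 / 2.
have m0 : 0 < Num.min r1 r2 by rewrite lt_min r10.
have yx : 0 < y - x by rewrite /y addrAC subrr add0r divr_gt0.
have ym : `|y - x| < Num.min r1 r2.
  rewrite gtr0_norm// /y addrAC subrr add0r gtr_pMr// invf_lt1// ltr1n//.
have := h1 y; rewrite (lt_le_trans ym) ?ge_min ?lexx// => /(_ isT) {}h1.
have {}h2 : mass y <= mass x + e / 2 / (B + 1).
  have := h2 y; rewrite /ball/= distrC (lt_le_trans ym) ?ge_min ?lexx ?orbT// => /(_ isT).
  by rewrite !massE => /ltr_normlW; lra.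
have := hP x y; rewrite -subr_ge0 (ltW yx) => /(_ isT).
rewrite -tailB_itv//; last by rewrite -subr_ge0 ltW.
rewrite (gtr0_norm yx) in h1.
move=> h3; rewrite -(ler_pM2r yx).
rewrite -[y - x in leLHS]gtr0_norm// -normrM.
rewrite (_ : P x * (y - x) = (tail P x - tail P y) +
   (tail P y - tail P x - - P x * (y - x))); last by ring.
rewrite (le_trans (ler_normD _ _))// (le_trans (lerD h3 h1))//.
rewrite -mulrDl ler_wpM2r ?(ltW yx)//.
have : B * mass y <= B * (mass x + e / 2 / (B + 1)) by rewrite ler_wpM2l.
have : B * (e / 2 / (B + 1)) <= e / 2.
  rewrite mulrA ler_pdivrMr ?ltr_wpDl// mulrDr mulr1 mulrC lerDl ltW//.
lra.
Qed.

(** The mass gained on [x, y] is at most B (y - x) times the mass at y; over steps with B (y - x) <=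
    1/2, vanishing propagates from x to y. *)
Lemma mass_eq0 : (forall x, x < 0 -> P x = 0) ->
  {ae mu, forall x, `|P x| <= B * mass x} -> forall x, mass x = 0.
Proof.
move=> Pneg PB.
have step x y : x <= y -> mass y - mass x <= B * mass y * (y - x).
  move=> xy; have -> : mass y - mass x = \int[mu]_(s in `[x, y[) `|P s|.
    by rewrite !massE -tailB_itv//; ring.
  rewrite -lee_fin /Rintegral fineK; last first.
    by apply: integrable_fin_num => //; exact: (L1S _ iA).
  apply: (@le_trans _ _ (\int[mu]_(s in `[x, y[) (B * mass y)%:E)%E).
    apply: ae_ge0_le_integral => //.
    - by apply/measurable_EFinP; apply: measurable_funTS; exact: L1_measurable iA.
    - by move=> s _; rewrite lee_fin mulr_ge0.
    move: PB; apply: filterS; first exact: (ae_filter_ringOfSetsType mu).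
    move=> s Ps; rewrite /= in_itv/= => /andP[_ sy]; rewrite lee_fin (le_trans Ps)//.
    by rewrite ler_wpM2l// mass_nondecreasing// ltW.
  rewrite integral_cst// [X in (_ * X)%E](lebesgue_measure_itv `[x, y[)/= lte_fin.
  case: ltP => [_|yx]; first by rewrite -EFinD -EFinM.
  by rewrite mule0 lee_fin mulr_ge0 ?mulr_ge0// subr_ge0.
have m0 : mass 0 = 0.
  by rewrite massE tail0E ?subrr// => x /Pneg ->; rewrite normr0.
pose d := (2 * B + 1)^-1.
have k0 : 0 < 2 * B + 1 by rewrite ltr_wpDl// mulr_ge0.
have d0 : 0 < d by rewrite invr_gt0.
have Bd : B * d <= 1 / 2 by rewrite /d ler_pdivrMr//; lra.
have mn n : mass (n%:R * d) = 0.
  elim: n => [|n ih]; first by rewrite mul0r.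
  have := step (n%:R * d) (n.+1%:R * d); rewrite ih subr0 -natr1 mulrDl mul1r lerDl (ltW d0).
  move=> /(_ isT); rewrite addrAC subrr add0r; set m := mass _ => h.
  have mge : 0 <= m by exact: mass_ge0.
  have : m * (B * d) <= m * (1 / 2) by rewrite ler_wpM2l.
  by lra.
move=> x; apply/eqP; rewrite eq_le mass_ge0 andbT.
have xn : x <= (Num.bound (`|x| / d))%:R * d.
  rewrite -ler_pdivrMr// (le_trans _ (ltW (archi_boundP _)))//.
    by rewrite ler_pM2r ?invr_gt0// ler_norm.
  by rewrite divr_ge0// ltW.
by rewrite (le_trans (mass_nondecreasing xn))// mn.
Qed.

End Gronwall.

Theorem theorem3p1p2 (R : realType) (q1 q2 : R -> R)
    (hq1 : L11 q1) (hq2 : L11 q2)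
    (hI : forall k : R, 0 < k ->
       I_function q1 (real_complex R k) = I_function q2 (real_complex R k)) :
  {ae (@lebesgue_measure R), forall x : R, 0 <= x -> q1 x = q2 x}.
Proof.
pose P := fun x => (q1 \_ `[0, +oo[) x - (q2 \_ `[0, +oo[) x.
have pq1 := potential_patch hq1; have pq2 := potential_patch hq2.
have iP : L1 P by apply: L1B; [case: pq1|case: pq2].
have Pneg x : x < 0 -> P x = 0.
  by move=> x0; rewrite /P; case: pq1 => _ _ ->//; case: pq2 => _ _ ->//; rewrite subrr.
have [H [B [iH B0 HB domP]]] := main_inequality hq1 hq2 hI.
have iA := L1_abs iP.
have PB : {ae lebesgue_measure, forall x, `|P x| <= B * \int[lebesgue_measure]_(s in `]-oo, x]) `|P s|}.
  apply: (ae_le_mass iP B0) => a b ab.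
  rewrite (le_trans (dominated_itv iP iH domP ab))//.
  set m := B * _.
  have m0 : 0 <= m by rewrite mulr_ge0// Rintegral_ge0.
  have muab : lebesgue_measure (`[a, b[%classic : set R) = (b - a)%:E.
    rewrite (lebesgue_measure_itv `[a, b[)/= lte_fin -EFinD; case: ltP => // ba.
    by rewrite (@le_anti _ _ a b) ?subrr// ab.
  have icst : lebesgue_measure.-integrable `[a, b[ (EFin \o cst m).
    apply: measurable_bounded_integrable => //.
      by rewrite [X in (X < _)%E]muab ltry.
    exists m; split; first exact: ger0_real.
    by move=> M /ltW mM x _; rewrite /= ger0_norm.
  apply: (@le_trans _ _ (\int[lebesgue_measure]_(x in `[a, b[) m)).
    apply: le_Rintegral => //; first exact: (L1S _ iH).
    move=> x; rewrite /= in_itv/= => /andP[_ xb].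
    (* On [a, b[ the bound on [H] increases with the point, so its value at [b] serves
       throughout. *)
    have /andP[_ h] := HB x; rewrite (le_trans h)// ler_wpM2l//.
    by apply: subset_Rintegral => // t; rewrite /= !in_itv/= => /le_trans; apply; exact: ltW.
  by rewrite Rintegral_cst// [X in fine X]muab.
have m0 := mass_eq0 iP B0 Pneg PB.
move: PB; apply: filterS; first exact: (ae_filter_ringOfSetsType lebesgue_measure).
move=> x; rewrite m0 mulr0 normr_le0 => /eqP + x0.
by rewrite /P !patchE !mem_set/= ?in_itv/= ?x0// => /eqP; rewrite subr_eq0 => /eqP.
Qed.
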